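(* Let $X$ be a Fréchet space, $x_0\in X$, and let $\Gamma:[0,1]\to ck(X)$ be Bochner measurable and Pettis integrable in $ck(X)$. Let $F:[0,1]\times X\to ck(X)$ satisfy: (1) for every $x\in C([0,1],X)$ the multifunction $t\mapsto F(t,x(t))$ is Bochner measurable; (2) for every $t\in[0,1]$, $x\mapsto F(t,x)$ is upper semicontinuous; (3) $F(t,x)\subseteq\Gamma(t)$ for all $t\in[0,1]$, $x\in X$. Let $k:[0,1]\times[0,1]\to\mathbb R$ be such that $k(t,\cdot)\in L^\infty([0,1])$ for each $t$ and $t\mapsto k(t,\cdot)$ is continuous into $L^\infty([0,1])$. Then the Volterra integral inclusion $$x(t)\in x_0+\int_0^tk(t,s)F(s,x(s))ds,\qquad t\in[0,1],$$ has a solution $x\in C([0,1],X)$.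
   Context: $X$ is a Fréchet space with metric $d$ induced by an increasing sufficient sequence of seminorms; $X^*$ its dual. $ck(X)$ (resp. $cb(X)$): nonempty compact (resp. closed bounded) convex subsets; $H$ the Hausdorff metric from $d$. $\sigma(x^*,C)=\sup_{x\in C}\langle x^*,x\rangle$. Bochner measurable: there are simple multifunctions $\sum_j\chi_{A_j}C_j$ ($A_j$ pairwise disjoint measurable, $C_j\in cb(X)$) converging to the multifunction in $H$ a.e. Pettis integrable in $ck(X)$: $\sigma(x^*,\Gamma(\cdot))$ Lebesgue integrable for all $x^*$ and for each measurable $E$ there is $x_E\in ck(X)$ with $\sigma(x^*,x_E)=\int_E\sigma(x^*,\Gamma)dt$ for all $x^*$. A Pettis integrable function $f:[0,1]\to X$: $\langle x^*,f\rangle$ integrable for every $x^*$ and for each measurable $E$ there is $(P)\int_Ef\in X$ with $\langle x^*,(P)\int_Ef\rangle=\int_E\langle x^*,f\rangle$. $C([0,1],X)$: continuous maps $[0,1]\to X$. The set-valued integral $\int_0^tk(t,s)F(s,x(s))ds$ is the set of $(P)\int_0^tk(t,s)f(s)ds$ with $f$ a Pettis integrable selection (i.e. $f(s)\in F(s,x(s))$ a.e.) of $s\mapsto F(s,x(s))$. *)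

(* Defs.v *)
From mathcomp Require Import all_boot all_algebra.
From mathcomp Require Import all_classical all_reals all_analysis.
Import GRing.Theory Num.Theory numFieldNormedType.Exports.
Set Implicit Arguments.
Unset Strict Implicit.
Unset Printing Implicit Defensive.
Local Open Scope classical_set_scope.
Local Open Scope ring_scope.

(* The measurable space of (Lebesgue-)measurable subsets of R: carrier R,
   sigma-algebra = Caratheodory sets = completion of the Borel sets. *)
Definition lebT (R : realType) :=
  caratheodory_type (R:=R) (wlength (R:=R) idfun)^*%mu.

Section Defs.
Variables (R : realType) (X : lmodType R) (p : nat -> X -> R).

Definition seminorm (q : X -> R) :=
  (forall x y, q (x + y) <= q x + q y) /\ (forall (a : R) x, q (a *: x) = `|a| * q x).

Definition fdist (x y : X) : R :=
  limn (series (fun n => (2 ^+ n)^-1 * (p n (x - y) / (1 + p n (x - y))))).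

Definition fcauchy (u : nat -> X) :=
  forall e : R, 0 < e -> exists N, forall m n, (N <= m)%N -> (N <= n)%N ->
    fdist (u m) (u n) < e.

Definition fconv (u : nat -> X) (x : X) :=
  forall e : R, 0 < e -> exists N, forall n, (N <= n)%N -> fdist (u n) x < e.

Definition is_frechet :=
  [/\ forall n, seminorm (p n),
      forall n x, p n x <= p n.+1 x,
      forall x, (forall n, p n x = 0) -> x = 0
    & forall u, fcauchy u -> exists x, fconv u x].

Definition fopen (U : set X) :=
  forall x, U x -> exists e : R, 0 < e /\ forall y, fdist x y < e -> U y.
Definition fclosed (C : set X) := fopen (~` C).
Definition fcompact (K : set X) :=
  forall (I : Type) (U : I -> set X), (forall i, fopen (U i)) ->
    K `<=` \bigcup_i U i ->
    exists J : set I, finite_set J /\ K `<=` \bigcup_(i in J) U i.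
Definition fbounded (C : set X) :=
  forall n, exists M : R, forall x, C x -> p n x <= M.
Definition convex_set (C : set X) :=
  forall x y (l : R), C x -> C y -> 0 <= l <= 1 -> C (l *: x + (1 - l) *: y).

Definition ck (C : set X) := [/\ C !=set0, fcompact C & convex_set C].
Definition cb (C : set X) := [/\ C !=set0, fclosed C, fbounded C & convex_set C].

Definition hexcess (A B : set X) : R :=
  sup [set r | exists a, A a /\ r = inf [set fdist a b | b in B]].
Definition hdist (A B : set X) : R := Num.max (hexcess A B) (hexcess B A).

Definition dual (f : X -> R) :=
  (forall (a : R) x y, f (a *: x + y) = a * f x + f y) /\
  (forall x (e : R), 0 < e -> exists d : R, 0 < d /\
     forall y, fdist x y < d -> `|f y - f x| < e).

Definition suppf (xs : X -> R) (C : set X) : R := sup [set xs x | x in C].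

Local Notation mu := (@completed_lebesgue_measure R).
Definition I01 : set R := `[0, 1].
Definition Lmeas (E : set R) := measurable (E : set (lebT R)).

Definition msum (A B : set X) : set X :=
  [set z | exists a b, A a /\ B b /\ z = a + b].
Definition chi (A : set R) (C : set X) (t : R) : set X :=
  if `[< A t >] then C else [set 0].
Definition simple_val (s : seq (set R * set X)) (t : R) : set X :=
  foldr (fun q acc => msum (chi q.1 q.2 t) acc) [set 0] s.

Definition is_simple_mf (S : R -> set X) :=
  exists s : seq (set R * set X),
    [/\ forall i j, (i < size s)%N -> (j < size s)%N -> i != j ->
          (nth (set0, set0) s i).1 `&` (nth (set0, set0) s j).1 = set0,
        forall i, (i < size s)%N ->
          Lmeas (nth (set0, set0) s i).1 /\ (nth (set0, set0) s i).1 `<=` I01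
          /\ cb (nth (set0, set0) s i).2
      & S = simple_val s].

Definition bochner_meas (G : R -> set X) :=
  exists S : nat -> R -> set X, (forall n, is_simple_mf (S n)) /\
    {ae mu, forall t, I01 t -> (fun n => hdist (S n t) (G t)) @ \oo --> 0}.

Definition pettis_ck (G : R -> set X) :=
  (forall xs, dual xs ->
     mu.-integrable (I01 : set (lebT R)) (fun t => (suppf xs (G t))%:E)) /\
  (forall E, Lmeas E -> E `<=` I01 -> exists xE, ck xE /\
     forall xs, dual xs ->
       (suppf xs xE)%:E = (\int[mu]_(t in (E : set (lebT R))) (suppf xs (G t))%:E)%E).

Definition is_pettis_integral (D : set R) (g : R -> X) (y : X) :=
  forall xs, dual xs ->
    mu.-integrable (D : set (lebT R)) (fun t => (xs (g t))%:E) /\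
    (xs y)%:E = (\int[mu]_(t in (D : set (lebT R))) (xs (g t))%:E)%E.

Definition pettis_integrable (D : set R) (g : R -> X) :=
  (forall xs, dual xs ->
     mu.-integrable (D : set (lebT R)) (fun t => (xs (g t))%:E)) /\
  (forall E, Lmeas E -> E `<=` D -> exists y, is_pettis_integral E g y).

Definition fcont01 (x : R -> X) :=
  forall t, I01 t -> forall e : R, 0 < e -> exists d : R, 0 < d /\
    forall s, I01 s -> `|s - t| < d -> fdist (x s) (x t) < e.

Definition usc (G : X -> set X) :=
  forall x V, fopen V -> G x `<=` V ->
    exists d : R, 0 < d /\ forall y, fdist x y < d -> G y `<=` V.

Definition Linf01 (h : R -> R) :=
  measurable_fun (I01 : set (lebT R)) h /\
  exists M : R, {ae mu, forall s, I01 s -> `|h s| <= M}.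

Definition kernel_cont (k : R -> R -> R) :=
  forall t, I01 t -> forall e : R, 0 < e -> exists d : R, 0 < d /\
    forall t', I01 t' -> `|t - t'| < d ->
      {ae mu, forall s, I01 s -> `|k t s - k t' s| <= e}.

Definition vint (k : R -> R -> R) (F : R -> X -> set X) (x : R -> X) (t : R) : set X :=
  [set y | exists f : R -> X,
     [/\ pettis_integrable I01 f,
         {ae mu, forall s, I01 s -> F s (x s) (f s)},
         pettis_integrable `[0, t] (fun s => k t s *: f s)
       & is_pettis_integral `[0, t] (fun s => k t s *: f s) y]].

End Defs.

(* Main.v *)
(** Tonelli's method: the inclusion with the argument of [F] delayed by [h] is solved
    step by step, using only measurable selections of [F(s, x(s))].  All selections
    of [Gamma] are Pettis integrable, and gluing selections together with the
    Orlicz-Pettis theorem shows that they are uniformly integrable in the sense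
    required for their primitives to be bounded and equicontinuous, uniformly over
    the selections; indefinite integrals lie in compact sets, so an ultrafilter limit
    and an Arzela-Ascoli argument give delayed solutions [x_n] (for [h = 1/n])
    converging to a continuous [x].  The selections [f_n] themselves need not
    converge; but a quadratic functional built from a separating sequence of
    functionals yields, by the parallelogram identity, iterated midpoints [g_j] of
    tails of [(f_n)] along which these functionals converge almost everywhere.
    Compactness of [Gamma s] then gives a pointwise limit [g], upper semicontinuity
    and convexity give [g s] in [F(s, x(s))], and dominated convergence identifies
    [x] with the primitive of [g]. *)

Require Import Defs.
From mathcomp Require Import all_boot all_order all_algebra.
From mathcomp Require Import all_classical all_reals all_analysis measurable_realfun.
From mathcomp Require Import ring lra zify.
Import Order.TTheory GRing.Theory Num.Theory numFieldNormedType.Exports.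
Set Implicit Arguments.
Unset Strict Implicit.
Unset Printing Implicit Defensive.
Local Open Scope classical_set_scope.
Local Open Scope ring_scope.

(** * The metric and the seminorms of a Frechet space *)

(** Every integral below is therefore tested against functionals, and an estimate in [p m] is proved
    uniformly over the functionals bounded by [p m], whose supremum recovers the seminorm. Neither
    [X] nor its dual is assumed separable; countability enters only through Bochner measurability,
    which places almost all values [Gamma t] in the closure of one countable set. Limits along a
    nonprincipal ultrafilter on [nat] replace diagonal extraction, but dominated convergence needs
    genuine sequences, so a true subsequence is extracted before the selections are treated. The
    delay answers the hypothesis on [F], which speaks only of compositions with continuous
    functions: at each step the delayed argument is an already known continuous function. Points are
    recovered from their prescribed values under functionals by a least-squares argument on a
    compact convex set; this places the integral of every selection in the compact set that
    integrates [Gamma]. *)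

Section FrechetMetric.
Variables (R : realType) (X : lmodType R) (p : nat -> X -> R).
Hypothesis Xf : is_frechet p.

Let p_seminorm m : seminorm (p m). Proof. by case: Xf. Qed.

Lemma snD m x y : p m (x + y) <= p m x + p m y.
Proof. by case: (p_seminorm m). Qed.

Lemma snZ m a x : p m (a *: x) = `|a| * p m x.
Proof. by case: (p_seminorm m). Qed.

Lemma sn0 m : p m 0 = 0.
Proof. by rewrite -(scale0r 0) snZ normr0 mul0r. Qed.

Lemma snN m x : p m (- x) = p m x.
Proof. by rewrite -scaleN1r snZ normrN normr1 mul1r. Qed.

Lemma sn_ge0 m x : 0 <= p m x.
Proof. by have := snD m x (- x); rewrite subrr sn0 snN; lra. Qed.

Lemma snC m x y : p m (x - y) = p m (y - x).
Proof. by rewrite -opprB snN. Qed.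

Lemma sn_tri m y x z : p m (x - z) <= p m (x - y) + p m (y - z).
Proof. by rewrite -[x - z](subrKA y) snD. Qed.

Lemma sn_le m n x : (m <= n)%N -> p m x <= p n x.
Proof.
elim: n => [|n IH]; first by rewrite leqn0 => /eqP ->.
rewrite leq_eqVlt => /predU1P[-> //|]; rewrite ltnS => /IH /le_trans; apply.
by case: Xf.
Qed.

Let phi (a : R) := a / (1 + a).
Let term x y n := (2 ^+ n)^-1 * phi (p n (x - y)).

Let phi_ge0 a : 0 <= a -> 0 <= phi a.
Proof. by move=> a0; rewrite /phi divr_ge0//; lra. Qed.

Let phi_lt1 a : 0 <= a -> phi a < 1.
Proof. by move=> a0; rewrite /phi ltr_pdivrMr; lra. Qed.

Let phi_le a b : 0 <= a -> a <= b -> phi a <= phi b.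
Proof.
move=> a0 ab; rewrite /phi ler_pdivrMr; last lra.
by rewrite mulrAC ler_pdivlMr; nra.
Qed.

Let phi_leid a : 0 <= a -> phi a <= a.
Proof. by move=> a0; rewrite /phi ler_pdivrMr; nra. Qed.

Let phiD a b : 0 <= a -> 0 <= b -> phi (a + b) <= phi a + phi b.
Proof.
move=> a0 b0; rewrite /phi mulrDl lerD//; rewrite ler_wpM2l// lef_pV2 ?posrE; lra.
Qed.

Let half_gt0 n : 0 < (2 ^+ n : R)^-1.
Proof. by rewrite invr_gt0 exprn_gt0. Qed.

Let term_ge0 x y n : 0 <= term x y n.
Proof. by rewrite mulr_ge0 ?(ltW (half_gt0 n))// phi_ge0// sn_ge0. Qed.

Let cvg_half : series (fun n => (2 ^+ n)^-1 : R) @ \oo --> (2 : R).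
Proof.
have := @cvg_geometric_series R 1 2^-1.
rewrite ger0_norm ?invr_ge0// invf_lt1 ?ltr1n// => /(_ isT).
rewrite (_ : 1 / (1 - 2^-1) = 2); last by field.
suff -> : geometric 1 2^-1 = (fun n => (2 ^+ n)^-1 : R) by [].
by apply/funext => n; rewrite /= mul1r exprVn.
Qed.

Let cvg_term x y : cvgn (series (term x y)).
Proof.
apply: (@series_le_cvg _ _ (fun n => (2 ^+ n)^-1)) => [n|n|n|].
- exact: term_ge0.
- exact: ltW.
- by rewrite ler_piMr ?(ltW (half_gt0 n))// ltW// phi_lt1// sn_ge0.
- by apply/cvg_ex; exists 2.
Qed.

Lemma fdist_ge0 x y : 0 <= fdist p x y.
Proof.
apply: limr_ge; first exact: cvg_term.
by apply: nearW => n; apply: sumr_ge0 => i _; exact: term_ge0.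
Qed.

Lemma fdistC x y : fdist p x y = fdist p y x.
Proof. by rewrite /fdist; under eq_fun => n do rewrite snC. Qed.

Lemma fdistxx x : fdist p x x = 0.
Proof.
rewrite /fdist (_ : series _ = cst 0) ?lim_cst//; apply/funext => n.
by rewrite /series/= big1// => i _; rewrite subrr sn0 mul0r mulr0.
Qed.

Lemma fdist_tri y x z : fdist p x z <= fdist p x y + fdist p y z.
Proof.
rewrite -limD; [|exact: cvg_term..].
apply: ler_lim; [exact: cvg_term|by apply: is_cvgD; exact: cvg_term|].
apply: nearW => n /=; rewrite -[leRHS]big_split/=; apply: ler_sum => i _.
rewrite -mulrDr ler_wpM2l ?(ltW (half_gt0 i))//.
by rewrite (le_trans (phi_le _ (sn_tri i y x z))) ?sn_ge0// phiD ?sn_ge0.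
Qed.

Lemma fdist_le2 x y : fdist p x y <= 2.
Proof.
rewrite -(cvg_lim (@Rhausdorff R) cvg_half).
apply: ler_lim; [exact: cvg_term|by apply/cvg_ex; exists 2|].
apply: nearW => n /=; apply: ler_sum => i _.
by rewrite ler_piMr ?(ltW (half_gt0 i))// ltW// phi_lt1// sn_ge0.
Qed.

(** The terms of the series are nonnegative, so the distance dominates its [m]-th term, and [phi] is
    increasing. Together with [fdist_lt_sn] this makes metric and seminorm neighbourhoods
    interchangeable, uniformly in the base point. *)
Lemma sn_lt_fdist m (e : R) : 0 < e ->
  exists2 d : R, 0 < d & forall x y, fdist p x y < d -> p m (x - y) < e.
Proof.
move=> e0; exists ((2 ^+ m)^-1 * phi e).
  by rewrite mulr_gt0// /phi divr_gt0//; lra.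
move=> x y; apply: contraTT; rewrite -!leNgt => ep.
apply: (@le_trans _ _ (term x y m)).
  by rewrite ler_wpM2l ?(ltW (half_gt0 m))// phi_le// ltW.
apply: (@le_trans _ _ (series (term x y) m.+1)).
  by rewrite /series/= big_nat_recr//= lerDr sumr_ge0// => i _; exact: term_ge0.
apply: nondecreasing_cvgn_le; last exact: cvg_term.
by apply/nondecreasing_seqP => n; rewrite /series/= big_nat_recr//= lerDl term_ge0.
Qed.

Lemma fdist_lt_sn (e : R) : 0 < e ->
  exists m, exists2 d : R, 0 < d & forall x y, p m (x - y) < d -> fdist p x y < e.
Proof.
move=> e0.
(* One majorant covers all indices: [(e / 8) 2^-i] serves for [i <= m], and for [i > m] one has
   [2^-i <= (2/3)^m (3/4)^i], from [2/3 * 3/4 = 1/2]. Its sum is [e / 4 + 4 (2/3)^m], below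
   [3 e / 4]. *)
have [m hm] : exists m, 4 * (2/3 : R) ^+ m < e / 2.
  have /cvgr0_norm_lt/(_ (e / 8)) : (fun n => (2/3 : R) ^+ n) @ \oo --> (0 : R).
    by apply: cvg_expr; rewrite ger0_norm; lra.
  case; first lra; move=> m _ /(_ m (leqnn _)) /(le_lt_trans (ler_norm _)) h.
  by exists m; lra.
exists m, (e / 8); first lra; move=> x y xy.
have cg : cvgn (series (fun n => (2 ^+ n)^-1 * (e / 8))).
  rewrite (_ : series _ = (fun n => (e / 8) * series (fun n => (2 ^+ n)^-1) n)).
    by apply: is_cvgMr; apply/cvg_ex; exists 2.
  by apply/funext=> n; rewrite /series/= mulr_sumr; apply: eq_bigr => i _; rewrite mulrC.
have cg34 : series (geometric ((2/3 : R) ^+ m) (3/4)) @ \oo --> (2/3 : R) ^+ m * 4.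
  have -> : (2/3 : R) ^+ m * 4 = (2/3) ^+ m * (1 - 3/4)^-1 by field.
  by apply: cvg_geometric_series; rewrite ger0_norm; lra.
apply: (@le_lt_trans _ _ ((e / 8) * 2 + (2/3) ^+ m * 4)); last lra.
have cv : (fun n => (e/8) * series (fun n => (2 ^+ n)^-1 : R) n +
   series (geometric ((2/3 : R) ^+ m) (3/4)) n) @ \oo --> (e / 8) * 2 + (2/3) ^+ m * 4.
  by apply: cvgD cg34; exact: cvgMr cvg_half.
rewrite -(cvg_lim (@Rhausdorff R) cv).
apply: ler_lim; [exact: cvg_term|by apply/cvg_ex; eexists; exact: cv|].
apply: nearW => n /=; rewrite /series/= mulr_sumr -big_split/=; apply: ler_sum => i _.
have [im|mi] := leqP i m.
  apply: ler_wpDr; first by rewrite mulr_ge0// exprn_ge0//; lra.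
  rewrite mulrC ler_wpM2r ?(ltW (half_gt0 i))//.
  apply: (le_trans (phi_leid (sn_ge0 _ _))); apply/ltW/le_lt_trans/xy.
  exact: sn_le.
apply: ler_wpDl; first by rewrite mulr_ge0 ?(ltW (half_gt0 i))//; lra.
apply: (@le_trans _ _ ((2 ^+ i)^-1)).
  by rewrite ler_piMr ?(ltW (half_gt0 i))// ltW// phi_lt1// sn_ge0.
rewrite -(subnKC (ltnW mi)) !exprD mulrA -exprMn.
rewrite (_ : 2/3 * (3/4) = 2^-1 :> R); last by field.
rewrite invfM -exprVn ler_wpM2l ?exprn_ge0 ?invr_ge0// -exprVn lerXn2r ?nnegrE; lra.
Qed.

End FrechetMetric.

(** * Hahn-Banach *)

Section HahnBanach.
Variables (R : realType) (X : lmodType R) (q : X -> R).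
Hypothesis qs : seminorm q.

Definition linf (f : X -> R) := forall a x y, f (a *: x + y) = a * f x + f y.

Lemma linfZ f a x : linf f -> f (a *: x) = a * f x.
Proof.
move=> lf; have f0 : f 0 = 0 by have := lf 1 0 0; rewrite scale1r addr0 mul1r; lra.
by rewrite -[a *: x]addr0 lf f0 addr0.
Qed.

Lemma linf0 f : linf f -> f 0 = 0.
Proof. by move=> lf; rewrite -(scale0r 0) linfZ// mul0r. Qed.

Lemma linfD f x y : linf f -> f (x + y) = f x + f y.
Proof. by move=> lf; rewrite -[x]scale1r lf mul1r scale1r. Qed.

Lemma linfN f x : linf f -> f (- x) = - f x.
Proof. by move=> lf; rewrite -scaleN1r linfZ// mulN1r. Qed.

Lemma linfB f x y : linf f -> f (x - y) = f x - f y.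
Proof. by move=> lf; rewrite linfD// linfN. Qed.

Let qD x y : q (x + y) <= q x + q y. Proof. by case: qs. Qed.
Let qZ a x : q (a *: x) = `|a| * q x. Proof. by case: qs. Qed.
Let q0 : q 0 = 0. Proof. by rewrite -(scale0r 0) qZ normr0 mul0r. Qed.
Let qN x : q (- x) = q x. Proof. by rewrite -scaleN1r qZ normrN normr1 mul1r. Qed.

(** Partial linear functionals below [q] are handled as linear subsets of [X * R], so that Zorn's
    lemma applies to plain inclusion. Single-valuedness is derived later from the domination by
    [q]. *)
Let graph (A : set (X * R)) :=
  (forall (a : R) u v, A u -> A v -> A (a *: u.1 + v.1, a * u.2 + v.2)) /\
  (forall u, A u -> u.2 <= q u.1).

(** By subadditivity every [u.2 - q (u.1 - x0)] lies below every [q (v.1 + x0) - v.2], so the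
    supremum [c] of the former is an admissible value at [x0]; rescaling by the coefficient [t] of
    [x0] reduces domination to these two bounds. *)
Let graph_extend A x0 : graph A -> A !=set0 -> (forall r, ~ A (x0, r)) ->
  exists2 B, graph B & A `<` B.
Proof.
move=> [Alin Aq] [u0 Au0] Ax0.
have A0 : A (0, 0).
  by have := Alin (-1) _ _ Au0 Au0; rewrite scaleN1r mulN1r !addNr.
have AZ a u : A u -> A (a *: u.1, a * u.2).
  by move=> Au; have := Alin a _ _ Au A0; rewrite /= !addr0.
have AD u v : A u -> A v -> A (u.1 + v.1, u.2 + v.2).
  by move=> Au Av; have := Alin 1 _ _ Au Av; rewrite scale1r mul1r.
pose L := [set r | exists2 u, A u & r = u.2 - q (u.1 - x0)].
have Lub v : A v -> ubound L (q (v.1 + x0) - v.2).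
  move=> Av _ [u Au ->]; have := Aq _ (AD _ _ Au Av); rewrite /=.
  by have := qD (u.1 - x0) (v.1 + x0); rewrite addrACA addNr addr0; lra.
have Lsup : has_sup L.
  split; first by exists (u0.2 - q (u0.1 - x0)), u0.
  by exists (q (u0.1 + x0) - u0.2); exact: Lub.
pose c := sup L.
have c_le v : A v -> c <= q (v.1 + x0) - v.2.
  by move=> Av; apply: ge_sup; [case: Lsup|exact: Lub].
have c_ge u : A u -> u.2 - q (u.1 - x0) <= c.
  by move=> Au; apply: sup_upper_bound => //; exists u.
exists [set w | exists u (t : R), A u /\ w = (u.1 + t *: x0, u.2 + t * c)].
  split.
    move=> a _ _ [u [t [Au ->]]] [v [s [Av ->]]] /=.
    exists (a *: u.1 + v.1, a * u.2 + v.2), (a * t + s).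
    split; first exact: Alin.
    rewrite /= scalerDl -scalerA scalerDr; congr pair; last by ring.
    by rewrite addrACA.
  move=> _ [u [t [Au ->]]] /=.
  have [t0|t0|->] := ltgtP t 0; last first.
  - by rewrite scale0r mul0r !addr0; exact: Aq.
  - have := c_le _ (AZ t^-1 _ Au).
    rewrite -(ler_pM2l t0) /= mulrBr mulrA mulfV ?gt_eqF// mul1r.
    have -> : t * q (t^-1 *: u.1 + x0) = q (u.1 + t *: x0).
      by rewrite -{1}(gtr0_norm t0) -qZ scalerDr scalerA mulfV ?gt_eqF// scale1r.
    by lra.
  - have nt0 : 0 < - t by lra.
    have := c_ge _ (AZ (- t)^-1 _ Au).
    rewrite -(ler_pM2l nt0) /= mulrBr mulrA mulfV ?gt_eqF// mul1r.
    have -> : - t * q ((- t)^-1 *: u.1 - x0) = q (u.1 + t *: x0).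
      rewrite -{1}(gtr0_norm nt0) -qZ scalerDr scalerA mulfV ?gt_eqF// scale1r.
      by rewrite scalerN scaleNr opprK.
    by lra.
split.
  by move=> u Au; exists u, 0; rewrite scale0r mul0r !addr0; case: u Au.
move=> /(_ (x0, c)) h; apply: (Ax0 c); apply: h.
by exists (0, 0), 1; rewrite /= !add0r scale1r mul1r.
Qed.

Lemma hahn_banach y : exists f, [/\ linf f, forall x, `|f x| <= q x & f y = q y].
Proof.
pose G0 := [set w : X * R | exists a : R, w = (a *: y, a * q y)].
have qy : 0 <= q y by have := qD y (- y); rewrite subrr q0 qN; lra.
have gG0 : graph G0.
  split.
    move=> a _ _ [b ->] [c ->]; exists (a * b + c).
    by rewrite /= scalerDl scalerA mulrDl mulrA.
  by move=> _ [a ->] /=; rewrite qZ ler_wpM2r// ler_norm.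
pose P (A : set (X * R)) := A = set0 \/ (graph A /\ G0 `<=` A).
have [F FP Ftot|A [PA Amax]] := @Zorn_bigcup _ P.
  have [[B FB [w Bw]]|Fe] := pselect (exists2 B, F B & B !=set0); last first.
    left; rewrite -subset0 => w [B FB Bw]; apply: Fe; exists B => //.
    by exists w.
  have Fg C w' : F C -> C w' -> graph C.
    by move=> /FP[->//|[]].
  right; split; last first.
    by have [B0|[_ G0B]] := FP _ FB; [rewrite B0 in Bw|move=> v /G0B ?; exists B].
  split=> [a u v [C FC Cu] [D FD Dv]|u [C FC Cu]].
    have [CD|DC] := Ftot _ _ FC FD.
      by exists D => //; have [+ _] := Fg _ _ FD Dv; apply => //; exact: CD.
    by exists C => //; have [+ _] := Fg _ _ FC Cu; apply => //; exact: DC.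
  by have [_] := Fg _ _ FC Cu; apply.
have {PA} [gA G0A] : graph A /\ G0 `<=` A.
  case: PA => // A0; exfalso; apply: (Amax G0); last by right; split.
  rewrite A0; split; first exact: sub0set.
  by move=> /(_ (1 *: y, 1 * q y)); apply; exists 1.
have Adom x : exists r, A (x, r).
  apply: contrapT => /forallNP Ax.
  have Ane : A !=set0 by exists (0 *: y, 0 * q y); apply: G0A; exists 0.
  have [B gB AB] := graph_extend gA Ane Ax.
  apply: (Amax B) => //; right; split => //.
  by apply: subset_trans (properW AB).
have A0 r : A (0, r) -> r = 0.
  case: gA => Alin Aq A0r.
  have h a : a * r <= 0.
    have := Aq _ (Alin (a - 1) _ _ A0r A0r).
    by rewrite /= scaler0 addr0 q0; lra.
  by have := h 1; have := h (-1); lra.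
have Afun x r s : A (x, r) -> A (x, s) -> r = s.
  case: (gA) => Alin _ Ar As; have := Alin (-1) _ _ Ar As.
  by rewrite /= scaleN1r addNr => /A0; lra.
have [f fA] := choice Adom.
have lf : linf f.
  move=> a x z; apply: (Afun (a *: x + z)); first exact: fA.
  by case: gA => Alin _; exact: (Alin a _ _ (fA x) (fA z)).
exists f; split=> // [x|].
  case: gA => _ Aq; rewrite ler_norml.
  have := Aq _ (fA x); have := Aq _ (fA (- x)); rewrite /= qN linfN//.
  by lra.
by apply: (Afun y); [exact: fA|apply: G0A; exists 1; rewrite scale1r mul1r].
Qed.

End HahnBanach.

(** * Ultrafilter limits and compact sets *)

Lemma ultra_oo : exists U : set_system nat, UltraFilter U /\ \oo `<=` U.
Proof. exact: (@ultraFilterLemma _ \oo). Qed.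

Section UltraLimits.
Variables (R : realType) (U : set_system nat).
Hypothesis UU : UltraFilter U.

Lemma ultra_bounded_cvg (a : nat -> R) (M : R) : (forall n, `|a n| <= M) ->
  exists l : R, a @ U --> l.
Proof.
move=> aM.
have : compact (`[- M, M] : set R) by exact: segment_compact.
move=> /(_ (a @ U) _)[|l [_ cl]].
  apply: (@filterS _ U _ setT); last exact: filterT.
  by move=> n _; rewrite /= in_itv/= -ler_norml.
exists l => B nB; have [//|nU] := in_ultra_setVsetC (a @^-1` B) UU.
by have [x [? ?]] := cl (~` B) B nU nB.
Qed.

Lemma ultra_not P : ~ U P -> U (~` P).
Proof. by have [|] := in_ultra_setVsetC P UU. Qed.

End UltraLimits.

Lemma filter_seq (I : eqType) T (F : set_system T) (s : seq I) (P : I -> set T) :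
  Filter F -> (forall i, i \in s -> F (P i)) ->
  F [set n | forall i, i \in s -> P i n].
Proof.
move=> FF; elim: s => [|i s IH] FP.
  by apply: (@filterS _ F _ setT); [|exact: filterT].
have FS : F [set n | forall i, i \in s -> P i n].
  by apply: IH => j js; apply: FP; rewrite inE js orbT.
apply: filterS (filterI (FP i (mem_head _ _)) FS) => n [Pi Ps] j.
by rewrite inE => /predU1P[->|/Ps].
Qed.

Lemma not_near_oo (P : nat -> Prop) : ~ (\forall n \near \oo, P n) ->
  exists f : nat -> nat, forall n, (n <= f n)%N /\ ~ P (f n).
Proof.
move=> nP; have h n : exists k, (n <= k)%N /\ ~ P k.
  apply: contrapT => /forallNP h; apply: nP; exists n => // k nk.
  by have /not_andP[//|/contrapT] := h k.
by have [f fP] := choice h; exists f.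
Qed.

Lemma cvg_subseq_ge (f : nat -> nat) : (forall n, (n <= f n)%N) -> f @ \oo --> \oo.
Proof.
move=> fn A [N _ NA]; exists N => // n /= Nn; apply: NA => /=.
exact: leq_trans Nn (fn n).
Qed.

Section Frechet.
Variables (R : realType) (X : lmodType R) (p : nat -> X -> R).
Hypothesis Xf : is_frechet p.

Definition sncvg (F : set_system nat) (u : nat -> X) (y : X) :=
  forall m (e : R), 0 < e -> F [set n | p m (u n - y) < e].

(** The polar of the unit ball of [p m]: an equicontinuous set of functionals whose supremum is
    [p m], by Hahn-Banach. *)
Definition polar m (f : X -> R) := linf f /\ forall x, `|f x| <= p m x.

Lemma sn_eq0 x : (forall m (e : R), 0 < e -> p m x < e) -> x = 0.
Proof.
move=> px; case: Xf => _ _ + _; apply => m; apply/eqP; rewrite eq_le sn_ge0// andbT.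
by apply/ler_addgt0Pl => e e0; rewrite addr0 ltW// px.
Qed.

Lemma bounded_dual C m f : linf f -> (forall x, `|f x| <= C * p m x) -> dual p f.
Proof.
move=> lf fp; split=> // x e e0.
have C0 : 0 < `|C| + 1 by rewrite ltr_pwDr.
have [d d0 dP] := sn_lt_fdist Xf m (divr_gt0 e0 C0).
exists d; split => // y xy; rewrite -linfB//.
apply: le_lt_trans (fp _) _; have := dP _ _ xy; rewrite ltr_pdivlMr// snC// mulrC.
apply: le_lt_trans; rewrite ler_wpM2r ?sn_ge0//.
by rewrite (le_trans (ler_norm C))// lerDl.
Qed.

Lemma polar_dual m f : polar m f -> dual p f.
Proof. by case=> lf fp; apply: (@bounded_dual 1 m) => // x; rewrite mul1r. Qed.

Lemma dual_linf f : dual p f -> linf f. Proof. by case. Qed.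

Lemma dualN f : dual p f -> dual p (fun x => - f x).
Proof.
move=> [lf cf]; split=> [a x y|x e /(cf x)[d [d0 dP]]].
  by rewrite lf; ring.
by exists d; split => // y /dP; rewrite -opprD normrN.
Qed.

Lemma norming_functional m y : exists2 f, polar m f & f y = p m y.
Proof.
have qs : seminorm (p m) by case: Xf.
by have [f [lf fp fy]] := hahn_banach qs y; exists f.
Qed.

Lemma sn_le_polar m y (e : R) : (forall f, polar m f -> f y <= e) -> p m y <= e.
Proof. by move=> h; have [f fp <-] := norming_functional m y; exact: h. Qed.

Lemma fopen_sn (V : set X) :
  (forall x, V x -> exists m, exists2 d : R, 0 < d &
    forall y, p m (y - x) < d -> V y) -> fopen p V.
Proof.
move=> Vo x /Vo[m [d d0 dV]]; have [e e0 eP] := sn_lt_fdist Xf m d0.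
by exists e; split => // y xy; apply: dV; rewrite snC//; exact: eP.
Qed.

Lemma ball_fopen m (y : X) (e : R) : fopen p [set z | p m (z - y) < e].
Proof.
apply: fopen_sn => x /= xy; exists m, (e - p m (x - y)); first by rewrite subr_gt0.
by move=> z zx /=; apply: le_lt_trans (sn_tri Xf m x z y) _; rewrite -ltrBrDr.
Qed.

Lemma dual_cvg F f u y : Filter F -> dual p f -> sncvg F u y ->
  (fun n => f (u n)) @ F --> f y.
Proof.
move=> FF [_ cf] uy; apply/cvgrPdist_lt => e e0; have [d [d0 dP]] := cf y e e0.
have [m [d' d'0 dP']] := fdist_lt_sn Xf d0.
apply: filterS (uy m d' d'0) => n /= un; rewrite distrC; apply: dP; apply: dP'.
by rewrite snC.
Qed.

Lemma sncvg_fdist F u y e : Filter F -> sncvg F u y -> 0 < e ->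
  F [set n | fdist p (u n) y < e].
Proof.
move=> FF uy e0; have [m [d d0 dP]] := fdist_lt_sn Xf e0.
by apply: filterS (uy m d d0) => n /dP.
Qed.

Section Ultra.
Variables (U : set_system nat).
Hypothesis (UU : UltraFilter U) (Uoo : \oo `<=` U).

(** If no point of [K] were a limit, each [y] in [K] would have a ball that [U]-almost all terms
    avoid; finitely many such balls cover [K], yet some term avoids them all. *)
Lemma compact_ulim K u : fcompact p K -> (forall n, K (u n)) ->
  exists2 y, K y & sncvg U u y.
Proof.
move=> Kc Ku; apply: contrapT => nK.
have h y : exists me : nat * R, K y ->
    0 < me.2 /\ ~ U [set n | p me.1 (u n - y) < me.2].
  have [Ky|nKy] := pselect (K y); last by exists (0%N, 0).
  apply: contrapT => /forallNP h; apply: nK; exists y => // m e e0.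
  by apply: contrapT => nU; apply: (h (m, e)).
have [me meP] := choice h.
(* The clause [K y] empties [V y] for [y] outside [K], where nothing is known about [me y]. *)
pose V y := [set z | K y /\ p (me y).1 (z - y) < (me y).2].
have [y|z Kz|J [fJ KJ]] := Kc X V.
- by move=> z [Ky zy]; have [e [e0 eP]] := @ball_fopen (me y).1 y (me y).2 z zy;
    exists e; split => // t /eP.
- by exists z => //; split => //; rewrite subrr sn0//; case: (meP z Kz).
have [s sJ] := (finite_seqP J).1 fJ.
have : U [set n | forall y, y \in s -> ~ V y (u n)].
  apply: filter_seq => y ys; have [Ky|nKy] := pselect (K y).
    by apply: filterS (ultra_not UU (meP y Ky).2) => n /= + [_ ?]; apply.
  by apply: (@filterS _ U _ setT) => [n _ []//|]; exact: filterT.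
move=> /filter_ex[n nV]; have [y Jy Vy] := KJ _ (Ku n).
by apply: (nV y) => //; rewrite sJ in Jy.
Qed.

Lemma compact_closed K y : fcompact p K ->
  (forall m (e : R), 0 < e -> exists2 z, K z & p m (z - y) < e) -> K y.
Proof.
move=> Kc yK; have h n : exists z, K z /\ p n (z - y) < n.+1%:R^-1.
  by have [|z Kz zy] := yK n n.+1%:R^-1; [rewrite invr_gt0|exists z].
have [u uP] := choice h; have [z Kz uz] := compact_ulim Kc (fun n => (uP n).1).
suff -> : y = z by []; apply/eqP; rewrite -subr_eq0; apply/eqP; apply: sn_eq0 => m e e0.
have e20 : 0 < e / 2 by lra.
have : U [set n | p m (u n - z) < e / 2 /\ n.+1%:R^-1 < e / 2 /\ (m <= n)%N].
  apply: filterI; first exact: uz.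
  apply: Uoo; apply: filterI; first exact: near_infty_natSinv_lt (PosNum e20).
  by exists m.
move=> /filter_ex[n /= [h1 [h2 mn]]]; apply: le_lt_trans (sn_tri Xf m (u n) _ _) _.
have := lt_trans (uP n).2 h2; have := sn_le Xf (u n - y) mn.
by rewrite (snC Xf m y); lra.
Qed.

(** The balls around [c i] and [c j] both contain [U]-almost all terms, hence a common one, so the
    centres form a Cauchy sequence. This provides ultralimits where no compact set is at hand. *)
Lemma ulim_complete u :
  (forall m (e : R), 0 < e -> exists c, U [set n | p m (u n - c) < e]) ->
  exists y, sncvg U u y.
Proof.
move=> uc; have h k : exists c, U [set n | p k (u n - c) < k.+1%:R^-1].
  by apply: uc; rewrite invr_gt0.
have [c cP] := choice h; case: (Xf) => _ _ _ /(_ c)[|y cy].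
  move=> e e0; have [m [d d0 dP]] := fdist_lt_sn Xf e0.
  have d20 : 0 < d / 2 by lra.
  have [N _ NP] := near_infty_natSinv_lt (PosNum d20).
  exists (maxn N m) => i j; rewrite !geq_max => /andP[Ni mi] /andP[Nj mj].
  apply: dP; have Uij : U ([set n | p i (u n - c i) < i.+1%:R^-1] `&`
    [set n | p j (u n - c j) < j.+1%:R^-1]) by apply: filterI.
  have [n /= [ni nj]] := filter_ex Uij.
  apply: le_lt_trans (sn_tri Xf m (u n) _ _) _.
  have := sn_le Xf (u n - c i) mi; have := sn_le Xf (u n - c j) mj.
  have := lt_trans ni (NP _ Ni); have := lt_trans nj (NP _ Nj).
  by rewrite (snC Xf m (c i)) /=; lra.
exists y => m e e0; have e20 : 0 < e / 2 by lra.
have [d d0 dP] := sn_lt_fdist Xf m e20.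
have [N NP] := cy d d0; have [N' _ NP'] := near_infty_natSinv_lt (PosNum e20).
pose k := maxn N (maxn N' m); apply: filterS (cP k) => n /= nk.
apply: le_lt_trans (sn_tri Xf m (c k) _ _) _.
have mk : (m <= k)%N by rewrite /k !leq_max leqnn !orbT.
have := dP _ _ (NP k (leq_maxl _ _)); have := sn_le Xf (u n - c k) mk.
suff /(lt_trans nk) : k.+1%:R^-1 < e / 2 by lra.
by apply: NP' => /=; rewrite /k !leq_max leqnn orbT.
Qed.

(** Banach-Alaoglu for a sequence: bounded real sequences converge along [U], so the limit is taken
    pointwise and inherits linearity and the bound. *)
Lemma ulim_functional C m (f : nat -> X -> R) : (forall n, linf (f n)) ->
  (forall n x, `|f n x| <= C * p m x) ->
  exists g, [/\ linf g, forall x, `|g x| <= C * p m x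
    & forall x, (fun n => f n x) @ U --> g x].
Proof.
move=> lf fC; have h x : exists l : R, (fun n => f n x) @ U --> l.
  by apply: ultra_bounded_cvg => n; exact: fC.
have [g fg] := choice h; exists g; split => // [a x y|x].
  have fxy : (fun n => a * f n x + f n y) @ U --> g (a *: x + y).
    by under eq_fun do rewrite -lf; exact: fg.
  have FU : Filter U by exact: _.
  apply: (cvg_unique _ fxy); first exact: Rhausdorff.
  exact: (@cvgD _ _ _ U FU _ _ _ _ (@cvgMl_tmp _ _ U FU _ a _ (fg x)) (fg y)).
by apply: (cvgr_to_le (cvg_norm (fg x))); exact: nearW.
Qed.

(** Terms staying away from [y] would have another limit in [K] with the same values under every
    [f i], hence equal to [y]. This turns scalar convergence into convergence of points. *)
Lemma compact_cvg K u (f : nat -> X -> R) : fcompact p K -> (forall n, K (u n)) ->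
  (forall i, dual p (f i)) -> (forall i, cvgn (fun n => f i (u n))) ->
  (forall y z, K y -> K z -> (forall i, f i y = f i z) -> y = z) ->
  exists2 y, K y & sncvg \oo u y.
Proof.
move=> Kc Ku fd fc fs; have [y Ky uy] := compact_ulim Kc Ku.
exists y => // m e e0; apply: contrapT => /not_near_oo[g gP].
have [z Kz uz] := compact_ulim Kc (fun n => Ku (g n)).
have yz : y = z.
  apply: fs => // i; have /cvg_ex[l fl] := fc i.
  have -> : f i y = l.
    apply: (@cvg_unique _ (@Rhausdorff R) ((fun n => f i (u n)) @ U)).
      by apply: dual_cvg.
    by move=> A /fl; exact: Uoo.
  apply/esym; apply: (@cvg_unique _ (@Rhausdorff R) ((fun n => f i (u (g n))) @ U)).
    by apply: (dual_cvg _ (fd i) uz).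
  have gl : (fun n => f i (u (g n))) @ \oo --> l.
    apply: (cvg_comp g (fun n => f i (u n)) _ fl).
    by apply: cvg_subseq_ge => n; case: (gP n).
  by move=> A /gl; exact: Uoo.
have /filter_ex[n /= un] := uz m e e0.
by case: (gP n) => _; apply; rewrite /= yz.
Qed.

(** [suppf] is a real supremum, meaningful only when the values are bounded above; compactness
    supplies the bound. *)
Lemma compact_dual_ub K f : fcompact p K -> dual p f -> has_ubound (f @` K).
Proof.
move=> Kc fd; apply: contrapT => /forallNP nub.
have h n : exists x, K x /\ n%:R < f x.
  apply: contrapT => /forallNP h; apply: (nub n%:R) => _ [x Kx <-].
  by have /not_andP[//|/negP] := h x; rewrite -leNgt.
have [u uP] := choice h; have [y Ky uy] := compact_ulim Kc (fun n => (uP n).1).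
have fu : (fun n => f (u n)) @ U --> f y by apply: dual_cvg.
have /cvgrPdist_lt/(_ 1 ltr01) {}fu := fu.
have : U [set n | `|f y - f (u n)| < 1 /\ f y + 1 < n%:R].
  apply: filterI => //; apply: Uoo.
  by have := @nbhs_infty_gtr R (f y + 1); apply.
move=> /filter_ex[n /= [+ hn]]; rewrite ltr_norml; have := (uP n).2.
by lra.
Qed.

Lemma le_suppf K f x : fcompact p K -> dual p f -> K x -> f x <= suppf f K.
Proof.
move=> Kc fd Kx; apply: ub_le_sup; first exact: compact_dual_ub.
by exists x.
Qed.

End Ultra.
End Frechet.

(** * Functionals dominated by a support function *)

Section Representation.
Variables (R : realType) (X : lmodType R) (p : nat -> X -> R).
Hypothesis Xf : is_frechet p.

Lemma dual_lin a f g : dual p f -> dual p g -> dual p (fun x => a * f x + g x).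
Proof.
move=> [lf cf] [lg cg]; split=> [b x y|x e e0]; first by rewrite lf lg; ring.
have a0 : 0 < `|a| + 1 by rewrite ltr_pwDr.
have ea : 0 < e / 2 / (`|a| + 1) by rewrite divr_gt0//; lra.
have e20 : 0 < e / 2 by lra.
have [d [d0 dP]] := cf x _ ea; have [d' [d'0 dP']] := cg x _ e20.
exists (Num.min d d'); split; first by rewrite lt_min d0.
move=> y; rewrite lt_min => /andP[/dP h /dP' h'].
rewrite (_ : _ - _ = a * (f y - f x) + (g y - g x)); last by ring.
apply: le_lt_trans (ler_normD _ _) _; rewrite normrM.
have : `|a| * `|f y - f x| <= e / 2.
  apply: (@le_trans _ _ ((`|a| + 1) * `|f y - f x|)).
    by rewrite ler_wpM2r// lerDl.
  by rewrite mulrC -ler_pdivlMr// ltW.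
by lra.
Qed.

Lemma dual0 : dual p (fun=> 0).
Proof.
split=> [a x y|x e e0]; first by rewrite mulr0 addr0.
by exists 1; split => // y _; rewrite subrr normr0.
Qed.

Lemma dual_sum (s : seq (X -> R)) (c : (X -> R) -> R) :
  (forall f, f \in s -> dual p f) -> dual p (fun x => \sum_(f <- s) c f * f x).
Proof.
elim: s => [_|f s IH sd].
  by under eq_fun do rewrite big_nil; exact: dual0.
under eq_fun do rewrite big_cons.
apply: dual_lin; first by apply: sd; rewrite mem_head.
by apply: IH => g gs; apply: sd; rewrite inE gs orbT.
Qed.

Section Functional.
Variables (K : set X) (l : (X -> R) -> R).
Hypothesis Kck : ck p K.
Hypothesis llin : forall a f g, dual p f -> dual p g ->
  l (fun x => a * f x + g x) = a * l f + l g.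
Hypothesis lK : forall f, dual p f -> l f <= suppf f K.

Let Kc : fcompact p K. Proof. by case: Kck. Qed.

Let l0 : l (fun=> 0) = 0.
Proof.
have := llin 1 dual0 dual0.
rewrite (_ : (fun x => 1 * 0 + 0) = (fun=> 0)); first by lra.
by apply/funext => x; rewrite mulr0 addr0.
Qed.

Let l_sum (s : seq (X -> R)) (c : (X -> R) -> R) :
  (forall f, f \in s -> dual p f) ->
  l (fun x => \sum_(f <- s) c f * f x) = \sum_(f <- s) c f * l f.
Proof.
elim: s => [_|f s IH sd].
  by under eq_fun do rewrite big_nil; rewrite big_nil l0.
have sd' g : g \in s -> dual p g by move=> gs; apply: sd; rewrite inE gs orbT.
under eq_fun do rewrite big_cons.
by rewrite llin ?big_cons ?IH//; [apply: sd; rewrite mem_head|exact: dual_sum].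
Qed.

Let phi (s : seq (X -> R)) y := \sum_(f <- s) (f y - l f) ^+ 2.

Let phi_ge0 s y : 0 <= phi s y.
Proof. by apply: sumr_ge0 => f _; exact: sqr_ge0. Qed.

Let phi_min (s : seq (X -> R)) : (forall f, f \in s -> dual p f) ->
  exists2 y, K y & forall z, K z -> phi s y <= phi s z.
Proof.
move=> sd; have [x0 Kx0] : K !=set0 by case: Kck.
have V : has_inf (phi s @` K).
  by split; [exists (phi s x0), x0|exists 0 => _ [x Kx <-]; exact: phi_ge0].
have h n : exists x, K x /\ phi s x < inf (phi s @` K) + n.+1%:R^-1.
  have [|_ [x Kx <-] hx] := @inf_adherent _ (phi s @` K) n.+1%:R^-1 _ V.
    by rewrite invr_gt0.
  by exists x.
have [u uP] := choice h; have [U [UU Uoo]] := ultra_oo.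
have [y Ky uy] := compact_ulim Xf UU Kc (fun n => (uP n).1).
exists y => // z Kz; apply: (@le_trans _ _ (inf (phi s @` K))); last first.
  by apply: ge_inf; [case: V|exists z].
have cphi : (fun n => phi s (u n)) @ U --> phi s y.
  rewrite /phi; elim: s sd {V h uP} => [_|f s IH sd].
    by under eq_fun do rewrite big_nil; rewrite big_nil; exact: cvg_cst.
  have sd' g : g \in s -> dual p g by move=> gs; apply: sd; rewrite inE gs orbT.
  under eq_fun do rewrite big_cons.
  rewrite big_cons; apply: cvgD (IH sd').
  have fu : (fun n => f (u n) - l f) @ U --> f y - l f.
    apply: cvgB; last exact: cvg_cst.
    by apply: (dual_cvg Xf _ _ uy) => //; apply: sd; rewrite mem_head.
  by under eq_fun do rewrite expr2; rewrite expr2; apply: cvgM.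
have cinf : (fun n => inf (phi s @` K) + n.+1%:R^-1) @ U --> inf (phi s @` K).
  have hoo : (fun n => inf (phi s @` K) + n.+1%:R^-1) @ \oo --> inf (phi s @` K) + 0.
    by apply: cvgD; [exact: cvg_cst|exact: cvg_harmonic].
  by rewrite -[X in _ --> X]addr0 => A /hoo; exact: Uoo.
by apply: (ler_cvg_to cphi cinf); apply: nearW => n; apply: ltW; case: (uP n).
Qed.

(* First-order optimality: at a minimiser [y] of [sum (f z - l f)^2] over [K], the
   functional [F] below attains its maximum over [K], so [l F <= F y], which says
   that the minimum is nonpositive. *)
Let exact_on (s : seq (X -> R)) : (forall f, f \in s -> dual p f) ->
  exists2 y, K y & forall f, f \in s -> f y = l f.
Proof.
move=> sd; have [y Ky ymin] := phi_min sd; exists y => //.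
pose F x := \sum_(f <- s) - (f y - l f) * f x.
have Fd : dual p F by exact: dual_sum.
have Fmax z : K z -> F z <= F y.
  move=> Kz; rewrite -subr_ge0.
  pose A := \sum_(f <- s) (f y - l f) * (f z - f y).
  pose B := \sum_(f <- s) (f z - f y) ^+ 2.
  have -> : F y - F z = A.
    by rewrite /F -sumrB; apply: eq_bigr => f _; ring.
  have B0 : 0 <= B by apply: sumr_ge0 => f _; exact: sqr_ge0.
  (* Moving from [y] towards [z] by [t] changes [phi s] by [t * (2 * A + t * B)], which minimality
     keeps nonnegative. *)
  have h t : 0 < t <= 1 -> 0 <= 2 * A + t * B.
    move=> /andP[t0 t1].
    have Kw : K (t *: z + (1 - t) *: y).
      by case: Kck => _ _; apply => //; rewrite t1 ltW.
    have := ymin _ Kw; rewrite -subr_ge0 /phi -sumrB.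
    have -> : \sum_(f <- s) ((f (t *: z + (1 - t) *: y) - l f) ^+ 2 - (f y - l f) ^+ 2)
        = t * (2 * A + t * B).
      rewrite /A /B !mulr_sumr -big_split mulr_sumr/= !big_seq.
      apply: eq_bigr => f /sd/dual_linf lf.
      rewrite (linfD _ _ lf) !(linfZ _ _ lf).
      by move: (f z) (f y) (l f) => a b c; ring.
    by rewrite pmulr_rge0.
  rewrite leNgt; apply/negP => A0.
  have AB : 0 < - A + B by lra.
  (* For this [t] one has [t * B <= - A], so [2 * A + t * B <= A < 0]. *)
  have /h : 0 < - A / (- A + B) <= 1.
    by rewrite divr_gt0/= ?oppr_gt0// ler_pdivrMr// mul1r; lra.
  suff : - A / (- A + B) * B <= - A by lra.
  by rewrite mulrAC ler_pdivrMr//; nra.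
have lF : l F <= F y.
  apply: le_trans (lK Fd) _; apply: ge_sup; last by move=> _ [z Kz <-]; exact: Fmax.
  by case: Kck => -[x Kx] _ _; exists (F x), x.
move: lF; rewrite l_sum// -subr_ge0 /F -sumrB => S0 f fs.
have : phi s y <= 0.
  rewrite -oppr_ge0 /phi -sumrN; apply: le_trans S0 _; rewrite le_eqVlt.
  by apply/orP; left; apply/eqP/eq_bigr => g _; ring.
rewrite le_eqVlt ltNge phi_ge0 orbF /phi psumr_eq0; last by move=> *; exact: sqr_ge0.
by move/allP => /(_ f fs); rewrite sqrf_eq0 subr_eq0 => /eqP.
Qed.

(** If every point of [K] failed for some functional, the open sets [V f] would cover [K]; a finite
    subcover leaves finitely many functionals, and [exact_on] yields a point of [K] correct for all
    of them. *)
Lemma compact_representation : exists2 y, K y & forall f, dual p f -> f y = l f.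
Proof.
apply: contrapT => nK.
pose V (f : X -> R) := [set z | dual p f /\ f z != l f].
have Vo f : fopen p (V f).
  move=> z [fd fz]; have [lf cf] := fd.
  have fz0 : 0 < `|f z - l f| by rewrite normr_gt0 subr_eq0.
  have [d [d0 dP]] := cf z _ fz0.
  exists d; split => // y /dP h; split => //; apply/eqP => fy.
  by move: h; rewrite fy distrC ltxx.
have KV : K `<=` \bigcup_f V f.
  move=> z Kz; apply: contrapT => nV; apply: nK; exists z => // f fd; apply/eqP/negPn/negP => h.
  by apply: nV; exists f.
have [J [fJ KJ]] := Kc Vo KV; have [s sJ] := (finite_seqP J).1 fJ.
have [|y Ky ys] := @exact_on [seq f <- s | `[< dual p f >]].
  by move=> f; rewrite mem_filter => /andP[/asboolP].
have [f Jf [fd /eqP]] := KJ _ Ky; apply; apply: ys.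
by rewrite mem_filter; apply/andP; split; [apply/asboolP|rewrite sJ in Jf].
Qed.

End Functional.
End Representation.

(** * Orlicz-Pettis *)

Section OrliczPettis.
Variables (R : realType) (X : lmodType R) (p : nat -> X -> R).
Hypothesis Xf : is_frechet p.
Variables (m : nat) (xs : nat -> X -> R) (w : nat -> X) (W : set nat -> X) (eps : R).
Hypothesis xsP : forall i, polar p m (xs i).
Hypothesis eps0 : 0 < eps.
Hypothesis wW : forall f N, dual p f ->
  series (fun i => if i \in N then f (w i) else 0) @ \oo --> f (W N).

(** The subseries over the indices with [0 <= f (w i)], minus the one over the complement, is the
    series of absolute values. *)
Let abs_summable f : dual p f -> cvgn (series (fun i => `|f (w i)|)).
Proof.
move=> fd; pose N := [set i | 0 <= f (w i)].
apply/cvg_ex; exists (f (W N) - f (W (~` N))).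
rewrite (_ : series _ = series (fun i => if i \in N then f (w i) else 0)
    - series (fun i => if i \in ~` N then f (w i) else 0)); last first.
  apply/funext => n; rewrite /series/= fctE -sumrB; apply: eq_bigr => i _.
  have [fi|fi] := leP 0 (f (w i)).
    by rewrite mem_set// memNset ?subr0 ?ger0_norm//=; exact.
  rewrite memNset/=; last by apply/negP; rewrite -ltNge.
  by rewrite mem_set ?sub0r ?ltr0_norm//=; apply/negP; rewrite -ltNge.
by apply: cvgB; exact: wW.
Qed.

(* Gliding hump: subtracting a weak-star limit of the functionals, one extracts
   functionals [y (phi k)] whose action on the series is concentrated on the
   single term [w (phi k)], while they tend weak-star to 0 on all partial sums. *)
Lemma orlicz_pettis : ~ forall i, eps < `|xs i (w i)|.
Proof.
move=> xw; have e_gt0 := eps0; have [U [UU Uoo]] := ultra_oo.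
have FU : Filter U by exact: _.
have [|z [lz zp xz]] := @ulim_functional _ _ p U UU 1 m xs (fun i => (xsP i).1).
  by move=> n x; rewrite mul1r; case: (xsP n).
have zd : dual p z by exact: (bounded_dual Xf lz zp).
pose y i x := xs i x - z x.
have ly i : linf (y i).
  by move=> a u v; rewrite /y (xsP i).1 lz; ring.
have yp i x : `|y i x| <= 2 * p m x.
  apply: le_trans (ler_normB _ _) _; have := zp x; rewrite mul1r.
  by case: (xsP i) => _ /(_ x); lra.
have yd i : dual p (y i) by exact: (bounded_dual Xf (ly i) (yp i)).
have y0 x : (fun i => y i x) @ U --> (0 : R).
  rewrite -(subrr (z x)); apply: cvgB => //; exact: cvg_cst.
have zw0 : (fun i => z (w i)) @ \oo --> (0 : R).
  apply/norm_cvg0P; apply: cvg_series_cvg_0; exact: abs_summable.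
(* From an index [a] at stage [k], the next index [b] is taken so far along [U] that [y b] is small
   on the terms up to [a], and that the tail of [y a] from [b] on and [z (w b)] are small. The
   factor [k.+1] serves the vanishing of the final [g] on every [w l]. *)
have step ak : exists b, [/\ (ak.1 < b)%N,
    \sum_(0 <= l < ak.1.+1) `|y b (w l)| <= eps / 8 / ak.2.+1%:R,
    forall n, \sum_(b <= l < n) `|y ak.1 (w l)| <= eps / 8 & `|z (w b)| <= eps / 4].
  case: ak => a k /=.
  have e8 : 0 < eps / 8 by lra.
  have e4 : 0 < eps / 4 by lra.
  have e8k : 0 < eps / 8 / k.+1%:R by rewrite divr_gt0.
  have U1 : U [set b | \sum_(0 <= l < a.+1) `|y b (w l)| <= eps / 8 / k.+1%:R].
    have : (fun b => \sum_(0 <= l < a.+1) `|y b (w l)|) @ U --> (0 : R).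
      elim: (a.+1) => [|n IH].
        by under eq_fun do rewrite big_geq//; exact: cvg_cst.
      rewrite (_ : (fun b => _) =
          (fun b => \sum_(0 <= l < n) `|y b (w l)| + `|y b (w n)|)); last first.
        by apply/funext => b; rewrite big_nat_recr.
      rewrite -[X in _ --> X]addr0; apply: cvgD; first exact: IH.
      by rewrite -(@normr0 _ R); exact: cvg_norm.
    move=> /cvgrPdist_le/(_ _ e8k); apply: filterS => b /=.
    by rewrite sub0r normrN => /(le_trans (ler_norm _)).
  have U2 : U [set b | forall n, \sum_(b <= l < n) `|y a (w l)| <= eps / 8].
    apply: Uoo; have /cvgrPdist_lt/(_ _ e8) := abs_summable (yd a).
    apply: filterS => b /= hb n; have [bn|nb] := leqP b n; last first.
      by rewrite big_geq ?(ltnW nb)//; exact: ltW.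
    have nd : nondecreasing_seq (series (fun l => `|y a (w l)|)).
      by apply/nondecreasing_seqP => i; rewrite /series/= big_nat_recr//= lerDl.
    have := nondecreasing_cvgn_le nd (abs_summable (yd a)) n.
    rewrite /series/= (big_cat_nat (leq0n b) bn)//= => hn.
    move: hb; rewrite ltr_norml => /andP[_]; rewrite /series/=; lra.
  have U3 : U [set b | `|z (w b)| <= eps / 4].
    apply: Uoo; move: zw0 => /cvgrPdist_le/(_ _ e4); apply: filterS => b /=.
    by rewrite sub0r normrN.
  have U4 : U [set b | (a < b)%N] by apply: Uoo; exists a.+1.
  have [b [[[? ?] ?] ?]] := filter_ex (filterI (filterI (filterI U1 U2) U3) U4).
  by exists b.
have [B BP] := choice step.
have [phi phiE] : exists phi : nat -> nat, forall k, phi k.+1 = B (phi k, k).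
  by exists (fix phi k := if k is k'.+1 then B (phi k', k') else 0%N).
have phiS k : (phi k < phi k.+1)%N by rewrite phiE; case: (BP (phi k, k)).
have phi_lt i j : (i < j)%N -> (phi i < phi j)%N.
  elim: j => // j IH; rewrite ltnS leq_eqVlt => /predU1P[->//|/IH h].
  exact: ltn_trans h (phiS j).
pose N := range phi.
(* The single term [w (phi k.+1)] contributes at least [3 / 4 * eps], namely [eps] less [eps / 4]
   for [z]; the terms before and after it cost [eps / 8] each. The index starts at [phi 1] because
   [phi 0] was not produced by [step]. *)
have hump k : eps / 2 <= `|y (phi k.+1) (W N)|.
  pose v l := if l \in N then y (phi k.+1) (w l) else 0.
  have big : 3 / 4 * eps <= `|y (phi k.+1) (w (phi k.+1))|.
    have := lerB_dist (xs (phi k.+1) (w (phi k.+1))) (z (w (phi k.+1))).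
    by have [_ _ _] := BP (phi k, k); rewrite -phiE; have := xw (phi k.+1); lra.
  have vc : series v @ \oo --> y (phi k.+1) (W N) by exact: wW.
  apply: (cvgr_to_ge (cvg_norm vc)).
  exists (phi k.+2) => // n /= kn.
  have k1n : (phi k.+1 < n)%N by exact: leq_trans (phiS k.+1) kn.
  have -> : series v n = \sum_(0 <= l < phi k.+1) v l + v (phi k.+1)
      + \sum_((phi k.+1).+1 <= l < n) v l.
    rewrite /series/= (big_cat_nat (leq0n _) (ltnW k1n))/= -addrA; congr (_ + _).
    by rewrite big_ltn.
  have vk : v (phi k.+1) = y (phi k.+1) (w (phi k.+1)).
    by rewrite /v mem_set//; exists k.+1.
  have low : `|\sum_(0 <= l < phi k.+1) v l| <= eps / 8.
    have -> : \sum_(0 <= l < phi k.+1) v l = \sum_(0 <= l < (phi k).+1) v l.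
      rewrite (big_cat_nat (leq0n _) (phiS k))/= [X in _ + X]big1_seq ?addr0// => l /=.
      rewrite mem_index_iota => /andP[kl lk]; rewrite /v memNset// => -[i _ il].
      move: kl lk; rewrite -il; have [ik|ki|->] := ssrnat.ltngtP i k; last by rewrite ltnn.
        by have := phi_lt _ _ ik; lia.
      have [ik|/phi_lt|->] := ssrnat.ltngtP i k.+1; [lia|lia|lia].
    apply: le_trans (ler_norm_sum _ _ _) _.
    apply: (@le_trans _ _ (\sum_(0 <= l < (phi k).+1) `|y (phi k.+1) (w l)|)).
      by apply: ler_sum => l _; rewrite /v; case: ifP; rewrite ?normr0.
    have [_ + _ _] := BP (phi k, k); rewrite -phiE => /le_trans; apply.
    by rewrite ler_pdivrMr// ler_peMr ?ler1n//; lra.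
  have high : `|\sum_((phi k.+1).+1 <= l < n) v l| <= eps / 8.
    rewrite (big_cat_nat (phiS k.+1) kn)/= big1_seq ?add0r; last first.
      move=> l /=; rewrite mem_index_iota => /andP[kl lk]; rewrite /v memNset// => -[i _ il].
      move: kl lk; rewrite -il; have [/phi_lt|ki|->] := ssrnat.ltngtP i k.+1; [lia| |lia].
      by have [ik|/phi_lt|->] := ssrnat.ltngtP i k.+2; lia.
    apply: le_trans (ler_norm_sum _ _ _) _.
    apply: (@le_trans _ _ (\sum_(phi k.+2 <= l < n) `|y (phi k.+1) (w l)|)).
      by apply: ler_sum => l _; rewrite /v; case: ifP; rewrite ?normr0.
    by have [_ _ + _] := BP (phi k.+1, k.+1); rewrite -phiE; apply.
  rewrite vk; move: low high big.
  set A := \sum_(_ <= _ < _) _; set C := \sum_(_ <= _ < _) _; set D := y _ _.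
  move=> low high big.
  have : `|D| <= `|A + D + C| + `|A| + `|C|.
    rewrite {1}(_ : D = A + D + C - A - C); last by ring.
    by apply: le_trans (ler_normB _ _) _; rewrite lerD2r ler_normB.
  by lra.
(* Along the extracted indices the limit [g] need not be zero, but it kills every [w l], hence also
   [W N], a weak sum of such terms; the humps forbid this. *)
have [|g [lg gp yg]] := @ulim_functional _ _ p U UU 2 m (fun k => y (phi k.+1))
    (fun k => ly _); first by move=> n x; exact: yp.
have gd : dual p g by exact: (bounded_dual Xf lg gp).
have gw l : g (w l) = 0.
  apply: (@cvg_unique _ (@Rhausdorff R) ((fun k => y (phi k.+1) (w l)) @ U)); first exact: yg.
  suff h : (fun k => y (phi k.+1) (w l)) @ \oo --> (0 : R).
    by move=> A nA; apply: Uoo; exact: (h A nA).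
  apply/norm_cvg0P.
  apply: (@squeeze_cvgr _ _ _ _ (fun=> 0) (fun k => eps / 8 * k.+1%:R^-1)).
  - exists l => // k /= lk; rewrite normr_ge0/=.
    have [_ + _ _] := BP (phi k, k); rewrite -phiE; apply: le_trans.
    have kphi i : (i <= phi i)%N by elim: i => // i IH; exact: leq_ltn_trans IH (phiS i).
    have lphi : (l < (phi k).+1)%N by rewrite ltnS (leq_trans lk).
    rewrite (bigD1_seq l) ?mem_index_iota ?iota_uniq//=.
    by rewrite lerDl sumr_ge0.
  - exact: cvg_cst.
  - by rewrite -(mulr0 (eps / 8)); apply: cvgMr; exact: cvg_harmonic.
have gW : g (W N) = 0.
  have h : series (fun i => if i \in N then g (w i) else 0) @ \oo --> g (W N).
    exact: wW.
  have e0 : series (fun i => if i \in N then g (w i) else 0) = cst 0.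
    by apply/funext => n; rewrite /series/= big1// => i _; rewrite gw; case: ifP.
  rewrite e0 in h.
  by apply: (cvg_unique _ h); [exact: Rhausdorff|exact: cvg_cst].
have : eps / 2 <= `|g (W N)|.
  by apply: (cvgr_to_ge (cvg_norm (yg (W N)))); exact: nearW.
by rewrite gW normr0; lra.
Qed.

End OrliczPettis.

(** * Bochner measurable multifunctions and their selections *)

Section Lebesgue.
Variable R : realType.
Local Notation mu := (@completed_lebesgue_measure R).

Lemma measurable_I01 : measurable (@I01 R : set (lebT R)).
Proof. by apply: sub_caratheodory; exact: measurable_itv. Qed.

Lemma completed_lebesgue_measureE (A : set R) : mu A = lebesgue_measure A.
Proof. by []. Qed.

Lemma ae_mono (P Q : set (lebT R)) : P `<=` Q ->
  almost_everywhere mu P -> almost_everywhere mu Q.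
Proof. by move=> PQ; apply: negligibleS => t /= nQ /PQ. Qed.

Lemma ae_setI (P Q : set (lebT R)) : almost_everywhere mu P ->
  almost_everywhere mu Q -> almost_everywhere mu (P `&` Q).
Proof. by rewrite /almost_everywhere => mP mQ; rewrite setCI; exact: negligibleU. Qed.

Lemma negligible_measurable_fun (D : set (lebT R)) (f : lebT R -> R) :
  mu.-negligible D -> measurable_fun D f.
Proof.
move=> D0 _ Y mY; apply: completed_lebesgue_measure_is_complete.
by apply: negligibleS D0; exact: subIsetl.
Qed.

(** Completeness of the measure enters here: on the null set where convergence may fail, every
    function is measurable. *)
Lemma measurable_fun_ae_cvg (D : set (lebT R)) (u : nat -> lebT R -> R) (f : lebT R -> R) :
  measurable D -> (forall n, measurable_fun D (u n)) ->
  {ae mu, forall t, D t -> u ^~ t @ \oo --> f t} -> measurable_fun D f.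
Proof.
move=> mD mu_ [N [mN N0 uN]].
rewrite -(setDUK (@subIsetl _ D N)) setDIr setDv set0U.
apply/measurable_funU; [exact: measurableI|exact: measurableD|split].
  by apply: negligible_measurable_fun; exists N; split => //; exact: subIsetr.
apply: (@measurable_fun_cvg _ _ _ _ u) => [n|t [Dt Nt]].
  by apply: measurable_funS (mu_ n) => //; exact: subDsetl.
by apply: contrapT => h; apply: Nt; apply: uN => /(_ Dt).
Qed.

Definition find_first (P : pred nat) : nat :=
  if pselect (exists n, P n) is left h then ex_minn h else 0%N.

Lemma find_firstP (P : pred nat) : (exists n, P n) -> P (find_first P).
Proof.
by rewrite /find_first; case: pselect => // h _; case: ex_minnP.
Qed.

(** The level set of [j] asks for [P t j] and for no earlier index; at [j = 0] it also collects the
    points with no index at all, where [find_first] takes its default. *)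
Lemma measurable_find_first (D : set (lebT R)) (P : lebT R -> pred nat) :
  measurable D -> (forall i, measurable_fun D (fun t => P t i)) ->
  measurable_fun D (fun t => find_first (P t)).
Proof.
move=> mD mP _ Y _.
have mPi i b : measurable (D `&` [set t | P t i = b]).
  exact: (mP i mD [set b]).
have m0 : measurable (D `&` [set t | forall i, P t i = false]).
  rewrite (_ : _ `&` _ = \bigcap_i (D `&` [set t | P t i = false])).
    by apply: bigcapT_measurable => i; exact: mPi.
  apply/seteqP; split=> t /=; first by move=> [Dt h] i _; split => //; exact: h.
  by move=> h; split=> [|i]; [case: (h 0%N I)|case: (h i I)].
have mj j : measurable (D `&` [set t | find_first (P t) = j]).
  have mlt : measurable (D `&` [set t | forall i, (i < j)%N -> P t i = false]).
    rewrite (_ : _ `&` _ = D `&` \bigcap_(i in [set i | (i < j)%N])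
        (D `&` [set t | P t i = false])).
      apply: measurableI => //; apply: bigcap_measurableType => i _.
      exact: mPi.
    apply/seteqP; split=> t /= [Dt h]; split => // i ij.
      by split => //; exact: h.
    by case: (h i ij).
  pose Z := if j == 0%N then D `&` [set t | forall i, P t i = false] else set0.
  rewrite (_ : _ `&` _ = (D `&` [set t | P t j = true]) `&`
      (D `&` [set t | forall i, (i < j)%N -> P t i = false]) `|` Z).
    apply: measurableU; first exact: measurableI.
    by rewrite /Z; case: ifP => // _; exact: m0.
  apply/seteqP; split=> t /=.
    move=> [Dt]; rewrite /find_first /Z; case: pselect => [h|h].
      case: ex_minnP => n Pn hn <-; left; split => //; split => // i ni.
      by apply/negP => /hn; rewrite leqNgt ni.
    move=> <-; right => /=; split => // i; apply/negP => Pi; apply: h.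
    by exists i.
  move=> [[[Dt Pj] [_ hj]]|].
    split => //; rewrite /find_first; case: pselect => [h|h]; last first.
      by exfalso; apply: h; exists j.
    case: ex_minnP => n Pn hn; apply/eqP; rewrite eqn_leq hn//= leqNgt.
    by apply/negP => /hj; rewrite Pn.
  rewrite /Z; case: eqP => // -> [Dt h]; split => //; rewrite /find_first.
  by case: pselect => // -[n Pn]; have := h n; rewrite Pn.
rewrite (_ : _ `&` _ = \bigcup_(j in Y) (D `&` [set t | find_first (P t) = j])).
  by apply: bigcup_measurable => j _; exact: mj.
apply/seteqP; split=> t /=; first by move=> [Dt Yt]; exists (find_first (P t)).
by move=> [j Yj [Dt /= ->]].
Qed.

End Lebesgue.

(** * Hausdorff excess, and separability and measurability from Bochner measurability *)

Section Hausdorff.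
Variables (R : realType) (X : lmodType R) (p : nat -> X -> R).
Hypothesis Xf : is_frechet p.
Local Notation mu := (@completed_lebesgue_measure R).

Let infd a (B : set X) : R := inf [set fdist p a b | b in B].

Let infd_le a b B : B b -> infd a B <= fdist p a b.
Proof.
by move=> Bb; apply: ge_inf; [exists 0 => _ [c _ <-]; exact: fdist_ge0|exists b].
Qed.

Let infd_ge c a B : B !=set0 -> (forall b, B b -> c <= fdist p a b) -> c <= infd a B.
Proof.
move=> [b0 Bb0] h; apply: lb_le_inf; first by exists (fdist p a b0), b0.
by move=> _ [b Bb <-]; exact: h.
Qed.

(** The metric is bounded by 2, so the suprema defining the excess are genuine even for sets
    unbounded in the seminorms. *)
Let hexcess_ub A (B : set X) : B !=set0 ->
  has_ubound [set r | exists a, A a /\ r = infd a B].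
Proof.
move=> [b Bb]; exists 2 => _ [a [Aa ->]].
by apply: le_trans (infd_le _ Bb) _; exact: fdist_le2.
Qed.

Let infd_hexcess a A B : B !=set0 -> A a -> infd a B <= hexcess p A B.
Proof. by move=> B0 Aa; apply: ub_le_sup; [exact: hexcess_ub|exists a]. Qed.

Let hexcess_le c A B : A !=set0 -> (forall a, A a -> infd a B <= c) ->
  hexcess p A B <= c.
Proof.
move=> [a Aa] h; apply: ge_sup; first by exists (infd a B), a.
by move=> _ [a' [Aa' ->]]; exact: h.
Qed.

Lemma hexcess_tri B A C : A !=set0 -> B !=set0 -> C !=set0 ->
  hexcess p A C <= hexcess p A B + hexcess p B C.
Proof.
move=> A0 B0 C0; apply: hexcess_le => // a Aa.
rewrite -lerBlDr; apply: le_trans (infd_hexcess B0 Aa); apply: infd_ge => // b Bb.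
rewrite lerBlDr; have := infd_hexcess C0 Bb.
suff : infd a C - fdist p a b <= infd b C by lra.
apply: infd_ge => // c Cc; have := infd_le a Cc.
by have := fdist_tri Xf b a c; lra.
Qed.

Lemma hexcess_lt c A B a : B !=set0 -> hexcess p A B < c -> A a ->
  exists2 b, B b & fdist p a b < c.
Proof.
move=> B0 h Aa; apply: contrapT => nb.
suff : c <= hexcess p A B by rewrite leNgt h.
apply: le_trans (infd_hexcess B0 Aa); apply: infd_ge => // b Bb.
by rewrite leNgt; apply/negP => ?; apply: nb; exists b.
Qed.

Lemma hexcess_le_near (c : R) A B : A !=set0 -> B !=set0 ->
  (forall a, A a -> exists2 b, B b & fdist p a b <= c) -> hexcess p A B <= c.
Proof.
move=> A0 B0 h; apply: hexcess_le => // a /h[b Bb]; apply: le_trans.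
exact: infd_le.
Qed.

Lemma hexcess_hdist Y A B : Y !=set0 -> A !=set0 -> B !=set0 ->
  `|hexcess p Y A - hexcess p Y B| <= hdist p A B.
Proof.
move=> Y0 A0 B0; have := hexcess_tri Y0 A0 B0; have := hexcess_tri Y0 B0 A0.
have : hexcess p A B <= hdist p A B by rewrite /hdist le_max lexx.
have : hexcess p B A <= hdist p A B by rewrite /hdist le_max lexx orbT.
by rewrite ler_norml; lra.
Qed.

Lemma hexcess_hdistl Y A B : Y !=set0 -> A !=set0 -> B !=set0 ->
  `|hexcess p A Y - hexcess p B Y| <= hdist p A B.
Proof.
move=> Y0 A0 B0; have := hexcess_tri A0 B0 Y0; have := hexcess_tri B0 A0 Y0.
have : hexcess p A B <= hdist p A B by rewrite /hdist le_max lexx.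
have : hexcess p B A <= hdist p A B by rewrite /hdist le_max lexx orbT.
by rewrite ler_norml; lra.
Qed.

Lemma fball_open (y : X) (e : R) : fopen p [set z | fdist p z y < e].
Proof.
move=> x /= xy; exists (e - fdist p x y); split; first by rewrite subr_gt0.
move=> z xz /=; apply: le_lt_trans (fdist_tri Xf x z y) _.
by rewrite (fdistC Xf z); move: xz; lra.
Qed.

Lemma compact_net K (e : R) : fcompact p K -> 0 < e ->
  exists s : seq X, forall y, K y -> exists2 z, z \in s & fdist p y z < e.
Proof.
move=> Kc e0.
have KU : K `<=` \bigcup_z [set y | fdist p y z < e].
  by move=> z Kz; exists z => //=; rewrite fdistxx.
have [J [fJ KJ]] := Kc _ _ (fun z => @fball_open z e) KU.
have [s sJ] := (finite_seqP J).1 fJ; exists s => y /KJ[z Jz yz].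
by exists z => //; rewrite sJ in Jz.
Qed.

Let bits (s : seq (set R * set X)) (t : R) : seq bool := [seq `[< q.1 t >] | q <- s].

Let bits_simple_val s t t' : bits s t = bits s t' -> simple_val s t = simple_val s t'.
Proof.
by elim: s => //= q s IH [qt /IH ->]; rewrite /chi qt.
Qed.

Let simple_val_neq0 (s : seq (set R * set X)) (t : R) :
  (forall q, q \in s -> q.2 !=set0) -> simple_val s t !=set0.
Proof.
elim: s => [_|q s IH sq] /=; first by exists 0.
have [|x sx] := IH; first by move=> r rs; apply: sq; rewrite inE rs orbT.
have [y qy] : chi q.1 q.2 t !=set0.
  by rewrite /chi; case: ifP => _; [apply: sq; rewrite mem_head|exists 0].
by exists (y + x), y, x.
Qed.

(** [P] can be arbitrary because a simple multifunction takes finitely many values; the induction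
    changes [P] to absorb the head summand. *)
Let simple_val_meas (s : seq (set R * set X)) (P : set X -> Prop) :
  (forall q, q \in s -> Lmeas q.1) ->
  Lmeas [set t | P (simple_val s t)].
Proof.
elim: s P => [|q s IH] P sq /=.
  have [h|h] := pselect (P [set 0]).
    rewrite (_ : [set _ | _] = setT); first exact: measurableT.
    by apply/seteqP; split.
  rewrite (_ : [set _ | _] = set0); first exact: measurable0.
  by apply/seteqP; split.
have sq' r : r \in s -> Lmeas r.1 by move=> rs; apply: sq; rewrite inE rs orbT.
have mq : Lmeas q.1 by apply: sq; rewrite mem_head.
rewrite (_ : [set _ | _] = (q.1 `&` [set t : R | P (Defs.msum q.2 (simple_val s t))]) `|`
   (~` q.1 `&` [set t : R | P (Defs.msum [set 0] (simple_val s t))])).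
  apply: measurableU; apply: measurableI => //.
  - by apply: (IH (fun A => P (Defs.msum q.2 A))).
  - exact: measurableC.
  - by apply: (IH (fun A => P (Defs.msum [set 0] A))).
apply/seteqP; split=> t /=; rewrite /chi.
  by case: asboolP => qt Pt; [left|right].
by case: asboolP => qt [[]|[]].
Qed.

Let simple_mf_seq (S : R -> set X) : is_simple_mf p S ->
  exists2 s : seq (set R * set X), S = simple_val s &
  (forall q, q \in s -> Lmeas q.1) /\ (forall q, q \in s -> q.2 !=set0).
Proof.
move=> [s [_ sP ->]]; exists s => //; split => q qs.
  have := sP (index q s); rewrite index_mem qs => /(_ isT)[+ _].
  by rewrite nth_index.
have := sP (index q s); rewrite index_mem qs => /(_ isT)[_ [_ []]].
by rewrite nth_index.
Qed.

(** A functional that is 1-Lipschitz for the Hausdorff distance takes finitely many values along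
    each simple multifunction and passes to the almost everywhere limit. *)
Lemma bochner_measurable_fun G (e : set X -> R) : bochner_meas p G ->
  (forall t, I01 t -> G t !=set0) ->
  (forall A B, A !=set0 -> B !=set0 -> `|e A - e B| <= hdist p A B) ->
  measurable_fun (@I01 R : set (lebT R)) (fun t : lebT R => e (G t)).
Proof.
move=> [S [Ssimple SG]] G0 elip.
have [s sP] := choice (fun n => let: ex_intro2 s a b := simple_mf_seq (Ssimple n) in
  ex_intro _ s (conj a b)).
apply: (@measurable_fun_ae_cvg _ _ (fun n t => e (S n t))).
- exact: measurable_I01.
- move=> n _ Y mY; apply: measurableI; first exact: measurable_I01.
  have [-> [ms _]] := sP n.
  exact: (simple_val_meas (fun A => Y (e A)) ms).
apply: ae_mono SG => t SG I01t.
apply/cvgrPdist_lt => eps eps0.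
have /cvgrPdist_lt/(_ _ eps0) := SG I01t.
apply: filterS => n; rewrite sub0r normrN distrC => /(le_lt_trans (ler_norm _)).
apply: le_lt_trans; apply: elip; last exact: G0.
by have [-> [_ ?]] := sP n; exact: simple_val_neq0.
Qed.

(** The values of the simple multifunctions are merely closed and bounded, so finite nets are taken
    in the compact sets [G (r nbk)] instead: for each index [n], membership pattern and precision,
    [r] picks one point with that pattern where [S n] is close to [G]. Any [t] with the same data
    has [G t] close to [G (r nbk)] through the common value of [S n]. *)
Lemma bochner_separable G : bochner_meas p G ->
  (forall t, I01 t -> G t !=set0 /\ fcompact p (G t)) ->
  exists D : nat -> X, {ae mu, forall t, I01 t -> forall y, G t y ->
    forall e : R, 0 < e -> exists i, fdist p y (D i) < e}.
Proof.
move=> [S [Ssimple SG]] GP.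
have [s sP] := choice (fun n => let: ex_intro2 s a b := simple_mf_seq (Ssimple n) in
  ex_intro _ s (conj a b)).
have S0 n t : S n t !=set0.
  by have [-> [_ ?]] := sP n; exact: simple_val_neq0.
pose Q (nbk : nat * seq bool * nat) (t : R) := [/\ I01 t,
  bits (s nbk.1.1) t = nbk.1.2 & hdist p (S nbk.1.1 t) (G t) < nbk.2.+1%:R^-1].
have repr nbk : exists t, (exists t', Q nbk t') -> Q nbk t.
  have [[t h]|h] := pselect (exists t', Q nbk t'); last by exists 0.
  by exists t.
have [r rP] := choice repr.
have net nbk : exists l : seq X, I01 (r nbk) -> forall y, G (r nbk) y ->
    exists2 z, z \in l & fdist p y z < nbk.2.+1%:R^-1.
  have [h|h] := pselect (I01 (r nbk)); last by exists [::].
  have e0 : 0 < nbk.2.+1%:R^-1 :> R by rewrite invr_gt0.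
  by have [l lP] := compact_net (GP _ h).2 e0; exists l.
have [l lP] := choice net.
exists (fun i => if (unpickle i : option (nat * seq bool * nat * nat)) is Some (nbk, j)
  then nth 0 (l nbk) j else 0).
apply: ae_mono SG => t SG It y Gy e e0.
have e30 : 0 < e / 3 by lra.
have [k _ kP] := near_infty_natSinv_lt (PosNum e30).
have {kP} /= ke := kP _ (leqnn k).
have k0 : 0 < k.+1%:R^-1 :> R by rewrite invr_gt0.
have /cvgrPdist_lt/(_ _ k0)[n _ /(_ n (leqnn _))] := SG It.
rewrite sub0r normrN => /(le_lt_trans (ler_norm _)) hn.
pose nbk := (n, bits (s n) t, k).
have [Ir br hr] : [/\ I01 (r nbk), bits (s n) (r nbk) = bits (s n) t &
    hdist p (S n (r nbk)) (G (r nbk)) < k.+1%:R^-1].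
  by apply: (rP nbk); exists t; split.
have Sr : S n (r nbk) = S n t.
  by have [-> _] := sP n; exact: bits_simple_val.
have [G0 G0'] := ((GP _ It).1, (GP _ Ir).1).
have hG : hexcess p (G t) (G (r nbk)) < 2 * (e / 3).
  apply: le_lt_trans (hexcess_tri G0 (S0 n t) G0') _.
  have : hexcess p (G t) (S n t) <= hdist p (S n t) (G t).
    by rewrite /hdist le_max lexx orbT.
  have : hexcess p (S n t) (G (r nbk)) <= hdist p (S n (r nbk)) (G (r nbk)).
    by rewrite Sr /hdist le_max lexx.
  have := lt_trans hn ke; have := lt_trans hr ke.
  by lra.
have [z Gz yz] := hexcess_lt G0' hG Gy.
have [w wl zw] := lP nbk Ir z Gz.
exists (pickle (nbk, index w (l nbk))); rewrite pickleK nth_index//.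
apply: le_lt_trans (fdist_tri Xf z y w) _.
by have := lt_trans zw ke; lra.
Qed.

End Hausdorff.

(** * Measurable selections *)

Section Selection.
Variables (R : realType) (X : lmodType R) (p : nat -> X -> R).
Hypothesis Xf : is_frechet p.

Let delta k : R := (2 ^+ k)^-1.

Let delta_gt0 k : 0 < delta k. Proof. by rewrite invr_gt0 exprn_gt0. Qed.

Let deltaS k : delta k.+1 = delta k / 2.
Proof. by rewrite /delta exprS invfM mulrC. Qed.

Let delta_cvg0 (e : R) : 0 < e -> exists N, forall n, (N <= n)%N -> delta n < e.
Proof.
move=> e0; have /cvgr0_norm_lt/(_ e e0)[N _ NP] :
    (fun n => (2^-1 : R) ^+ n) @ \oo --> (0 : R).
  by apply: cvg_expr; rewrite ger0_norm; lra.
exists N => n /NP /=; rewrite /delta -exprVn; apply: le_lt_trans; exact: ler_norm.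
Qed.

Lemma limit_in_compact K (u : nat -> X) : K !=set0 -> fcompact p K ->
  (forall k, hexcess p [set u k] K < delta k) ->
  (forall k, fdist p (u k.+1) (u k) < delta k + delta k.+1) ->
  exists2 y, K y & sncvg p \oo u y.
Proof.
move=> K0 Kc uK uu.
(* Telescoping with room to spare: a step costs less than [delta + delta / 2], while [4 * delta]
   drops by [2 * delta]. *)
have ua a n : fdist p (u (a + n)%N) (u a) <= 4 * delta a - 4 * delta (a + n)%N.
  elim: n => [|n IH]; first by rewrite addn0 fdistxx// subrr.
  apply: le_trans (fdist_tri Xf (u (a + n)%N) _ _) _; rewrite addnS.
  have := uu (a + n)%N; have := deltaS (a + n)%N; have := delta_gt0 (a + n)%N.
  by lra.
have uab N a b : (N <= a)%N -> (N <= b)%N -> fdist p (u a) (u b) < 8 * delta N.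
  move=> Na Nb; apply: le_lt_trans (fdist_tri Xf (u N) _ _) _.
  rewrite (fdistC Xf (u N)) -(subnKC Na) -(subnKC Nb).
  have := ua N (a - N)%N; have := ua N (b - N)%N.
  have := delta_gt0 (N + (a - N))%N; have := delta_gt0 (N + (b - N))%N.
  by lra.
have [y uy] : exists y, fconv p u y.
  case: (Xf) => _ _ _; apply => e e0; have e80 : 0 < e / 8 by lra.
  have [N NP] := delta_cvg0 e80; exists N => a b Na Nb.
  by have := uab _ _ _ Na Nb; have := NP N (leqnn N); lra.
have uy' : sncvg p \oo u y.
  move=> m e e0; have [d d0 dP] := sn_lt_fdist Xf m e0.
  by have [N NP] := uy d d0; exists N => // n /NP /dP.
exists y => //; have [U [UU Uoo]] := ultra_oo.
apply: (compact_closed Xf UU Uoo Kc) => m e e0; have e20 : 0 < e / 2 by lra.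
have [N1 _ N1P] := uy' m _ e20.
have [d d0 dP] := sn_lt_fdist Xf m e20; have [N2 N2P] := delta_cvg0 d0.
pose n := maxn N1 N2.
have [z Kz uz] := hexcess_lt Xf K0 (uK n) (erefl (u n)).
exists z => //; apply: le_lt_trans (sn_tri Xf m (u n) z y) _.
have /= := N1P n (leq_maxl _ _).
have : p m (u n - z) < e / 2.
  by apply: dP; apply: lt_trans uz _; apply: N2P; exact: leq_maxr.
by rewrite (snC Xf m z); lra.
Qed.

(* Kuratowski and Ryll-Nardzewski: among a countable family [D] almost everywhere
   dense in [G t], choose the first element close enough to [G t] and to the
   previous choice. *)
Lemma measurable_selection G : bochner_meas p G -> (forall t, I01 t -> ck p (G t)) ->
  exists f : R -> X, (forall t, I01 t -> G t (f t)) /\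
    forall xs, dual p xs ->
      measurable_fun (@I01 R : set (lebT R)) (fun t : lebT R => xs (f t)).
Proof.
move=> Gm Gck.
have G0 t : I01 t -> G t !=set0 by move=> /Gck[].
have Gc t : I01 t -> fcompact p (G t) by move=> /Gck[].
have [D Dae] := bochner_separable Xf Gm (fun t It => conj (G0 t It) (Gc t It)).
pose ex i t := hexcess p [set D i] (G t).
have mex i : measurable_fun (@I01 R : set (lebT R)) (ex i : lebT R -> R).
  apply: (@bochner_measurable_fun R X p G (hexcess p [set D i]) Gm G0) => A B A0 B0.
  by apply: hexcess_hdist => //; exists (D i).
pose P k j t : pred nat := fun i =>
  (ex i t < delta k.+1) && (fdist p (D i) (D j) < delta k + delta k.+1).
pose fix idx k (t : R) {struct k} : nat := if k is k'.+1 then find_first (P k' (idx k' t) t)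
  else find_first (fun i => ex i t < delta 0).
have midx k : measurable_fun (@I01 R : set (lebT R)) (idx k : lebT R -> nat).
  elim: k => [|k IH] /=.
    apply: measurable_find_first; first exact: measurable_I01.
    by move=> i; apply: measurable_fun_ltr.
  apply: measurable_find_first; first exact: measurable_I01.
  move=> i; apply: measurable_and; first exact: measurable_fun_ltr.
  apply: (@measurableT_comp _ _ _ _ _ _
    (fun j => fdist p (D i) (D j) < delta k + delta k.+1)) => //.
(* Membership in [G t] is wanted at every [t], so where [D] does not approximate [G t] the value is
   any point of [G t]; convergence is claimed only where it does. *)
have h t : exists y, I01 t -> G t y /\ ((forall y, G t y ->
    forall e : R, 0 < e -> exists i, fdist p y (D i) < e) ->
    sncvg p \oo (fun k => D (idx k t)) y).
  have [It|nIt] := pselect (I01 t); last by exists 0.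
  set Q := forall y, _; have [Dt|nDt] := pselect Q; last first.
    by have [y Gy] := G0 t It; exists y => _; split => // /nDt.
  have exi y e : G t y -> 0 < e -> exists2 i, fdist p y (D i) < e & ex i t < e.
    move=> Gy e0; have e20 : 0 < e / 2 by lra.
    have [i yi] := Dt y Gy _ e20; exists i; first by lra.
    apply: (@le_lt_trans _ _ (e / 2)); last lra.
    apply: hexcess_le_near => [//||| _ ->]; [by exists (D i)|exact: G0|].
    by exists y => //; rewrite fdistC// ltW.
  have ex0 : ex (idx 0%N t) t < delta 0.
    apply: (@find_firstP (fun i => ex i t < delta 0)).
    by have [y Gy] := G0 t It; have [i _ ?] := exi y _ Gy (delta_gt0 0); exists i.
  (* The search succeeds: some [z] in [G t] is within [delta k] of the current choice, and some
     element of [D] is within [delta k.+1] of [z]. *)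
  have exS k : ex (idx k t) t < delta k -> P k (idx k t) t (idx k.+1 t).
    move=> ek; apply: find_firstP.
    have [z Gz uz] := hexcess_lt Xf (G0 t It) ek (erefl (D (idx k t))).
    have [i zi ei] := exi z _ Gz (delta_gt0 k.+1); exists i; rewrite /P ei/=.
    apply: le_lt_trans (fdist_tri Xf z _ _) _.
    by rewrite (fdistC Xf (D i)) (fdistC Xf z (D (idx k t))); lra.
  have exk k : ex (idx k t) t < delta k.
    by elim: k => [//|k /exS /andP[]].
  have [||y Gy yP] := @limit_in_compact (G t) (fun k => D (idx k t)) (G0 t It) (Gc t It).
  - exact: exk.
  - by move=> k; have /andP[] := exS k (exk k).
  by exists y.
have [f fP] := choice h; exists f; split=> [t It|xs xd]; first by case: (fP t It).
apply: (@measurable_fun_ae_cvg _ _ (fun k t => xs (D (idx k t)))).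
- exact: measurable_I01.
- by move=> k; apply: (@measurableT_comp _ _ _ _ _ _ (fun j => xs (D j))).
apply: ae_mono Dae => t Dt It; have [_ /(_ (Dt It)) cv] := fP t It.
exact: (dual_cvg Xf _ xd cv).
Qed.

End Selection.

(** * Integrals of selections *)

Section RealIntegral.
Variable R : realType.
Local Notation mu := (@completed_lebesgue_measure R).
Local Notation intble D u := (mu.-integrable (D : set (lebT R)) (EFin \o (u : lebT R -> R))).
Local Notation Int D u := (Rintegral mu (D : set (lebT R)) (u : lebT R -> R)).
Implicit Types (D A B : set (lebT R)) (f g h u : lebT R -> R).

Lemma integrable_EFin_measurable D f : intble D f -> measurable_fun D f.
Proof. by move=> /integrableP[/measurable_EFinP]. Qed.

Lemma integrable_dominated D f g : measurable D -> intble D g -> measurable_fun D f ->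
  (forall t, D t -> `|f t| <= g t) -> intble D f.
Proof.
move=> mD ig mf fg; apply: (le_integrable mD _ _ ig) => //.
  by apply/measurable_EFinP.
by move=> t Dt /=; rewrite lee_fin; apply: le_trans (fg t Dt) _; exact: ler_norm.
Qed.

Lemma integrableZ D f a : measurable D -> intble D f -> intble D (fun t => a * f t).
Proof. by move=> mD /(integrableZl mD a); apply: eq_integrable. Qed.

Lemma integrable_bddM D h f M : measurable D -> measurable_fun D h ->
  (forall t, D t -> `|h t| <= M) -> intble D f -> intble D (fun t => h t * f t).
Proof.
move=> mD mh hM fi; apply: (@integrable_dominated _ _ (fun t => M * `|f t|) mD).
- by apply: integrableZ mD _; exact: integrable_norm.
- by apply: measurable_funM => //; exact: integrable_EFin_measurable.
- by move=> t Dt; rewrite normrM ler_wpM2r// hM.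
Qed.

Lemma integrable_subset D A f : measurable D -> measurable A -> A `<=` D ->
  intble D f -> intble A f.
Proof. by move=> mD mA AD; apply: integrableS. Qed.

Lemma Rintegral_setID D A f : measurable D -> measurable A -> intble D f ->
  Int D f = Int (D `&` A) f + Int (D `\` A) f.
Proof.
move=> mD mA fi; rewrite -Rintegral_setU ?setUIDK//.
- exact: measurableI.
- exact: measurableD.
- by apply/disj_setPS => t [[_ At] [_]].
Qed.

Lemma Rintegral_le_subset D A f : measurable D -> measurable A -> A `<=` D ->
  intble D f -> (forall t, D t -> 0 <= f t) -> Int A f <= Int D f.
Proof.
move=> mD mA AD fi f0; rewrite (@Rintegral_setID D A)// (setIidr AD) lerDl.
by apply: Rintegral_ge0 => t [Dt _]; exact: f0.
Qed.

Lemma Rintegral_dominated_cvg D (u : nat -> lebT R -> R) f g : measurable D ->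
  (forall n, measurable_fun D (u n)) -> measurable_fun D f ->
  {ae mu, forall t, D t -> u ^~ t @ \oo --> f t} -> intble D g ->
  (forall n t, D t -> `|u n t| <= g t) ->
  (fun n => Int D (u n)) @ \oo --> Int D f.
Proof.
move=> mD mu_ mf uf ig ug.
have ui n : intble D (u n) by apply: integrable_dominated ig _ _ => //; exact: ug.
have [fi _ cv] : [/\ mu.-integrable D (EFin \o f),
   [sequence (\int[mu]_(x in D) `|(u n x)%:E - (f x)%:E|)%E]_n @ \oo --> (0%E : \bar R) &
   [sequence (\int[mu]_(x in D) (u n x)%:E)%E]_n @ \oo --> (\int[mu]_(x in D) (f x)%:E)%E].
  apply: (dominated_convergence mD _ _ _ ig).
  - by move=> n; exact/measurable_EFinP.
  - exact/measurable_EFinP.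
  - apply: ae_mono uf => t uf Dt; apply: cvg_EFin; last exact: uf.
    exact: nearW.
  - apply: aeW => t n Dt /=; rewrite lee_fin; exact: ug.
have E : (\int[mu]_(x in D) (f x)%:E)%E = (Int D f)%:E.
  by rewrite /Rintegral fineK//; exact: integrable_fin_num.
by rewrite E in cv; have /fine_cvgP[_] := cv.
Qed.

Lemma Rintegral_patch D A f : Int (D `&` A) f = Int D (f \_ A).
Proof. exact: Rintegral_mkcondr. Qed.

Lemma integrable_patch D A f : measurable D -> measurable A -> intble D f ->
  intble D (f \_ A).
Proof.
move=> mD mA fi; apply: (@integrable_dominated _ _ (fun t => `|f t|)) => //.
- exact: integrable_norm.
- apply/measurable_restrict => //; apply: measurable_funS (integrable_EFin_measurable fi) => //.
- by move=> t Dt; rewrite patchE; case: ifP => // _; rewrite normr0.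
Qed.

Lemma Rintegral_set_cvg D (A : nat -> set (lebT R)) (B : set (lebT R)) f : measurable D ->
  (forall n, measurable (A n)) -> measurable B -> intble D f ->
  {ae mu, forall t, D t -> \forall n \near \oo, A n t <-> B t} ->
  (fun n => Int (D `&` A n) f) @ \oo --> Int (D `&` B) f.
Proof.
move=> mD mA mB fi AB; under eq_fun do rewrite Rintegral_patch.
rewrite Rintegral_patch; apply: (@Rintegral_dominated_cvg _ _ _ (fun t => `|f t|)) => //.
- by move=> n; apply: integrable_EFin_measurable; exact: integrable_patch.
- by apply: integrable_EFin_measurable; exact: integrable_patch.
- apply: ae_mono AB => t AB Dt; apply: cvg_near_cst; apply: filterS (AB Dt) => n ABt.
  by rewrite !patchE; congr (if _ then _ else _); apply: asbool_equiv_eq.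
- exact: integrable_norm.
- by move=> n t Dt; rewrite patchE; case: ifP => // _; rewrite normr0.
Qed.

(** Countable additivity written as a convergent series, the form in which [orlicz_pettis] asks for
    subseries sums. *)
Lemma Rintegral_series_disjoint D (A : nat -> set (lebT R)) f : measurable D ->
  (forall n, measurable (A n)) -> (forall n, A n `<=` D) ->
  (forall i j t, A i t -> A j t -> i = j) -> intble D f ->
  series (fun i => Int (A i) f) @ \oo --> Int (\bigcup_i A i) f.
Proof.
move=> mD mA AD dA fi.
pose B n := \bigcup_(i in [set i | (i < n)%N]) A i.
have mB n : measurable (B n) by apply: bigcup_measurable.
have BD n : B n `<=` D by move=> t [i _ /AD].
have mUA : measurable (\bigcup_i A i) by exact: bigcup_measurable.
have -> : series (fun i => Int (A i) f) = fun n => Int (D `&` B n) f.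
  apply/funext; elim=> [|n IH].
    rewrite /series/= big_geq// (_ : _ `&` _ = set0) ?Rintegral_set0//.
    by apply/seteqP; split=> t // -[_ [i]].
  rewrite seriesSr IH -Rintegral_setU//.
  - congr (Int _ f); apply/seteqP; split=> t.
      move=> [[Dt [i /= iltn Ai]]|An]; split=> //; [|exact: AD An|].
        by exists i => //=; exact: ltn_trans iltn _.
      by exists n => /=.
    move=> [Dt [i /=]]; rewrite ltnS leq_eqVlt => /predU1P[->|iltn] Ai; first by right.
    by left; split => //; exists i.
  - exact: measurableI.
  - apply: integrable_subset fi => //.
      by apply: measurableU => //; exact: measurableI.
    by move=> t [[]//|/AD].
  - apply/disj_setPS => t [[_ [i /= iltn Ai]] An].
    by move: iltn; rewrite (dA _ _ _ Ai An) ltnn.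
rewrite (_ : Int (\bigcup_i A i) f = Int (D `&` \bigcup_i A i) f); last first.
  by congr (Int _ f); apply/esym/setIidr => t [i _ /AD].
apply: Rintegral_set_cvg => //; apply: aeW => t Dt.
have [[i _ Ai]|nA] := pselect ((\bigcup_i A i) t).
  exists i.+1 => // n /= iltn; split=> _; first by exists i.
  by exists i.
by apply: nearW => n; split=> // -[i _ Ai]; exfalso; apply: nA; exists i.
Qed.

(** Of the sets where [f] is nonnegative and where it is negative, one carries at least half of the
    integral of the absolute value. *)
Lemma Rintegral_half_sign D f eps : measurable D -> intble D f ->
  eps < Int D (fun t => `|f t|) ->
  exists A, [/\ measurable A, A `<=` D & eps / 2 < `|Int A f| ].
Proof.
move=> mD fi; pose P := D `&` [set t | 0 <= f t].
have mP : measurable P.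
  by apply: measurable_fun_le => //; exact: integrable_EFin_measurable.
have nfi : intble D (fun t => `|f t|) by exact: integrable_norm.
have PD : P `<=` D by exact: subIsetl.
have mDP : measurable (D `\` P) by exact: measurableD.
rewrite (Rintegral_setID mD mP nfi) (setIidr PD).
rewrite (@eq_Rintegral _ _ _ mu P f); last first.
  by move=> t; rewrite inE => -[_ /= ft]; rewrite ger0_norm.
rewrite (@eq_Rintegral _ _ _ mu (D `\` P) (fun t => (-1) * f t)); last first.
  move=> t; rewrite inE => -[Dt nP]; rewrite ltr0_norm ?mulN1r//.
  by rewrite ltNge; apply/negP => ft; apply: nP; split.
rewrite RintegralZl//; last by apply: integrable_subset fi => //; exact: subDsetl.
have [h|h] := ltP (eps / 2) `|Int P f|; first by move=> _; exists P.
move=> e; exists (D `\` P); split => //.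
move: h e; rewrite ler_norml.
by have := ler_norm (- Int (D `\` P) f); rewrite normrN; lra.
Qed.

End RealIntegral.

(** * Pettis integrals and uniform integrability of the selections of [Gamma] *)

Section Selections.
Variables (R : realType) (X : lmodType R) (p : nat -> X -> R).
Hypothesis Xf : is_frechet p.
Variable Gamma : R -> set X.
Hypothesis Gck : forall t, I01 t -> ck p (Gamma t).
Hypothesis Gp : pettis_ck p Gamma.
Local Notation mu := (@completed_lebesgue_measure R).
Local Notation I := (@I01 R : set (lebT R)).
Local Notation intble D u := (mu.-integrable (D : set (lebT R)) (EFin \o (u : lebT R -> R))).
Local Notation Int D u := (Rintegral mu (D : set (lebT R)) (u : lebT R -> R)).

(** An integrable majorant of [xs] in absolute value on [Gamma t]. It depends on [xs], and no common
    majorant over the functionals bounded by [p m] is given; uniformity over these is what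
    Orlicz-Pettis provides. *)
Definition envelope (xs : X -> R) (t : R) : R :=
  `|suppf xs (Gamma t)| + `|suppf (fun x => - xs x) (Gamma t)|.

Lemma le_envelope xs t y : dual p xs -> I01 t -> Gamma t y -> `|xs y| <= envelope xs t.
Proof.
move=> xd It Gy; have [U [UU Uoo]] := ultra_oo.
have Gc : fcompact p (Gamma t) by case: (Gck It).
have h1 := le_suppf Xf UU Uoo Gc xd Gy.
have h2 := le_suppf Xf UU Uoo Gc (dualN xd) Gy.
have h3 := ler_norm (suppf xs (Gamma t)).
have h4 := ler_norm (suppf (fun x => - xs x) (Gamma t)).
have h5 := normr_ge0 (suppf xs (Gamma t)).
have h6 := normr_ge0 (suppf (fun x => - xs x) (Gamma t)).
by rewrite ler_norml /envelope; lra.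
Qed.

Lemma envelope_integrable xs : dual p xs -> intble I (envelope xs).
Proof.
move=> xd; have [h _] := Gp; have mI := @measurable_I01 R.
have h1 := integrable_norm (h _ xd); have h2 := integrable_norm (h _ (dualN xd)).
exact: (integrableD mI h1 h2).
Qed.

Definition sel (f : R -> X) := (forall t, I01 t -> Gamma t (f t)) /\
  forall xs, dual p xs -> measurable_fun I (fun t : lebT R => xs (f t)).

Lemma sel_integrable f xs : sel f -> dual p xs -> intble I (fun t => xs (f t)).
Proof.
move=> [fG mf] xd; apply: (integrable_dominated (@measurable_I01 R) (envelope_integrable xd)).
  exact: mf.
by move=> t It; apply: le_envelope => //; exact: fG.
Qed.

Lemma sel_integrableS E f xs : Lmeas E -> E `<=` @I01 R -> sel f -> dual p xs ->
  intble E (fun t => xs (f t)).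
Proof.
move=> mE EI sf xd; apply: (integrable_subset (@measurable_I01 R) mE EI).
exact: sel_integrable.
Qed.

(** Integrating [xs (f t) <= suppf xs (Gamma t)] bounds the integral functional by [suppf xs K], and
    [compact_representation] gives a point of [K]. Since [K] does not depend on [f], this is the
    source of compactness for sequences of selections. *)
Lemma sel_set_integral E : Lmeas E -> E `<=` @I01 R -> exists2 K, ck p K &
  forall f, sel f -> exists2 y, K y & forall xs, dual p xs -> xs y = Int E (fun t => xs (f t)).
Proof.
move=> mE EI; have [K [Kck KE]] := Gp.2 E mE EI; exists K => // f sf.
apply: (compact_representation Xf Kck (l := fun xs => Int E (fun t => xs (f t)))).
- move=> a xs ys xd yd.
  have ix := sel_integrableS mE EI sf xd; have iy := sel_integrableS mE EI sf yd.
  by rewrite (RintegralD mE (integrableZ a mE ix) iy) (RintegralZl _ mE ix).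
- move=> xs xd; have := KE xs xd.
  move=> /(congr1 fine) /= ->; apply: le_Rintegral => //.
  + exact: sel_integrableS.
  + apply: (integrable_subset (@measurable_I01 R) mE EI); exact: (Gp.1 xs xd).
  + move=> t /EI It; have [U [UU Uoo]] := ultra_oo.
    apply: (le_suppf Xf UU Uoo) => //; first by case: (Gck It).
    by case: sf => + _; apply.
Qed.

(** Countably many pieces are allowed because the uniform integrability argument glues infinitely
    many bad selections at once. *)
Lemma sel_glue (B : nat -> set R) (g : nat -> R -> X) g0 :
  (forall i, Lmeas (B i)) -> (forall i, B i `<=` @I01 R) ->
  (forall i j t, B i t -> B j t -> i = j) -> (forall i, sel (g i)) -> sel g0 ->
  exists F, [/\ sel F, forall i t, B i t -> F t = g i t &
    forall t, (forall i, ~ B i t) -> F t = g0 t].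
Proof.
move=> mB BI dB sg sg0.
pose F t := if pselect (exists i, B i t) is left h then g (projT1 (cid h)) t else g0 t.
have FB i t : B i t -> F t = g i t.
  move=> Bi; rewrite /F; case: pselect => [h|[]]; last by exists i.
  by case: (cid h) => j /= Bj; rewrite (dB _ _ _ Bi Bj).
have F0 t : ~ (exists i, B i t) -> F t = g0 t by rewrite /F; case: pselect.
exists F; split; [|exact: FB|by move=> t nB; apply: F0 => -[i /nB]].
split=> [t It|xs xd].
  have [[i Bi]|h] := pselect (exists i, B i t).
    by rewrite (FB _ _ Bi); case: (sg i) => + _; apply.
  by rewrite F0//; case: sg0 => + _; apply.
have mUB : measurable (\bigcup_i B i : set (lebT R)) by apply: bigcup_measurable => i _; exact: mB.
have UI : \bigcup_i B i `<=` I by move=> t [i _ /BI].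
rewrite -(setDUK UI).
apply/(measurable_funU _ mUB (measurableD (@measurable_I01 R) mUB)); split.
  apply/(measurable_fun_bigcup _ mB) => i.
  have h : measurable_fun (B i : set (lebT R)) (fun t : lebT R => xs (g i t)).
    by apply: measurable_funS ((sg i).2 _ xd); [exact: measurable_I01|exact: BI].
  by apply: eq_measurable_fun h => t; rewrite inE => /FB ->.
have h : measurable_fun (I `\` \bigcup_i B i) (fun t : lebT R => xs (g0 t)).
  by apply: measurable_funS (sg0.2 _ xd); [exact: measurable_I01|exact: subDsetl].
apply: eq_measurable_fun h => t; rewrite inE => -[_ nB]; rewrite F0// => -[i Bi].
by apply: nB; exists i.
Qed.

(* The Pettis integrability of the measurable selections, hence Orlicz-Pettis,
   is what makes the family [xs \o f] uniformly integrable: otherwise selections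
   that are bad on disjoint pieces are glued into a single one. *)
Lemma sel_uniformly_integrable m (eps : R) (T : nat -> set R) : 0 < eps ->
  (forall J, Lmeas (T J)) -> (forall J, T J `<=` @I01 R) ->
  (forall J, T J.+1 `<=` T J) ->
  {ae mu, forall t, I01 t -> exists J, ~ T J t} ->
  exists J, forall f xs, sel f -> polar p m xs ->
    Int (T J) (fun t => `|xs (f t)|) <= eps.
Proof.
move=> eps0 mT TI TS T0; apply: contrapT => nJ.
have Tle i j : (i <= j)%N -> T j `<=` T i.
  by move=> /subnK <-; elim: (j - i)%N => // n IH t /TS /IH.
have mI := @measurable_I01 R.
have bad J : exists fx : (R -> X) * (X -> R), [/\ sel fx.1, polar p m fx.2 &
    eps < Int (T J) (fun t => `|fx.2 (fx.1 t)|)].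
  apply: contrapT => /forallNP h; apply: nJ; exists J => f xs sf xp.
  by have := h (f, xs); rewrite leNgt => h'; apply/negP => ?; apply: h'.
have [fx fxP] := choice bad.
have norm_int J D : Lmeas D -> D `<=` @I01 R ->
    intble D (fun t => `|(fx J).2 ((fx J).1 t)|).
  move=> mD DI; have [sf xp _] := fxP J.
  by apply: integrable_norm; apply: sel_integrableS => //; exact: (polar_dual Xf xp).
(* The sets [T n] shrink to a null set, so a late [J'] leaves more than [eps] of the integral on the
   part of [T J] outside [T J']; iteration gives disjoint pieces. *)
have next J : exists J', (J < J')%N /\
    eps < Int (T J `\` T J') (fun t => `|(fx J).2 ((fx J).1 t)|).
  have [sf xp ef] := fxP J.
  have cv : (fun n => Int (T J `&` ~` T n) (fun t => `|(fx J).2 ((fx J).1 t)|)) @ \oo -->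
      Int (T J `&` setT) (fun t => `|(fx J).2 ((fx J).1 t)|).
    apply: (Rintegral_set_cvg (mT J)) => [n|||].
    - by apply: measurableC; exact: mT.
    - exact: measurableT.
    - exact: norm_int.
    - apply: ae_mono T0 => t Tt TJt; have [n nT] := Tt (TI _ _ TJt).
      by exists n => // k /= nk; split => // _ /(Tle _ _ nk).
  rewrite setIT in cv.
  have [N _ NP] := cvgr_gt _ cv _ ef.
  exists (maxn N J.+1); split; first by rewrite leq_maxr.
  exact: (NP _ (leq_maxl _ _)).
have [nx nxP] := choice next.
have [J JE] : exists J : nat -> nat, forall i, J i.+1 = nx (J i).
  by exists (fun i => iter i nx 0%N).
have JS i : (J i < J i.+1)%N by rewrite JE; case: (nxP (J i)).
have Jle i j : (i < j)%N -> (J i.+1 <= J j)%N.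
  by move=> /subnK <-; elim: (j - i.+1)%N => // n IH; exact: leq_trans IH (ltnW (JS _)).
pose B i := T (J i) `\` T (J i.+1).
have mB i : Lmeas (B i) by apply: measurableD; exact: mT.
have BI i : B i `<=` @I01 R by move=> t [/TI].
have dB i j t : B i t -> B j t -> i = j.
  move=> [Ti nTi] [Tj nTj]; case: (ssrnat.ltngtP i j) => // /Jle ij; exfalso.
    by apply: nTi; exact: (Tle _ _ ij t Tj).
  by apply: nTj; exact: (Tle _ _ ij t Ti).
pose f i := (fx (J i)).1; pose xs i := (fx (J i)).2.
have sf i : sel (f i) by case: (fxP (J i)).
have xp i : polar p m (xs i) by case: (fxP (J i)).
have xd i : dual p (xs i) by exact: (polar_dual Xf (xp i)).
have hA i : exists A, [/\ Lmeas A, A `<=` B i &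
    eps / 2 < `|Int A (fun t => xs i (f i t))| ].
  have ei : eps < Int (B i) (fun t => `|xs i (f i t)|).
    by rewrite /B JE; case: (nxP (J i)).
  exact: (Rintegral_half_sign (mB i) (sel_integrableS (mB i) (BI i) (sf i) (xd i)) ei).
have [A AP] := choice hA.
have mA i : Lmeas (A i) by case: (AP i).
have AB i : A i `<=` B i by case: (AP i).
have [F [sF FB _]] := sel_glue mB BI dB sf (sf 0%N).
have AI i : A i `<=` @I01 R by move=> t /AB /BI.
have hw i : exists y, forall ys, dual p ys -> ys y = Int (A i) (fun t => ys (F t)).
  by have [K _ /(_ F sF)[y _ yP]] := sel_set_integral (mA i) (AI i); exists y.
have [w wP] := choice hw.
pose AN (N : set nat) i : set R := if i \in N then A i else set0.
have mAN N i : Lmeas (AN N i).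
  by rewrite /AN; case: ifP => // _; exact: measurable0.
have ANI N i : AN N i `<=` @I01 R by move=> t; rewrite /AN; case: ifP => // _; exact: AI.
have mUA N : Lmeas (\bigcup_i AN N i) by apply: bigcup_measurable => i _; exact: mAN.
have UAI N : \bigcup_i AN N i `<=` @I01 R by move=> t [i _ /ANI].
have hW N : exists y, forall ys, dual p ys ->
    ys y = Int (\bigcup_i AN N i) (fun t => ys (F t)).
  by have [K _ /(_ F sF)[y _ yP]] := sel_set_integral (mUA N) (UAI N); exists y.
have [W WP] := choice hW.
have e20 : 0 < eps / 2 by lra.
(* [w i] is the integral of the glued [F] over [A i], and [W N] the one over the union of the [A i]
   with [i] in [N]. *)
apply: (@orlicz_pettis _ _ _ Xf m xs w W (eps / 2) xp e20) => [g N gd|i].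
  rewrite WP//.
  have -> : (fun i => if i \in N then g (w i) else 0) =
      (fun i => Int (AN N i) (fun t => g (F t))).
    apply/funext => i; rewrite /AN; case: ifP => _; first exact: wP.
    by rewrite Rintegral_set0.
  apply: (Rintegral_series_disjoint mI (mAN N) (ANI N) _ (sel_integrable sF gd)).
  move=> j k t; rewrite /AN; case: ifP => // _ /AB Bj; case: ifP => // _ /AB Bk.
  exact: dB Bj Bk.
rewrite wP//; have [_ _ h] := AP i; apply: (lt_le_trans h).
rewrite (@eq_Rintegral _ _ _ mu (A i) (fun t => xs i (F t)))// => t.
by rewrite inE => /AB /FB ->.
Qed.

End Selections.

(** * Bounds uniform over all selections *)

Section SelectionBounds.
Variables (R : realType) (X : lmodType R) (p : nat -> X -> R).
Hypothesis Xf : is_frechet p.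
Variable Gamma : R -> set X.
Hypothesis Gck : forall t, I01 t -> ck p (Gamma t).
Hypothesis Gb : bochner_meas p Gamma.
Hypothesis Gp : pettis_ck p Gamma.
Local Notation mu := (@completed_lebesgue_measure R).
Local Notation I := (@I01 R : set (lebT R)).
Local Notation intble D u := (mu.-integrable (D : set (lebT R)) (EFin \o (u : lebT R -> R))).
Local Notation Int D u := (Rintegral mu (D : set (lebT R)) (u : lebT R -> R)).
Local Notation sel := (sel p Gamma).

Lemma mu_I01 : mu I = 1%E.
Proof.
by rewrite completed_lebesgue_measureE lebesgue_measure_itv/= lte_fin ltr01 oppr0 adde0.
Qed.

Lemma mu_sub_fin (E : set (lebT R)) : measurable E -> E `<=` I -> mu E \is a fin_num.
Proof.
move=> mE EI; rewrite ge0_fin_numE ?measure_ge0//.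
apply: (@le_lt_trans _ _ (mu I)); last by rewrite mu_I01 ltry.
by apply: le_measure => //; rewrite inE//; exact: measurable_I01.
Qed.

Lemma fine_mu_le (A B : set (lebT R)) : measurable A -> measurable B -> A `<=` B ->
  B `<=` I -> fine (mu A) <= fine (mu B).
Proof.
move=> mA mB AB BI; apply: fine_le; [|exact: mu_sub_fin|by apply: le_measure; rewrite ?inE].
by apply: mu_sub_fin => // t /AB /BI.
Qed.

Lemma integrable_cst_I01 (E : set (lebT R)) (c : R) : measurable E -> E `<=` I ->
  intble E (fun=> c).
Proof.
move=> mE EI; apply: measurable_bounded_integrable => //.
- by have := mu_sub_fin mE EI; rewrite ge0_fin_numE.
- by exists `|c|; split => // M cM t _ /=; exact: ltW.
Qed.

Lemma Rintegral_le_cst (E : set (lebT R)) (u : lebT R -> R) (c : R) : measurable E ->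
  E `<=` I -> intble E u -> (forall t, E t -> u t <= c) -> Int E u <= c * fine (mu E).
Proof.
move=> mE EI ui uc; rewrite -Rintegral_cst//.
by apply: le_Rintegral => //; exact: integrable_cst_I01.
Qed.

(** [T r] collects the points where [Gamma t] is not yet within [d / 2] of the first [r.+1] points
    of the countable set [D]. Compactness removes almost every [t] after finitely many stages, and
    off [T r] the seminorm is at most 1 plus the largest [p m (D i)], bounded by the sum. *)
Lemma sel_exhaustion m : exists (T : nat -> set R) (B : nat -> R),
  [/\ (forall r, Lmeas (T r)) /\ (forall r, T r `<=` @I01 R), forall r, T r.+1 `<=` T r,
    {ae mu, forall t, I01 t -> exists r, ~ T r t} &
    forall r t y, I01 t -> ~ T r t -> Gamma t y -> p m y <= B r].
Proof.
have G0 t : I01 t -> Gamma t !=set0 by move=> /Gck[].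
have Gc t : I01 t -> fcompact p (Gamma t) by move=> /Gck[].
have [D Dae] := bochner_separable Xf Gb (fun t It => conj (G0 t It) (Gc t It)).
have [d d0 dP] := sn_lt_fdist Xf m (@ltr01 R).
have d20 : 0 < d / 2 by lra.
pose Y r := D @` [set i | (i <= r)%N].
have Y0 r : Y r !=set0 by exists (D 0%N), 0%N.
pose e r t := hexcess p (Gamma t) (Y r).
have me r : measurable_fun I (e r : lebT R -> R).
  apply: (@bochner_measurable_fun R X p Gamma (fun A => hexcess p A (Y r)) Gb G0).
  by move=> A B A0 B0; exact: hexcess_hdistl.
pose T r := I `\` (I `&` [set t | e r t <= d / 2]).
exists T, (fun r => 1 + \sum_(0 <= i < r.+1) p m (D i)); split.
- split=> r; last by move=> t [].
  apply: measurableD; first exact: measurable_I01.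
  by apply: measurable_fun_le => //; exact: measurable_I01.
- move=> r t [It nT]; split => // -[_ /= er]; apply: nT; split => //=.
  apply: le_trans er; apply: le_trans (hexcess_tri Xf (G0 t It) (Y0 r) (Y0 r.+1)) _.
  rewrite gerDl; apply: hexcess_le_near => // _ [i /= ir <-].
  by exists (D i); [exists i => //=; exact: leqW|rewrite fdistxx].
- apply: ae_mono Dae => t Dt It.
  have GU : Gamma t `<=` \bigcup_i [set y | fdist p y (D i) < d / 2].
    by move=> y Gy; have [i yi] := Dt It y Gy _ d20; exists i.
  have [J [fJ GJ]] := Gc t It _ _ (fun i => @fball_open _ _ _ Xf (D i) (d / 2)) GU.
  have [s sJ] := (finite_seqP J).1 fJ.
  exists (\max_(i <- s) i)%N => -[_]; apply; split => //=.
  apply: hexcess_le_near => //; first exact: G0.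
  move=> y /GJ[i Ji yi]; exists (D i); last exact: ltW.
  by exists i => //=; apply: leq_bigmax_seq => //; rewrite sJ in Ji.
- move=> r t y It nT Gy; have er : e r t <= d / 2.
    by apply: contrapT => h; apply: nT; split => // -[].
  have er' : hexcess p (Gamma t) (Y r) < d by move: er; rewrite /e; lra.
  have [_ [i /= ir <-] yi] := hexcess_lt Xf (Y0 r) er' Gy.
  have := dP _ _ yi; rewrite -{2}(subrK (D i) y) => /ltW yD.
  apply: le_trans (snD Xf m _ _) _; rewrite lerD//.
  rewrite (bigD1_seq i) ?mem_index_iota ?iota_uniq//=.
  by rewrite lerDl; apply: sumr_ge0 => j _; exact: sn_ge0.
Qed.

(** On [T J] uniform integrability gives at most [eps], and off [T J] the bound of [sel_exhaustion]
    applies. The next two lemmas read off absolute continuity and boundedness. *)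
Let split_bound m (eps : R) : 0 < eps -> exists2 B : R, 0 < B & forall E f xs, Lmeas E ->
  E `<=` @I01 R -> sel f -> polar p m xs ->
  Int E (fun t => `|xs (f t)|) <= eps + B * fine (mu E).
Proof.
move=> eps0; have [T [B [[mT TI] TS T0 TB]]] := sel_exhaustion m.
have [J JP] := sel_uniformly_integrable Xf Gck Gp m eps0 mT TI TS T0.
exists (`|B J| + 1); first by rewrite ltr_wpDl.
move=> E f xs mE EI sf xp; have xd := polar_dual Xf xp.
have ni := integrable_norm (sel_integrableS Xf Gck Gp mE EI sf xd).
have mET : measurable (E `&` T J : set (lebT R)) by apply: measurableI => //; exact: mT.
have mED : measurable (E `\` T J : set (lebT R)) by apply: measurableD => //; exact: mT.
rewrite (Rintegral_setID mE (mT J) ni) lerD//.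
  apply: le_trans (JP f xs sf xp); apply: Rintegral_le_subset => //.
  - exact: mT.
  - exact: integrable_norm (sel_integrableS Xf Gck Gp (mT J) (TI J) sf xd).
  - by move=> t _ /=.
apply: (@le_trans _ _ ((`|B J| + 1) * fine (mu (E `\` T J)))); last first.
  by rewrite ler_wpM2l ?addr_ge0//; apply: fine_mu_le => //; exact: subDsetl.
apply: Rintegral_le_cst => //.
- by move=> t [/EI].
- by apply: (integrable_subset mE mED _ ni); exact: subDsetl.
move=> t [Et nT]; apply: le_trans (xp.2 _) _.
apply: le_trans (TB _ _ _ (EI _ Et) nT (sf.1 _ (EI _ Et))) _.
by rewrite (le_trans (ler_norm _))// lerDl.
Qed.

Lemma sel_abs_continuous m (eps : R) : 0 < eps -> exists2 d : R, 0 < d & forall E f xs, Lmeas E ->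
  E `<=` @I01 R -> fine (mu E) <= d -> sel f -> polar p m xs ->
  Int E (fun t => `|xs (f t)|) <= eps.
Proof.
move=> eps0; have e20 : 0 < eps / 2 by lra.
have [B B0 BP] := split_bound m e20.
exists (eps / 2 / B); first by rewrite divr_gt0.
move=> E f xs mE EI Ed sf xp; apply: le_trans (BP E f xs mE EI sf xp) _.
have : B * fine (mu E) <= eps / 2 by rewrite mulrC -ler_pdivlMr.
by lra.
Qed.

Lemma sel_bounded m : exists2 C : R, 0 < C & forall f xs, sel f -> polar p m xs ->
  Int I (fun t => `|xs (f t)|) <= C.
Proof.
have [B B0 BP] := split_bound m (@ltr01 R).
exists (1 + B) => [|f xs sf xp]; first by lra.
have := BP I f xs (@measurable_I01 R) (@subset_refl _ _) sf xp.
by rewrite mu_I01/= mulr1.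
Qed.

End SelectionBounds.

(** The sum counts the positive multiples of [eta] up to [x]: it is [x] rounded down to the grid and
    capped at [K%:R * eta]. *)
Lemma staircase_approx (R : realFieldType) (eta x : R) (K : nat) : 0 < eta -> 0 <= x ->
  (x < K%:R * eta -> `|x - \sum_(i < K) eta * (i.+1%:R * eta <= x)%R%:R| <= eta) /\
  (K%:R * eta <= x -> \sum_(i < K) eta * (i.+1%:R * eta <= x)%R%:R = K%:R * eta).
Proof.
move=> eta0 x0; elim: K => [|K [IH1 IH2]].
  by split; [rewrite mul0r ltNge x0|rewrite big_ord0 mul0r].
rewrite big_ord_recr/=; split=> [xK|Kx].
  rewrite (leNgt (K.+1%:R * eta) x) xK/= mulr0 addr0; have [/IH1//|Kx] := ltP x (K%:R * eta).
  move: xK; rewrite IH2// -natr1 mulrDl mul1r => xK.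
  by rewrite ger0_norm; lra.
rewrite Kx mulr1 IH2 ?natr1 -?natr1 ?mulrDl ?mul1r//.
by move: Kx; rewrite -natr1 mulrDl mul1r; lra.
Qed.

(** * Integrals of selections against a bounded weight *)

Section MultiplierIntegrals.
Variables (R : realType) (X : lmodType R) (p : nat -> X -> R).
Hypothesis Xf : is_frechet p.
Variable Gamma : R -> set X.
Hypothesis Gck : forall t, I01 t -> ck p (Gamma t).
Hypothesis Gb : bochner_meas p Gamma.
Hypothesis Gp : pettis_ck p Gamma.
Local Notation mu := (@completed_lebesgue_measure R).
Local Notation I := (@I01 R : set (lebT R)).
Local Notation intble D u := (mu.-integrable (D : set (lebT R)) (EFin \o (u : lebT R -> R))).
Local Notation Int D u := (Rintegral mu (D : set (lebT R)) (u : lebT R -> R)).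
Local Notation sel := (sel p Gamma).

Definition step (s : seq (R * set R)) (t : R) : R := \sum_(q <- s) q.1 * \1_(q.2) t.

Definition step_meas (s : seq (R * set R)) :=
  forall q, q \in s -> Lmeas q.2 /\ q.2 `<=` @I01 R.

Lemma step_approx (h : R -> R) M eps : measurable_fun I (h : lebT R -> R) ->
  (forall t, I01 t -> `|h t| <= M) -> 0 < eps ->
  exists2 s, step_meas s & forall t, I01 t -> `|h t - step s t| <= eps.
Proof.
move=> mh hM eps0; pose M' := `|M| + 1.
have M'0 : 0 < M' by rewrite ltr_wpDl.
have hM' t : I01 t -> - M' < h t < M'.
  move=> It; rewrite -ltr_norml; apply: le_lt_trans (hM t It) _.
  by rewrite /M' (le_lt_trans (ler_norm M))// ltrDl.
have [K _ KP] := near_infty_natSinv_lt (PosNum (divr_gt0 eps0 (mulr_gt0 (ltr0n R 2) M'0))).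
have {KP} /= KP := KP K (leqnn K).
(* The shifted function [h + M'] takes values between 0 and [2 * M'], a range that [K.+1] steps of
   height [eta] cover exactly; the choice of [K] makes [eta <= eps]. *)
pose eta := 2 * M' / K.+1%:R.
have eta0 : 0 < eta by rewrite divr_gt0// mulr_gt0.
have etae : eta <= eps.
  by move: KP; rewrite ltr_pdivlMr ?mulr_gt0// mulrC => /ltW.
pose A i : set R := I `&` [set t | i.+1%:R * eta <= h t + M'].
exists ((- M', @I01 R) :: [seq (eta, A (val i)) | i <- enum 'I_K.+1]).
  move=> q; rewrite inE => /predU1P[->/=|/mapP[i _ ->]/=].
    by split => //; exact: measurable_I01.
  split; last by move=> t [].
  have mc : measurable_fun I (fun t : lebT R => h t + M').
    exact: measurable_funD mh (measurable_cst _).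
  exact: (measurable_fun_le (@measurable_I01 R) (measurable_cst _) mc).
move=> t It; rewrite /step big_cons big_map big_enum/= indicE mem_set// mulr1.
have x0 : 0 <= h t + M' by have := hM' t It; lra.
have [+ _] := staircase_approx K.+1 eta0 x0.
have -> : K.+1%:R * eta = 2 * M' by rewrite /eta mulrC divfK.
have -> : \sum_(i < K.+1) eta * \1_(A i) t =
    \sum_(i < K.+1) eta * (i.+1%:R * eta <= h t + M')%R%:R.
  apply: eq_bigr => i _; congr (_ * _); rewrite indicE; congr (nat_of_bool _)%:R.
  apply/idP/idP; first by rewrite inE => -[].
  by move=> hi; rewrite inE; split.
set S := \sum_(i < _) _ => hS.
rewrite (_ : h t - (- M' + S) = h t + M' - S); last by ring.
by apply: le_trans etae; apply: hS; have := hM' t It; lra.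
Qed.

(** The weak integral of [h f] over [[0, 1]]. Putting both the domain and the kernel into the weight
    lets integrals for different times be compared by linearity in [h]. *)
Definition wint (h : R -> R) (f : R -> X) (y : X) :=
  forall xs, dual p xs -> xs y = Int I (fun t => h t * xs (f t)).

Let mI := @measurable_I01 R.

Lemma sel_bddM h M f xs : measurable_fun I (h : lebT R -> R) ->
  (forall t, I01 t -> `|h t| <= M) -> sel f -> dual p xs ->
  intble I (fun t => h t * xs (f t)).
Proof.
move=> mh hM sf xd; apply: (integrable_bddM mI mh hM).
exact: (sel_integrable Xf Gck Gp).
Qed.

Lemma wint_lin a h g M N f y z : measurable_fun I (h : lebT R -> R) ->
  (forall t, I01 t -> `|h t| <= M) -> measurable_fun I (g : lebT R -> R) ->
  (forall t, I01 t -> `|g t| <= N) -> sel f ->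
  wint h f y -> wint g f z -> wint (fun t => a * h t + g t) f (a *: y + z).
Proof.
move=> mh hM mg gN sf hy gz xs xd; rewrite (dual_linf xd) hy// gz//.
have ih := sel_bddM mh hM sf xd; have ig := sel_bddM mg gN sf xd.
rewrite -(RintegralZl _ mI ih) -(RintegralD mI (integrableZ a mI ih) ig).
by apply: eq_Rintegral => t _; ring.
Qed.

Lemma wint_sub h g M N f y z : measurable_fun I (h : lebT R -> R) ->
  (forall t, I01 t -> `|h t| <= M) -> measurable_fun I (g : lebT R -> R) ->
  (forall t, I01 t -> `|g t| <= N) -> sel f ->
  wint h f y -> wint g f z -> wint (fun t => h t - g t) f (y - z).
Proof.
move=> mh hM mg gN sf hy gz.
have := wint_lin (-1) mg gN mh hM sf gz hy.
rewrite scaleN1r addrC; congr (wint _ f _); apply/funext => t; ring.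
Qed.

Lemma wint_sn_le h eta C m f y : measurable_fun I (h : lebT R -> R) ->
  (forall t, I01 t -> `|h t| <= eta) -> sel f -> wint h f y ->
  (forall xs, polar p m xs -> Int I (fun t => `|xs (f t)|) <= C) ->
  p m y <= eta * C.
Proof.
move=> mh heta sf hy hC; apply: (sn_le_polar Xf) => xs xp.
have xd := polar_dual Xf xp; have ih := sel_bddM mh heta sf xd.
have ni := integrable_norm (sel_integrable Xf Gck Gp sf xd).
have eta0 : 0 <= eta.
  by apply: le_trans (heta 0 _); rewrite ?normr_ge0// /I01/= in_itv/= lexx ler01.
rewrite hy//; apply: le_trans (ler_norm _) _; apply: le_trans (le_normr_Rintegral mI ih) _.
apply: (@le_trans _ _ (eta * Int I (fun t => `|xs (f t)|))); last first.
  by rewrite ler_wpM2l// hC.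
rewrite -(RintegralZl _ mI ni); apply: (le_Rintegral mI).
- exact: (integrable_norm ih).
- exact: (integrableZ _ mI ni).
- by move=> t It; rewrite /= normrM ler_wpM2r// heta.
Qed.

Section UltraIntegral.
Variable U : set_system nat.
Hypotheses (UU : UltraFilter U) (Uoo : \oo `<=` U).

Let wint_ulim_set E (f : nat -> R -> X) : Lmeas E -> E `<=` @I01 R ->
  (forall n, sel (f n)) -> exists2 y : nat -> X,
    forall n, wint \1_E (f n) (y n) & exists z, sncvg p U y z.
Proof.
move=> mE EI sf; have [K [_ Kc _] KP] := sel_set_integral Xf Gck Gp mE EI.
have h n : exists y, K y /\ forall xs, dual p xs -> xs y = Int E (fun t => xs (f n t)).
  by have [y] := KP _ (sf n); exists y.
have [y yP] := choice h; exists y => [n xs xd|]; last first.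
  by have [z _] := compact_ulim Xf UU Kc (fun n => (yP n).1); exists z.
rewrite (yP n).2// -[in LHS](setIidr EI) Rintegral_patch; apply: eq_Rintegral => t _.
by rewrite indicE; case: ifP => _; rewrite ?mul1r ?mul0r.
Qed.

Lemma step_measurable s : step_meas s -> measurable_fun I (step s : lebT R -> R).
Proof.
elim: s => [_|q s IH ms].
  rewrite (_ : step [::] = cst 0); first exact: measurable_cst.
  by apply/funext => t; rewrite /step big_nil.
rewrite (_ : step _ = (fun t : lebT R => q.1 * \1_(q.2) t + step s t)); last first.
  by apply/funext => t; rewrite /step big_cons.
apply: measurable_funD; last by apply: IH => r rs; apply: ms; rewrite inE rs orbT.
apply: measurable_funM; first exact: measurable_cst.
apply: measurable_funTS; apply: measurable_indic.
by case: (ms q (mem_head _ _)).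
Qed.

Lemma step_bounded s t : `|step s t| <= \sum_(q <- s) `|q.1|.
Proof.
apply: le_trans (ler_norm_sum _ _ _) _; apply: ler_sum => q _.
by rewrite normrM ler_piMr// indicE; case: (_ \in _); rewrite ?normr1 ?normr0.
Qed.

Let wint_ulim_step s (f : nat -> R -> X) : step_meas s ->
  (forall n, sel (f n)) -> exists2 y : nat -> X,
    forall n, wint (step s) (f n) (y n) & exists z, sncvg p U y z.
Proof.
move=> + sf; elim: s => [_|q s IH ms].
  exists (fun=> 0) => [n xs xd|].
    rewrite (linf0 (dual_linf xd)) (_ : (fun t => _) = cst 0) ?Rintegral_cst ?mul0r//.
    by apply/funext => t; rewrite /step big_nil mul0r.
  exists 0 => m e e0; apply: (@filterS _ U _ setT); last exact: filterT.
  by move=> n _ /=; rewrite subrr sn0.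
have [mq qI] := ms q (mem_head _ _).
have ms' : step_meas s by move=> r rs; apply: ms; rewrite inE rs orbT.
have [y yP [z yz]] := IH ms'; have [y' yP' [z' yz']] := wint_ulim_set mq qI sf.
exists (fun n => q.1 *: y' n + y n) => [n|].
  rewrite (_ : step _ = (fun t => q.1 * \1_(q.2) t + step s t)); last first.
    by apply/funext => t; rewrite /step big_cons.
  have m1 : measurable_fun I (\1_(q.2) : lebT R -> R).
    by apply: measurable_funTS; exact: measurable_indic.
  have b1 t : I01 t -> `|\1_(q.2) t : R| <= 1.
    by move=> _; rewrite indicE; case: (_ \in _); rewrite ?normr1 ?normr0.
  exact: (wint_lin q.1 m1 b1 (step_measurable ms') (fun t _ => step_bounded s t)
    (sf n) (yP' n) (yP n)).
exists (q.1 *: z' + z) => m e e0.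
have e20 : 0 < e / 2 by lra.
have q0 : 0 < `|q.1| + 1 by rewrite ltr_wpDl.
have eq0 : 0 < e / 2 / (`|q.1| + 1) by rewrite divr_gt0.
apply: filterS (filterI (yz m _ e20) (yz' m _ eq0)) => n [/= h1 h2].
rewrite opprD addrACA -scalerBr; apply: le_lt_trans (snD Xf m _ _) _.
rewrite snZ//; have : `|q.1| * p m (y' n - z') <= e / 2.
  apply: (@le_trans _ _ ((`|q.1| + 1) * p m (y' n - z'))).
    by rewrite ler_wpM2r ?sn_ge0// lerDl.
  by rewrite mulrC -ler_pdivlMr// ltW.
by lra.
Qed.

(** For indicator weights the integrals lie in a compact set; step weights follow by linearity. A
    general [h] is a uniform limit of step weights, with errors uniform in [n] by [sel_bounded], so
    completeness gives both the integral for each [n] and its limit along [U]. *)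
Lemma wint_ulim h M (f : nat -> R -> X) : measurable_fun I (h : lebT R -> R) ->
  (forall t, I01 t -> `|h t| <= M) -> (forall n, sel (f n)) ->
  exists2 y : nat -> X, forall n, wint h (f n) (y n) & exists z, sncvg p U y z.
Proof.
move=> mh hM sf.
have happ N : exists s, step_meas s /\ forall t, I01 t -> `|h t - step s t| <= N.+1%:R^-1.
  have N0 : 0 < N.+1%:R^-1 :> R by rewrite invr_gt0.
  by have [s] := step_approx mh hM N0; exists s.
have [s sP] := choice happ.
have hy N : exists y : nat -> X, (forall n, wint (step (s N)) (f n) (y n)) /\
    exists z, sncvg p U y z.
  by have [y] := wint_ulim_step (sP N).1 sf; exists y.
have [y yP] := choice hy.
have [C CP] := choice (fun m => let: ex_intro2 C a b := sel_bounded Xf Gck Gb Gp m in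
  ex_intro _ C (conj a b)).
have ms N := step_measurable (sP N).1.
have yNN m n N N' : p m (y N n - y N' n) <= (N.+1%:R^-1 + N'.+1%:R^-1) * C m.
  have md : measurable_fun I (fun t : lebT R => step (s N) t - step (s N') t).
    exact: measurable_funB.
  have bd t : I01 t -> `|step (s N) t - step (s N') t| <= N.+1%:R^-1 + N'.+1%:R^-1.
    move=> It; have h1 := (sP N).2 t It; have h2 := (sP N').2 t It.
    rewrite (_ : _ - _ = (h t - step (s N') t) - (h t - step (s N) t)); last by ring.
    by apply: le_trans (ler_normB _ _) _; rewrite addrC lerD.
  have wd := wint_sub (ms N) (fun t _ => step_bounded (s N) t) (ms N')
    (fun t _ => step_bounded (s N') t) (sf n) ((yP N).1 n) ((yP N').1 n).
  exact: (wint_sn_le md bd (sf n) wd (fun xs xp => (CP m).2 _ xs (sf n) xp)).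
have small m (e : R) : 0 < e -> exists N, forall N', (N <= N')%N -> N'.+1%:R^-1 * C m < e.
  move=> e0; have C0 : 0 < C m by case: (CP m).
  have [N _ NP] := near_infty_natSinv_lt (PosNum (divr_gt0 e0 C0)).
  by exists N => N' /NP /=; rewrite ltr_pdivlMr.
(* Here [n] is fixed and the ultrafilter acts on the approximation index [N], which produces the
   integral itself; the limit in [n] comes last. *)
have hlim n : exists z, sncvg p U (fun N => y N n) z.
  apply: (ulim_complete Xf UU) => m e e0; have e20 : 0 < e / 2 by lra.
  have [N0 NP] := small m _ e20; exists (y N0 n); apply: Uoo; exists N0 => // N /= hN.
  apply: le_lt_trans (yNN m n N N0) _; rewrite mulrDl (splitr e).
  by apply: ltrD; apply: NP.
have [z zP] := choice hlim.
have zw n : wint h (f n) (z n).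
  move=> xs xd; have c1 : (fun N => xs (y N n)) @ U --> xs (z n).
    exact: (dual_cvg Xf _ xd (zP n)).
  have ix := sel_integrable Xf Gck Gp (sf n) xd.
  have ih := sel_bddM mh hM (sf n) xd.
  have c2 : (fun N => Int I (fun t => step (s N) t * xs (f n t))) @ \oo -->
      Int I (fun t => h t * xs (f n t)).
    apply: (Rintegral_dominated_cvg (g := fun t => (M + 1) * `|xs (f n t)|) mI).
    - by move=> N; exact: (measurable_funM (ms N) (integrable_EFin_measurable ix)).
    - exact: integrable_EFin_measurable.
    - apply: aeW => t It; apply: cvgMl.
      apply/cvgrPdist_lt => e e0.
      have [N _ NP] := near_infty_natSinv_lt (PosNum e0).
      by exists N => // N' /NP /=; apply: le_lt_trans; exact: (sP N').2.
    - by apply: (integrableZ _ mI); exact: integrable_norm.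
    - move=> N t It; rewrite normrM ler_wpM2r//.
      rewrite (_ : step _ _ = h t - (h t - step (s N) t)); last by ring.
      apply: le_trans (ler_normB _ _) _; apply: lerD; first exact: hM.
      by apply: le_trans ((sP N).2 t It) _; rewrite invf_le1// ler1n.
  have c2' : (fun N => xs (y N n)) @ U --> Int I (fun t => h t * xs (f n t)).
    rewrite (_ : (fun N => xs (y N n)) = (fun N => Int I (fun t => step (s N) t * xs (f n t)))).
      by move=> A nA; apply: Uoo; exact: (c2 A nA).
    by apply/funext => N; exact: (yP N).1.
  by apply: (cvg_unique _ c1 c2'); exact: Rhausdorff.
exists z => //; apply: (ulim_complete Xf UU) => m e e0; have e40 : 0 < e / 4 by lra.
have [N NP] := small m _ e40; have [z' zz'] := (yP N).2.
exists z'; apply: filterS (zz' m _ e40) => n /= hn.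
apply: le_lt_trans (sn_tri Xf m (y N n) _ _) _.
have md : measurable_fun I (fun t : lebT R => h t - step (s N) t).
  exact: measurable_funB.
have wd := wint_sub mh hM (ms N) (fun t _ => step_bounded (s N) t) (sf n) (zw n) ((yP N).1 n).
have := wint_sn_le md (sP N).2 (sf n) wd (fun xs xp => (CP m).2 _ xs (sf n) xp).
move=> /le_lt_trans => /(_ _ (NP N (leqnn N))).
by lra.
Qed.

End UltraIntegral.
End MultiplierIntegrals.

Section AlmostEverywhere.
Variable R : realType.
Local Notation mu := (@completed_lebesgue_measure R).
Local Notation intble D u := (mu.-integrable (D : set (lebT R)) (EFin \o (u : lebT R -> R))).
Local Notation Int D u := (Rintegral mu (D : set (lebT R)) (u : lebT R -> R)).
Implicit Types (D A B : set (lebT R)) (f g h u : lebT R -> R).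

Lemma integrable_ae_eq D f g : measurable D -> intble D f ->
  {ae mu, forall t, D t -> f t = g t} -> intble D g /\ Int D f = Int D g.
Proof.
move=> mD fi fg; have [mf ff] := integrableP _ _ _ fi.
have fg' : ae_eq mu D (EFin \o f) (EFin \o g).
  by apply: ae_mono fg => t h Dt; rewrite /= (h Dt).
have mg : measurable_fun D (EFin \o g).
  exact: (ae_measurable_fun completed_lebesgue_measure_is_complete fg' mf).
have nfg : ae_eq mu D (fun t => `|(EFin \o f) t|%E) (fun t => `|(EFin \o g) t|%E).
  by apply: ae_mono fg' => t h Dt; rewrite (h Dt).
split; last by rewrite /Rintegral (ae_eq_integral _ _ mD mf mg fg').
apply/integrableP; split => //; apply: le_lt_trans ff; rewrite le_eqVlt; apply/orP; left.
apply/eqP/esym; apply: (ae_eq_integral _ _ mD _ _ nfg); exact: measurableT_comp.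
Qed.

Lemma Rintegral_ae_le D f g : measurable D -> intble D f -> intble D g ->
  {ae mu, forall t, D t -> f t <= g t} -> Int D f <= Int D g.
Proof.
move=> mD fi gi fg.
have h : {ae mu, forall t, D t -> f t = Num.min (f t) (g t)}.
  by apply: ae_mono fg => t fg Dt; rewrite min_l// fg.
have [mi ->] := integrable_ae_eq mD fi h.
by apply: (le_Rintegral mD mi gi) => t _; rewrite /= ge_min lexx orbT.
Qed.

End AlmostEverywhere.

(** * Cut-off kernels and equicontinuity *)

Section Kernel.
Variables (R : realType) (X : lmodType R) (p : nat -> X -> R).
Hypothesis Xf : is_frechet p.
Variable Gamma : R -> set X.
Hypothesis Gck : forall t, I01 t -> ck p (Gamma t).
Hypothesis Gb : bochner_meas p Gamma.
Hypothesis Gp : pettis_ck p Gamma.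
Local Notation mu := (@completed_lebesgue_measure R).
Local Notation I := (@I01 R : set (lebT R)).
Local Notation intble D u := (mu.-integrable (D : set (lebT R)) (EFin \o (u : lebT R -> R))).
Local Notation Int D u := (Rintegral mu (D : set (lebT R)) (u : lebT R -> R)).
Local Notation sel := (sel p Gamma).
Local Notation wint := (wint p).

Let mI := @measurable_I01 R.

(* Bounds on the kernel only hold almost everywhere; truncating at [N] makes them
   hold everywhere without changing integrals. *)
Definition cutoff (E : set R) (g : R -> R) (N : R) : R -> R :=
  g \_ (E `&` [set s | `|g s| <= N]).

Lemma cutoff_measurable E g N : Lmeas E -> E `<=` @I01 R ->
  measurable_fun I (g : lebT R -> R) -> measurable_fun I (cutoff E g N : lebT R -> R).
Proof.
move=> mE EI mg; have mng : measurable_fun I (fun s : lebT R => `|g s|).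
  exact: measurableT_comp.
have mA : measurable (E `&` (I `&` [set s : lebT R | `|g s| <= N]) : set (lebT R)).
  apply: measurableI => //; exact: (measurable_fun_le mI mng (measurable_cst _)).
have -> : cutoff E g N = g \_ (E `&` (I `&` [set s | `|g s| <= N])).
  rewrite /cutoff; congr patch; apply/seteqP; split=> s /=; first by move=> [/[dup] /EI].
  by move=> [Es [_ ?]].
apply/(measurable_restrict _ mA mI); apply: measurable_funS mg => //; exact: subIsetl.
Qed.

Lemma cutoff_bounded E g N s : `|cutoff E g N s| <= `|N|.
Proof.
rewrite /cutoff patchE; case: ifP; last by rewrite normr0.
by rewrite inE => -[_ /= gN]; apply: le_trans gN (ler_norm N).
Qed.

Lemma cutoffE E g N s : `|g s| <= N -> cutoff E g N s = if s \in E then g s else 0.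
Proof.
move=> gN; rewrite /cutoff patchE; congr (if _ then _ else _).
by apply/idP/idP; rewrite !inE; [case|move=> Es; split].
Qed.

Lemma wint_cutoff_pettis E g N f y : Lmeas E -> E `<=` @I01 R ->
  measurable_fun I (g : lebT R -> R) -> {ae mu, forall s, I01 s -> `|g s| <= N} ->
  sel f -> wint (cutoff E g N) f y -> is_pettis_integral p E (fun s => g s *: f s) y.
Proof.
move=> mE EI mg gN sf yw xs xd.
have iu := sel_bddM Xf Gck Gp (cutoff_measurable N mE EI mg)
  (fun s _ => @cutoff_bounded E g N s) sf xd.
have iuE := integrable_subset mI mE EI iu.
have [iv uv] : intble E (fun s => xs (g s *: f s)) /\
    Int E (fun s => cutoff E g N s * xs (f s)) = Int E (fun s => xs (g s *: f s)).
  apply: (integrable_ae_eq mE iuE); apply: ae_mono gN => s gs Es.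
  by rewrite (cutoffE E (gs (EI _ Es))) mem_set// (linfZ _ _ (dual_linf xd)).
split; first exact: iv.
rewrite (yw _ xd) (Rintegral_setID mI mE iu) (setIidr EI).
rewrite [X in _ + X](_ : _ = 0); last first.
  rewrite (@eq_Rintegral _ _ _ mu (I `\` E) (fun=> 0)) ?Rintegral_cst ?mul0r//.
    exact: measurableD.
  move=> s; rewrite inE => -[_ nE]; rewrite /cutoff patchE memNset ?mul0r//.
  by case.
by rewrite addr0 uv /Rintegral fineK//; exact: integrable_fin_num.
Qed.

Lemma wint_exists h M f : measurable_fun I (h : lebT R -> R) ->
  (forall t, I01 t -> `|h t| <= M) -> sel f -> exists y, wint h f y.
Proof.
move=> mh hM sf; have [U [UU Uoo]] := ultra_oo.
have [y yP _] := wint_ulim Xf Gck Gb Gp UU Uoo mh hM (fun _ => sf).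
by exists (y 0%N).
Qed.

Lemma sel_pettis_integrable f : sel f -> pettis_integrable p (@I01 R) f.
Proof.
move=> sf; split=> [xs xd|E mE EI]; first exact: (sel_integrable Xf Gck Gp).
have [K _ /(_ f sf)[y _ yP]] := sel_set_integral Xf Gck Gp mE EI.
exists y => xs xd; have h := sel_integrableS Xf Gck Gp mE EI sf xd.
by split; [exact: h|rewrite yP// /Rintegral fineK//; exact: integrable_fin_num].
Qed.

Lemma cutoff_pettis_integrable E g N f : Lmeas E -> E `<=` @I01 R ->
  measurable_fun I (g : lebT R -> R) -> {ae mu, forall s, I01 s -> `|g s| <= N} ->
  sel f -> pettis_integrable p E (fun s => g s *: f s).
Proof.
move=> mE EI mg gN sf.
have h A : Lmeas A -> A `<=` @I01 R -> exists y, is_pettis_integral p A (fun s => g s *: f s) y.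
  move=> mA AI.
  have [y yP] := wint_exists (cutoff_measurable N mA AI mg)
    (fun s _ => @cutoff_bounded A g N s) sf.
  by exists y; exact: wint_cutoff_pettis yP.
split=> [xs xd|A mA AE]; last by apply: h => // t /AE /EI.
by have [y /(_ xs xd)[]] := h E mE EI.
Qed.

Variables (k : R -> R -> R) (M : R -> R).
Hypothesis kL : forall t, I01 t -> measurable_fun I (k t : lebT R -> R).
Hypothesis kM : forall t, I01 t -> {ae mu, forall s, I01 s -> `|k t s| <= M t}.
Hypothesis kc : kernel_cont k.

Lemma itv0_I01 (t : R) : I01 t -> `[0, t] `<=` @I01 R.
Proof.
rewrite /I01 /= in_itv/= => /andP[_ t1] s /=; rewrite !in_itv/= => /andP[-> st].
exact: le_trans st t1.
Qed.

Lemma measurable_itv_lebT (i : interval R) : Lmeas [set` i].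
Proof. by apply: sub_caratheodory; exact: measurable_itv. Qed.

Definition ker t : R -> R := cutoff `[0, t] (k t) (M t).

Lemma ker_measurable t : I01 t -> measurable_fun I (ker t : lebT R -> R).
Proof.
move=> It; apply: cutoff_measurable; [exact: measurable_itv_lebT|exact: itv0_I01|exact: kL].
Qed.

Lemma ker_bounded t s : `|ker t s| <= `|M t|.
Proof. exact: cutoff_bounded. Qed.

(** Where both kernels are active they differ by at most [e1], and [sel_bounded] applies; on the
    strip [B] between [t] and [t'] only one is active, and absolute continuity applies. Both
    estimates are uniform in [f], so [d] can be chosen before it. *)
Lemma wint_ker_equicontinuous t m (eps : R) : I01 t -> 0 < eps -> exists2 d : R, 0 < d &
  forall t' f y y', I01 t' -> `|t - t'| < d -> sel f -> wint (ker t) f y ->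
    wint (ker t') f y' -> p m (y - y') <= eps.
Proof.
move=> It eps0; have [C C0 CP] := sel_bounded Xf Gck Gb Gp m.
pose e1 := eps / 2 / C; have e10 : 0 < e1 by rewrite !divr_gt0.
(* [N] also bounds [k t'] almost everywhere, by closeness to [k t]; the constants [M t'] are not
   known to be bounded near [t]. *)
pose N := `|M t| + e1; have N0 : 0 < N by rewrite ltr_wpDl.
have eN : 0 < eps / 2 / N by rewrite !divr_gt0.
have [d1 d10 acP] := sel_abs_continuous Xf Gck Gb Gp m eN.
have [d2 [d20 kP]] := kc It e10.
exists (Num.min d1 d2); first by rewrite lt_min d10.
move=> t' f y y' It' + sf yw y'w; rewrite lt_min => /andP[td1 td2].
apply: (sn_le_polar Xf) => xs xp; have xd := polar_dual Xf xp.
pose B : set R := `]Num.min t t', Num.max t t']%classic.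
have mB : Lmeas B by exact: measurable_itv_lebT.
have BI : B `<=` @I01 R.
  move=> s; rewrite /B /I01 /= !in_itv/= => /andP[ms sM].
  move: It It'; rewrite /I01 /= !in_itv/= => /andP[t0 t1] /andP[t'0 t'1].
  apply/andP; split; first by apply: le_trans (ltW ms); rewrite le_min t0.
  by apply: le_trans sM _; rewrite ge_max t1.
have muB : fine (mu B) <= d1.
  rewrite /B completed_lebesgue_measureE lebesgue_measure_itv/= lte_fin.
  case: ifP => _ /=; last exact: ltW.
  by rewrite maxr_absE minr_absE; move: td1; lra.
have ni := integrable_norm (sel_integrable Xf Gck Gp sf xd).
have dw := wint_sub Xf Gck Gp (ker_measurable It) (fun s _ => ker_bounded t s)
  (ker_measurable It') (fun s _ => ker_bounded t' s) sf yw y'w.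
have md : measurable_fun I (fun s : lebT R => ker t s - ker t' s).
  by apply: measurable_funB; exact: ker_measurable.
have bd s : I01 s -> `|ker t s - ker t' s| <= `|M t| + `|M t'|.
  by move=> _; apply: le_trans (ler_normB _ _) _; rewrite lerD// ker_bounded.
have id := sel_bddM Xf Gck Gp md bd sf xd.
pose g s := e1 * `|xs (f s)| + N * ((fun s => `|xs (f s)|) \_ B) s.
have i1 : intble I (fun s => e1 * `|xs (f s)|) by exact: (integrableZ _ mI ni).
have i2 : intble I (fun s => N * ((fun s => `|xs (f s)|) \_ B) s).
  by apply: (integrableZ _ mI); exact: (integrable_patch mI mB ni).
have ig : intble I g by exact: (integrableD mI i1 i2).
rewrite (dw _ xd); apply: (@le_trans _ _ (Int I g)).
  apply: (Rintegral_ae_le mI id ig).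
  apply: ae_mono (ae_setI (ae_setI (kM It) (kM It')) (kP t' It' td2)).
  move=> s [[ks ks'] kk] Is; have {}ks := ks Is; have {}ks' := ks' Is; have {}kk := kk Is.
  apply: le_trans (ler_norm _) _; rewrite normrM /g patchE.
  have s0 : 0 <= s by move: Is; rewrite /I01 /= in_itv/= => /andP[].
  rewrite /ker (cutoffE _ ks) (cutoffE _ ks').
  have inE' r : (s \in `[0, r]%classic) = (s <= r).
    apply/idP/idP => [/set_mem|sr]; first by rewrite /= in_itv/= => /andP[].
    by apply: mem_set; rewrite /= in_itv/= s0.
  have inB : (s \in B) = (Num.min t t' < s) && (s <= Num.max t t').
    apply/idP/idP => [/set_mem|sr]; first by rewrite /B /= in_itv.
    by apply: mem_set; rewrite /B /= in_itv.
  rewrite !inE' inB gt_min le_max !ltNge.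
  have x0 := normr_ge0 (xs (f s)).
  have ktN : `|k t s| <= N.
    by apply: le_trans ks _; apply: le_trans (ler_norm _) _; rewrite lerDl ltW.
  have kt'N : `|k t' s| <= N.
    rewrite (_ : k t' s = k t s - (k t s - k t' s)); last by ring.
    apply: le_trans (ler_normB _ _) _; apply: lerD => //.
    exact: le_trans ks (ler_norm _).
  have e1x : 0 <= e1 * `|xs (f s)| by rewrite mulr_ge0// ltW.
  case: (s <= t); case: (s <= t') => /=; rewrite ?mulr0 ?addr0 ?subr0 ?sub0r ?normrN.
  - by rewrite ler_wpM2r.
  - by rewrite ler_wpDl// ler_wpM2r.
  - by rewrite ler_wpDl// ler_wpM2r.
  - by rewrite normr0 mul0r.
rewrite (RintegralD mI i1 i2) (RintegralZl _ mI ni) (RintegralZl _ mI (integrable_patch mI mB ni)).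
rewrite -Rintegral_patch (setIidr BI).
have h1 : e1 * Int I (fun s => `|xs (f s)|) <= eps / 2.
  apply: (@le_trans _ _ (e1 * C)); first by rewrite ler_wpM2l ?(ltW e10)// CP.
  by rewrite /e1 divfK// gt_eqF.
have h2 : N * Int B (fun s => `|xs (f s)|) <= eps / 2.
  have := acP B f xs mB BI muB sf xp.
  by rewrite ler_pdivlMr// mulrC.
by rewrite (splitr eps) lerD.
Qed.

End Kernel.

(** * Delayed solutions *)

Section Tonelli.
Variables (R : realType) (X : lmodType R) (p : nat -> X -> R).
Hypothesis Xf : is_frechet p.
Variable Gamma : R -> set X.
Hypothesis Gck : forall t, I01 t -> ck p (Gamma t).
Hypothesis Gb : bochner_meas p Gamma.
Hypothesis Gp : pettis_ck p Gamma.
Local Notation mu := (@completed_lebesgue_measure R).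
Local Notation I := (@I01 R : set (lebT R)).
Local Notation sel := (sel p Gamma).
Local Notation wint := (wint p).
Variables (k : R -> R -> R) (M : R -> R).
Hypothesis kL : forall t, I01 t -> measurable_fun I (k t : lebT R -> R).
Hypothesis kM : forall t, I01 t -> {ae mu, forall s, I01 s -> `|k t s| <= M t}.
Hypothesis kc : kernel_cont k.
Local Notation ker := (ker k M).
Variable x0 : X.

Let mI := @measurable_I01 R.

Lemma dual_separates y z : (forall xs, dual p xs -> xs y = xs z) -> y = z.
Proof.
move=> yz; apply/eqP; rewrite -subr_eq0; apply/eqP; apply: (sn_eq0 Xf) => m e e0.
apply: le_lt_trans e0; apply: (sn_le_polar Xf) => xs xp.
by rewrite (linfB _ _ xp.1) (yz _ (polar_dual Xf xp)) subrr.
Qed.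

Definition primitive (f x : R -> X) := forall t, I01 t -> wint (ker t) f (x t - x0).

Lemma primitive_exists f : sel f -> exists x, primitive f x.
Proof.
move=> sf; have h t : exists y, I01 t -> wint (ker t) f (y - x0).
  have [It|nIt] := pselect (I01 t); last by exists 0.
  have [y yP] := wint_exists Xf Gck Gb Gp (ker_measurable M kL It)
    (fun s _ => ker_bounded k M t s) sf.
  by exists (y + x0); rewrite addrK.
by have [x xP] := choice h; exists x.
Qed.

Lemma primitive_equicontinuous t m (eps : R) : I01 t -> 0 < eps -> exists2 d : R, 0 < d &
  forall t' f x, I01 t' -> `|t - t'| < d -> sel f -> primitive f x ->
    p m (x t - x t') <= eps.
Proof.
move=> It eps0.
have [d d0 dP] := wint_ker_equicontinuous Xf Gck Gb Gp kL kM kc m It eps0.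
exists d => // t' f x It' tt' sf fx.
have := dP t' f _ _ It' tt' sf (fx t It) (fx t' It').
by rewrite opprB addrA subrK.
Qed.

Lemma primitive_continuous f x : sel f -> primitive f x -> fcont01 p x.
Proof.
move=> sf fx t It e e0; have [m [d d0 dP]] := fdist_lt_sn Xf e0.
have d20 : 0 < d / 2 by lra.
have [r r0 rP] := primitive_equicontinuous m It d20.
exists r; split => // s Is st; apply: dP.
rewrite (snC Xf); rewrite distrC in st; apply: le_lt_trans (rP s f x Is st sf fx) _.
by lra.
Qed.

(** Causality: the kernel vanishes after [t], and the point [t] itself is null. The method of steps
    can thus alter a selection later without changing the past. *)
Lemma primitive_local f g x y t : sel f -> sel g -> primitive f x -> primitive g y ->
  I01 t -> (forall s, I01 s -> s < t -> f s = g s) -> x t = y t.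
Proof.
move=> sf sg fx gy It fg; apply: (addIr (- x0)); apply: dual_separates => xs xd.
rewrite (fx t It _ xd) (gy t It _ xd).
have ifx := sel_bddM Xf Gck Gp (ker_measurable M kL It) (fun s _ => ker_bounded k M t s) sf xd.
apply: (integrable_ae_eq mI ifx _).2; exists [set t]; split.
- by apply: sub_caratheodory; exact: measurable_set1.
- by rewrite completed_lebesgue_measureE lebesgue_measure_set1.
move=> s /= h; apply: contrapT => st; apply: h => Is.
have [sltt|tlts] := ltP s t; first by rewrite fg.
rewrite /ker /cutoff patchE memNset ?mul0r// => -[/=]; rewrite in_itv/= => /andP[_ st'].
by move=> _; apply: st; apply/eqP; rewrite eq_le st'.
Qed.

Variable F : R -> X -> set X.
Hypothesis Fck : forall t x, I01 t -> ck p (F t x).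
Hypothesis Fb : forall x : R -> X, fcont01 p x -> bochner_meas p (fun t => F t (x t)).
Hypothesis FG : forall t x, I01 t -> F t x `<=` Gamma t.

Definition delay (h t : R) := Num.max (t - h) 0.

Lemma delay_I01 h t : 0 <= h -> I01 t -> I01 (delay h t).
Proof.
rewrite /I01 /= !in_itv/= /delay le_max lexx orbT/= => h0 /andP[_ t1].
by rewrite ge_max ler01 andbT; lra.
Qed.

Lemma delay_dist h s t : `|delay h s - delay h t| <= `|s - t|.
Proof.
have h1 := ler_norm (s - t); have h2 := ler_norm (t - s); rewrite distrC in h2.
have h3 := normr_ge0 (s - t); move: h1 h2 h3; move: `|s - t| => a h1 h2 h3.
rewrite /delay ler_norml.
by case: (leP (s - h) 0) => hs; case: (leP (t - h) 0) => ht; apply/andP; split; lra.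
Qed.

Lemma delay_close h t : 0 <= h -> I01 t -> `|t - delay h t| <= h.
Proof.
rewrite /I01 /= in_itv/= /delay => h0 /andP[t0 _].
rewrite ler_norml; case: (leP (t - h) 0) => th; apply/andP; split; lra.
Qed.

Lemma delay_continuous h x : 0 <= h -> fcont01 p x -> fcont01 p (x \o delay h).
Proof.
move=> h0 cx t It e e0; have [d [d0 dP]] := cx _ (delay_I01 h0 It) e e0.
exists d; split => // s Is st; apply: dP; first exact: delay_I01.
exact: le_lt_trans (delay_dist _ _ _) st.
Qed.

(* Tonelli's method of steps: the delayed inclusion is solved successively on
   the intervals of length [h], without any fixed point theorem. *)
Lemma delayed_solution h : 0 < h -> exists f x, [/\ sel f, primitive f x &
  forall s, I01 s -> F s (x (delay h s)) (f s)].
Proof.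
move=> h0.
have steps j : exists f x, [/\ sel f, primitive f x &
    forall s, I01 s -> s < j%:R * h -> F s (x (delay h s)) (f s)].
  elim: j => [|j [f [x [sf fx Fj]]]].
    have [f [fG mf]] := measurable_selection Xf Gb Gck.
    have [x fx] := primitive_exists (conj fG mf); exists f, x; split => //.
    by move=> s; rewrite /I01 /= in_itv/= mul0r ltNge => /andP[->].
  (* Continuity of the delayed function is what the Bochner measurability hypothesis on [F]
     requires; it yields a selection [g] along the current [x]. *)
  have cx := delay_continuous (ltW h0) (primitive_continuous sf fx).
  have [g [gF mg]] := measurable_selection Xf (Fb cx) (fun t It => Fck _ It).
  have sg : sel g by split=> // t It; exact: FG (gF t It).
  (* A gluing of two selections: only the piece of index 0 can be nonempty, and [g] takes over from
     [j%:R * h] on. *)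
  pose B i : set R := if i == 0%N then I `&` `]-oo, j%:R * h[ else set0.
  have mB i : Lmeas (B i).
    rewrite /B; case: ifP => _; last exact: measurable0.
    by apply: measurableI; [exact: mI|exact: measurable_itv_lebT].
  have BI i : B i `<=` @I01 R by move=> t; rewrite /B; case: ifP => // _ [].
  have dB i i' t : B i t -> B i' t -> i = i'.
    by rewrite /B; case: eqP => // -> _; case: eqP => // ->.
  have [f' [sf' f'f f'g]] := sel_glue mB BI dB (fun _ => sf) sg.
  have [x' fx'] := primitive_exists sf'.
  have ff' s : I01 s -> s < j%:R * h -> f' s = f s.
    by move=> Is sj; apply: (f'f 0%N); rewrite /B eqxx; split => //=; rewrite in_itv.
  have xx' t : I01 t -> t <= j%:R * h -> x' t = x t.
    move=> It tj; apply: (primitive_local sf' sf fx' fx It) => s Is st.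
    by apply: ff' => //; exact: lt_le_trans st tj.
  have jh0 : 0 <= j%:R * h by rewrite mulr_ge0 ?ler0n// ltW.
  exists f', x'; split=> // s Is; rewrite -natr1 mulrDl mul1r => sj.
  have dI := delay_I01 (ltW h0) Is.
  have dj : delay h s <= j%:R * h by rewrite /delay ge_max jh0 andbT; lra.
  rewrite (xx' _ dI dj); have [sltj|jles] := ltP s (j%:R * h).
    by rewrite ff'//; exact: Fj.
  rewrite f'g; first exact: gF.
  move=> i; rewrite /B; case: ifP => [_ [_ /=]|_ []].
  by rewrite in_itv/= ltNge jles.
(* More than [1 / h] steps, so that the last interval reaches strictly beyond 1. *)
have [f [x [sf fx Fx]]] := steps (Num.truncn h^-1).+1.
exists f, x; split=> // s Is; apply: Fx => //.
move: Is; rewrite /I01 /= in_itv/= => /andP[_ s1]; apply: le_lt_trans s1 _.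
rewrite -ltr_pdivrMr// mul1r; apply: truncnS_gt.
Qed.

End Tonelli.

(** * Almost everywhere convergence of midpoints *)

(* Near-minimisers of a quadratic functional over decreasing midpoint-convex sets
   are close to each other by the parallelogram identity; this replaces weak
   compactness followed by Mazur's lemma. *)
Lemma minimizing_sequence (R : realType) (T : Type) (A : nat -> set T)
    (mid : T -> T -> T) (Q : T -> R) (D : T -> T -> R) (C : R) (eta : nat -> R) :
  (forall n, A n !=set0) -> (forall n, A n.+1 `<=` A n) ->
  (forall n u v, A n u -> A n v -> A n (mid u v)) ->
  (forall u, A 0%N u -> 0 <= Q u <= C) ->
  (forall u v, A 0%N u -> A 0%N v -> D u v = 2 * Q u + 2 * Q v - 4 * Q (mid u v)) ->
  (forall j, 0 < eta j) -> (forall j, eta j.+1 <= eta j) ->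
  exists g, (forall j, A j (g j)) /\ forall j, D (g j) (g j.+1) <= eta j.
Proof.
move=> A0 AS Amid QC DQ eta0 etaS.
have Ale i j : (i <= j)%N -> A j `<=` A i.
  by move=> /subnK <-; elim: (j - i)%N => // n IH u /AS /IH.
have A00 j : A j `<=` A 0%N by exact: Ale.
pose c n := inf (Q @` A n).
have Ainf n : has_inf (Q @` A n).
  split; first by have [u Au] := A0 n; exists (Q u), u.
  by exists 0 => _ [u Au <-]; case/andP: (QC u (A00 _ _ Au)).
have cQ n u : A n u -> c n <= Q u.
  by move=> Au; apply: ge_inf; [case: (Ainf n)|exists u].
have c_le i j : (i <= j)%N -> c i <= c j.
  move=> ij; apply: lb_le_inf; first by case: (Ainf j).
  by move=> _ [u Au <-]; apply: cQ; exact: Ale Au.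
have csup : has_sup (range c).
  split; first by exists (c 0%N), 0%N.
  exists C => _ [n _ <-]; have [u Au] := A0 n; apply: le_trans (cQ n u Au) _.
  by case/andP: (QC u (A00 _ _ Au)).
have c_sup n : c n <= sup (range c) by apply: sup_upper_bound => //; exists n.
(* The infima [c n] increase to a finite supremum. Past [N j] they are within [eta j / 8] of it, and
   so are the excesses of the near-minimisers; with the coefficients 2, 2 and 4 the errors add up to
   [eta j]. *)
have hN j : exists N, sup (range c) - eta j / 8 < c N.
  have e0 : 0 < eta j / 8 by rewrite divr_gt0.
  by have [_ [N _ <-] h] := sup_adherent e0 csup; exists N.
have [N NP] := choice hN.
(* Partial sums plus [j] are monotone and dominate both [N j] and [j]. *)
pose n j := (\sum_(i < j.+1) N i + j)%N.
have nS j : (n j <= n j.+1)%N by rewrite /n (big_ord_recr j.+1)/=; lia.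
have Nn j : (N j <= n j)%N.
  by rewrite /n big_ord_recr/=; apply: leq_trans (leq_addr _ _); exact: leq_addl.
have jn j : (j <= n j)%N by exact: leq_addl.
have hg j : exists u, A (n j) u /\ Q u < c (n j) + eta j / 8.
  have e0 : 0 < eta j / 8 by rewrite divr_gt0.
  by have [_ [u Au <-] h] := inf_adherent e0 (Ainf (n j)); exists u.
have [g gP] := choice hg; exists g; split=> j.
  by apply: Ale (jn j) _ _; case: (gP j).
have [g1 q1] := gP j; have [g2 q2] := gP j.+1.
rewrite DQ; [|exact: A00 g1|exact: A00 g2].
have h1 := cQ _ _ (Amid _ _ _ g1 (Ale _ _ (nS j) _ g2)).
have h2 := c_le _ _ (Nn j); have h3 := NP j; have h4 := c_sup (n j.+1).
have h5 := etaS j; have h6 := eta0 j.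
by lra.
Qed.

Section AlmostEverywhereCauchy.
Variables (R : realType) (X : lmodType R) (p : nat -> X -> R).
Hypothesis Xf : is_frechet p.
Variable Gamma : R -> set X.
Hypothesis Gck : forall t, I01 t -> ck p (Gamma t).
Hypothesis Gp : pettis_ck p Gamma.
Local Notation mu := (@completed_lebesgue_measure R).
Local Notation I := (@I01 R : set (lebT R)).
Local Notation intble D u := (mu.-integrable (D : set (lebT R)) (EFin \o (u : lebT R -> R))).
Local Notation Int D u := (Rintegral mu (D : set (lebT R)) (u : lebT R -> R)).
Local Notation sel := (sel p Gamma).

Let mI := @measurable_I01 R.

Let half_sum n : series (fun j => (2 ^+ j)^-1 : R) n <= 2.
Proof.
suff -> : series (fun j => (2 ^+ j)^-1 : R) n = 2 - 2 * (2 ^+ n)^-1.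
  by rewrite gerBl mulr_ge0// invr_ge0 exprn_ge0.
elim: n => [|n IH]; first by rewrite /series/= big_geq// expr0 invr1; lra.
rewrite seriesSr IH exprS invfM; move: (2 ^+ n)^-1 => a; lra.
Qed.

(** Monotone convergence: the sum has integral at most [K * 2], so it is finite almost
    everywhere. *)
Lemma ae_summable (u : nat -> lebT R -> R) K : (forall j, intble I (u j)) ->
  (forall j t, I t -> 0 <= u j t) -> (forall j, Int I (u j) <= K * (2 ^+ j)^-1) ->
  {ae mu, forall t, I t -> cvgn (series (fun j => u j t))}.
Proof.
move=> ui u0 uK.
have mu_ j : measurable_fun I (EFin \o u j).
  by apply/measurable_EFinP; exact: integrable_EFin_measurable.
have K0 : 0 <= K.
  have := uK 0%N; rewrite expr0 invr1 mulr1; apply: le_trans.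
  by apply: Rintegral_ge0 => t; exact: u0.
have u0' j t : I t -> (0 <= (EFin \o u j) t)%E by move=> It; rewrite lee_fin u0.
have mS : measurable_fun I (fun t => \sum_(j <oo) (EFin \o u j) t)%E.
  by apply: (ge0_emeasurable_sum (P := xpredT)) => [j t It _|j _]; [exact: u0'|exact: mu_].
have iS : mu.-integrable I (fun t => \sum_(j <oo) (EFin \o u j) t)%E.
  apply/integrableP; split => //.
  rewrite (eq_integral (fun t => \sum_(j <oo) (EFin \o u j) t)%E); last first.
    by move=> t; rewrite inE => It; rewrite gee0_abs// nneseries_ge0// => j _ _; exact: u0'.
  rewrite (integral_nneseries mu mI mu_ u0').
  apply: (@le_lt_trans _ _ (K * 2)%:E); last exact: ltry.
  apply: lime_le.
    by apply: is_cvg_nneseries => j _ _; apply: integral_ge0 => t; exact: u0'.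
  apply: nearW => n.
  rewrite (eq_bigr (fun j => (Int I (u j))%:E)); last first.
    by move=> j _; rewrite /Rintegral fineK ?(integrable_fin_num mI (ui j)).
  rewrite sumEFin lee_fin; apply: (@le_trans _ _ (\sum_(0 <= j < n) K * (2 ^+ j)^-1)).
    by apply: ler_sum => j _; exact: uK.
  by rewrite -mulr_sumr ler_wpM2l//; exact: half_sum.
apply: ae_mono (integrable_ae mI iS) => t tS It; have {}tS := tS It.
apply: nondecreasing_is_cvgn.
  by apply/nondecreasing_seqP => n; rewrite seriesSr lerDl u0.
exists (fine (\sum_(j <oo) (EFin \o u j) t)%E) => _ [n _ <-].
rewrite -lee_fin fineK// /series/= -sumEFin.
by apply: nneseries_lim_ge => j _ _; exact: u0'.
Qed.

Variable xs : nat -> X -> R.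
Hypothesis xd : forall i, dual p (xs i).

(** The functionals along a selection are only integrable; dividing by a weight common to all
    selections makes them bounded by 1, hence square integrable. The division is linear in [u] and
    is undone pointwise once convergence is known. *)
Let co i (u : R -> X) (t : R) := xs i (u t) / (1 + envelope Gamma (xs i) t).

Let env_ge0 i t : 0 <= envelope Gamma (xs i) t.
Proof. by rewrite /envelope addr_ge0. Qed.

Let env1_gt0 i t : 0 < 1 + envelope Gamma (xs i) t.
Proof. by rewrite ltr_pwDl. Qed.

Definition smeas (u : R -> X) := forall f, dual p f ->
  measurable_fun I (fun t : lebT R => f (u t)).

Let co_meas i u : smeas u -> measurable_fun I (co i u : lebT R -> R).
Proof.
move=> mu_; apply: measurable_funM; first exact: mu_.
have me : measurable_fun I (fun t : lebT R => 1 + envelope Gamma (xs i) t).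
  apply: measurable_funD; first exact: measurable_cst.
  exact: integrable_EFin_measurable (envelope_integrable Gp (xd i)).
rewrite (_ : (fun t => _) = (fun t : lebT R => (1 + envelope Gamma (xs i) t) `^ (-1))).
  exact: (measurableT_comp (measurable_powR (-1)) me).
by apply/funext => t; rewrite powR_inv1// ltW.
Qed.

Let co_le1 i u t : I01 t -> Gamma t (u t) -> `|co i u t| <= 1.
Proof.
move=> It Gu; have e1 := env1_gt0 i t; rewrite /co normrM normfV (gtr0_norm e1).
rewrite ler_pdivrMr// mul1r; apply: le_trans (le_envelope Xf Gck (xd i) It Gu) _.
by rewrite lerDr.
Qed.

Let mid (u v : R -> X) (t : R) := 2^-1 *: (u t + v t).

Let dif (u v : R -> X) (t : R) := u t - v t.

Lemma sel_mid u v : sel u -> sel v -> sel (mid u v).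
Proof.
move=> [uG mu_] [vG mv]; split=> [t It|f fd].
  have [_ _] := Gck It; move=> /(_ (u t) (v t) 2^-1 (uG t It) (vG t It)).
  rewrite /mid scalerDr (_ : 1 - 2^-1 = 2^-1 :> R); last by field.
  by apply; rewrite invr_ge0 ler0n/= invf_le1// ler1n.
have -> : (fun t : lebT R => f (mid u v t)) = (fun t => 2^-1 * (f (u t) + f (v t))).
  by apply/funext => t; rewrite /mid (linfZ _ _ (dual_linf fd)) (linfD _ _ (dual_linf fd)).
apply: measurable_funM; first exact: measurable_cst.
by apply: measurable_funD; [exact: mu_|exact: mv].
Qed.

Let dif_meas u v : sel u -> sel v -> smeas (dif u v).
Proof.
move=> [_ mu_] [_ mv] f fd.
have -> : (fun t : lebT R => f (dif u v t)) = (fun t => f (u t) - f (v t)).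
  by apply/funext => t; rewrite /dif (linfB _ _ (dual_linf fd)).
by apply: measurable_funB; [exact: mu_|exact: mv].
Qed.

Let co_dif i u v t : co i (dif u v) t = co i u t - co i v t.
Proof. by rewrite /co /dif (linfB _ _ (dual_linf (xd i))) mulrBl. Qed.

Let co_mid i u v t : co i (mid u v) t = 2^-1 * (co i u t + co i v t).
Proof.
rewrite /co /mid (linfZ _ _ (dual_linf (xd i))) (linfD _ _ (dual_linf (xd i))).
by rewrite -mulrDl mulrA.
Qed.

Let sq i (u : R -> X) (t : R) := co i u t ^+ 2.

Let sq_int i u B : smeas u -> (forall t, I01 t -> `|co i u t| <= B) -> intble I (sq i u).
Proof.
move=> mu_ uB.
apply: (integrable_dominated mI
  (@integrable_cst_I01 R I (B ^+ 2) mI (@subset_refl _ _))).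
  exact: measurable_funX (co_meas i mu_).
move=> t It; rewrite /sq normrX lerXn2r ?nnegrE ?normr_ge0//; last exact: uB.
exact: le_trans (normr_ge0 _) (uB t It).
Qed.

Let sel_sq_int i u : sel u -> intble I (sq i u).
Proof.
by move=> [uG mu_]; apply: (sq_int mu_ (B := 1)) => t It; apply: co_le1 => //; exact: uG.
Qed.

Let dif_le2 i u v t : sel u -> sel v -> I01 t -> `|co i (dif u v) t| <= 2.
Proof.
move=> [uG _] [vG _] It; rewrite co_dif; apply: le_trans (ler_normB _ _) _.
have := co_le1 i It (uG t It); have := co_le1 i It (vG t It); lra.
Qed.

Let sel_sq_le1 i u : sel u -> 0 <= Int I (sq i u) <= 1.
Proof.
move=> su; apply/andP; split; first by apply: Rintegral_ge0 => t _; exact: sqr_ge0.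
have := Rintegral_le_cst mI (@subset_refl _ _) (sel_sq_int i su).
move=> /(_ 1); rewrite mu_I01 mulr1; apply => t It.
have := co_le1 i It (su.1 t It).
by rewrite /sq -(real_normK (num_real (co i u t))) expr_le1.
Qed.

Let parallelogram i u v : sel u -> sel v ->
  Int I (sq i (dif u v)) = 2 * Int I (sq i u) + 2 * Int I (sq i v) - 4 * Int I (sq i (mid u v)).
Proof.
move=> su sv; have iu := sel_sq_int i su; have iv := sel_sq_int i sv.
have im := sel_sq_int i (sel_mid su sv).
have i2u := integrableZ 2 mI iu; have i2v := integrableZ 2 mI iv.
have i4m := integrableZ 4 mI im.
rewrite -(RintegralZl 2 mI iu) -(RintegralZl 2 mI iv) -(RintegralZl 4 mI im).
rewrite -(RintegralD mI i2u i2v) -(RintegralB mI (integrableD mI i2u i2v) i4m).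
by apply: eq_Rintegral => t _; rewrite /sq co_dif co_mid; field.
Qed.

(** The squared norm of all normalised coordinates in a weighted sum of [L2] spaces, at most 2 on
    selections. *)
Let Q u := limn (series (fun i => (2 ^+ i)^-1 * Int I (sq i u))).

Let half_ge0 i : 0 <= (2 ^+ i : R)^-1. Proof. by rewrite invr_ge0 exprn_ge0. Qed.

Let Q_cvg u : sel u -> cvgn (series (fun i => (2 ^+ i)^-1 * Int I (sq i u))).
Proof.
move=> su; have sq1 i := sel_sq_le1 i su; apply: nondecreasing_is_cvgn.
  apply/nondecreasing_seqP => n; rewrite seriesSr lerDl mulr_ge0//.
  by case/andP: (sq1 n).
exists 2 => _ [n _ <-]; apply: le_trans (half_sum n); apply: ler_sum => i _.
by rewrite ler_piMr//; case/andP: (sq1 i).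
Qed.

Let Q_bound u : sel u -> 0 <= Q u <= 2.
Proof.
move=> su; have sq1 i := sel_sq_le1 i su; apply/andP; split.
  apply: limr_ge; first exact: Q_cvg.
  apply: nearW => n; apply: sumr_ge0 => i _; rewrite mulr_ge0//.
  by case/andP: (sq1 i).
apply: limr_le; first exact: Q_cvg.
apply: nearW => n; apply: le_trans (half_sum n); apply: ler_sum => i _.
by rewrite ler_piMr//; case/andP: (sq1 i).
Qed.

(** The parallelogram defect of [Q] is the weighted sum of the squared [L2] distances of the
    coordinates, so it bounds each weighted distance. *)
Let D_term u v i : sel u -> sel v ->
  (2 ^+ i)^-1 * Int I (sq i (dif u v)) <= 2 * Q u + 2 * Q v - 4 * Q (mid u v).
Proof.
move=> su sv; have sm := sel_mid su sv.
pose w j := (2 ^+ j)^-1 * Int I (sq j (dif u v)).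
have w0 j : 0 <= w j.
  by rewrite mulr_ge0//; apply: Rintegral_ge0 => t _; exact: sqr_ge0.
have wc : series w @ \oo --> 2 * Q u + 2 * Q v - 4 * Q (mid u v).
  rewrite (_ : series w = (fun n => 2 * series (fun i => (2 ^+ i)^-1 * Int I (sq i u)) n +
     2 * series (fun i => (2 ^+ i)^-1 * Int I (sq i v)) n -
     4 * series (fun i => (2 ^+ i)^-1 * Int I (sq i (mid u v))) n)); last first.
    apply/funext => n; rewrite /series/= !mulr_sumr -big_split/= -sumrB.
    by apply: eq_bigr => j _; rewrite /w parallelogram//; ring.
  by apply: cvgB; [apply: cvgD|]; apply: cvgMr; exact: Q_cvg.
have ndw : nondecreasing_seq (series w).
  by apply/nondecreasing_seqP => n; rewrite seriesSr lerDl.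
rewrite -(cvg_lim (@Rhausdorff R) wc).
apply: (@le_trans _ _ (series w i.+1)).
  by rewrite seriesSr lerDr sumr_ge0.
by apply: (nondecreasing_cvgn_le ndw); apply/cvg_ex; eexists; exact: wc.
Qed.

Lemma ae_cauchy_midpoints (A : nat -> set (R -> X)) :
  (forall n, A n !=set0) -> (forall n, A n.+1 `<=` A n) ->
  (forall n u v, A n u -> A n v -> A n (fun t => 2^-1 *: (u t + v t))) ->
  (forall u, A 0%N u -> sel u) ->
  exists g : nat -> R -> X, (forall j, A j (g j)) /\
    {ae mu, forall t, I t -> forall i, cvgn (fun j => xs i (g j t))}.
Proof.
move=> A0 AS Amid Asel.
(* The distance argument is the defect itself, which [D_term] converts to coordinate distances. The
   rate [4^-j] for squared [L2] distances leaves a geometric rate in [L1]. *)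
have [|||||g [Ag gD]] := @minimizing_sequence R (R -> X) A mid Q
  (fun u v => 2 * Q u + 2 * Q v - 4 * Q (mid u v)) 2 (fun j => (4 ^+ j)^-1) A0 AS.
- exact: Amid.
- by move=> u /Asel/Q_bound.
- by [].
- by move=> j; rewrite invr_gt0 exprn_gt0.
- move=> j; rewrite exprS invfM ler_piMl ?invr_ge0 ?exprn_ge0//.
  by rewrite invf_le1// ler1n.
have Ale j : A j `<=` A 0%N by elim: j => // j IH u /AS /IH.
have sg j : sel (g j) by apply: Asel; apply: (Ale j); exact: Ag.
exists g; split => //.
have sm i : {ae mu, forall t, I t ->
    cvgn (series (fun j => `|co i (dif (g j) (g j.+1)) t|))}.
  (* The integrand is at most [2^l] times its square plus [2^-l], and the squared distance is at
     most [2^i 4^-l], whence [(2^i + 1) 2^-l]. *)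
  apply: (@ae_summable (fun j t => `|co i (dif (g j) (g j.+1)) t|) (2 ^+ i + 1)).
  - move=> l; have md := dif_meas (sg l) (sg l.+1).
    apply: (integrable_dominated mI (@integrable_cst_I01 R I 2 mI (@subset_refl _ _))).
      by apply: measurableT_comp => //; exact: co_meas.
    by move=> t It; rewrite normr_id dif_le2.
  - by move=> l t _.
  - move=> l; have md := dif_meas (sg l) (sg l.+1).
    have isq := sq_int md (fun t It => dif_le2 i (sg l) (sg l.+1) It).
    have ic := @integrable_cst_I01 R I ((2 ^+ l)^-1) mI (@subset_refl _ _).
    have iz := integrableZ (2 ^+ l) mI isq.
    apply: (@le_trans _ _ (Int I (fun t => 2 ^+ l * sq i (dif (g l) (g l.+1)) t + (2 ^+ l)^-1))).
      apply: (le_Rintegral mI).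
      + apply: (integrable_dominated mI (@integrable_cst_I01 R I 2 mI (@subset_refl _ _))).
          by apply: measurableT_comp => //; exact: co_meas.
        by move=> t It; rewrite normr_id dif_le2.
      + exact: (integrableD mI iz ic).
      + move=> t It; rewrite /= /sq -real_normK ?num_real//.
        move: (normr_ge0 (co i (dif (g l) (g l.+1)) t)) => {It}.
        move: `|co i (dif (g l) (g l.+1)) t| => c c0.
        have l0 : 0 < (2 ^+ l : R) by rewrite exprn_gt0.
        (* AM-GM: [2 c <= a c^2 + 1 / a] *)
        have : 0 <= 2 ^+ l * c ^+ 2 - 2 * c + (2 ^+ l)^-1.
          have -> : 2 ^+ l * c ^+ 2 - 2 * c + (2 ^+ l)^-1 =
              (2 ^+ l)^-1 * (2 ^+ l * c - 1) ^+ 2.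
            by move: (2 ^+ l) l0 => a a0; field; rewrite gt_eqF.
          by rewrite mulr_ge0 ?sqr_ge0// invr_ge0 ltW.
        by lra.
    have hc : Int I (fun=> (2 ^+ l)^-1) = (2 ^+ l)^-1.
      transitivity ((2 ^+ l)^-1 * fine (mu I)); first exact: (Rintegral_cst mu mI).
      by rewrite mu_I01 mulr1.
    rewrite (RintegralD mI iz ic) (RintegralZl _ mI isq) hc.
    rewrite mulrDl mul1r lerD2r.
    have := le_trans (D_term i (sg l) (sg l.+1)) (gD l).
    rewrite mulrC ler_pdivrMr ?exprn_gt0// => h.
    apply: (@le_trans _ _ (2 ^+ l * ((4 ^+ l)^-1 * 2 ^+ i))); first by rewrite ler_wpM2l ?exprn_ge0.
    rewrite le_eqVlt; apply/orP; left; apply/eqP.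
    have -> : (4 ^+ l : R) = 2 ^+ l * 2 ^+ l by rewrite -exprMn; congr (_ ^+ l); ring.
    have : (2 ^+ l : R) != 0 by rewrite expf_neq0.
    by move: (2 ^+ l) (2 ^+ i) => a b a0; field.
apply: ae_mono (ae_foralln sm) => t ht It i.
have cn := ht i It; have /normed_cvg : cvgn [normed series (fun j =>
  co i (dif (g j) (g j.+1)) t)] by exact: cn.
have -> : (fun j => co i (dif (g j) (g j.+1)) t) = - telescope (fun j => co i (g j) t).
  by apply/funext => j; rewrite co_dif /telescope fctE opprB.
rewrite (_ : series _ = (fun n => - (co i (g n) t - co i (g 0%N) t))); last first.
  apply/funext => n; have := congr1 (@^~ n) (telescopeK (fun j => co i (g j) t)).
  by rewrite /= => <-; rewrite /series/= -sumrN.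
move=> /cvg_ex[l hl]; apply/cvg_ex.
exists ((co i (g 0%N) t - l) * (1 + envelope Gamma (xs i) t)).
rewrite (_ : (fun j => _) = (fun n => (co i (g 0%N) t -
    - (co i (g n) t - co i (g 0%N) t)) * (1 + envelope Gamma (xs i) t))); last first.
  apply/funext => n; rewrite opprK addrCA subrr addr0 /co divfK//.
  by rewrite gt_eqF.
by apply: cvgMl; apply: cvgB => //; exact: cvg_cst.
Qed.

End AlmostEverywhereCauchy.

(** * Passage to the limit *)

(** Midpoints are the only combinations that the parallelogram identity uses. They are formed on
    functions, so one combination acts at all times, and properties stable under midpoints pass to
    the hull by induction. *)
Inductive midhull (R : realType) (X : lmodType R) (B : set (R -> X)) : set (R -> X) :=
| midhull_sub u : B u -> midhull B u
| midhull_mid u v : midhull B u -> midhull B v ->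
    midhull B (fun t => 2^-1 *: (u t + v t)).

Lemma midhullS (R : realType) (X : lmodType R) (A B : set (R -> X)) :
  A `<=` B -> midhull A `<=` midhull B.
Proof.
move=> AB u; elim=> [v /AB|v w _ Bv _ Bw]; first exact: midhull_sub.
exact: midhull_mid.
Qed.

(** * Compactness of primitives, separating functionals, upper semicontinuity *)

Section Compactness.
Variables (R : realType) (X : lmodType R) (p : nat -> X -> R).
Hypothesis Xf : is_frechet p.
Variable Gamma : R -> set X.
Hypothesis Gck : forall t, I01 t -> ck p (Gamma t).
Hypothesis Gb : bochner_meas p Gamma.
Hypothesis Gp : pettis_ck p Gamma.
Local Notation mu := (@completed_lebesgue_measure R).
Local Notation I := (@I01 R : set (lebT R)).
Local Notation sel := (sel p Gamma).
Local Notation wint := (wint p).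
Variables (k : R -> R -> R) (M : R -> R).
Hypothesis kL : forall t, I01 t -> measurable_fun I (k t : lebT R -> R).
Hypothesis kM : forall t, I01 t -> {ae mu, forall s, I01 s -> `|k t s| <= M t}.
Hypothesis kc : kernel_cont k.
Local Notation ker := (ker k M).
Variable x0 : X.
Local Notation primitive := (primitive p k M x0).

Lemma dense_rat_I01 (t d : R) : I01 t -> 0 < d ->
  exists q : rat, I01 (ratr q : R) /\ `|t - ratr q| < d.
Proof.
rewrite /I01 /= in_itv/= => /andP[t0 t1] d0.
have /rat_in_itvoo[q] : Num.max 0 (t - d) < Num.min 1 (t + d).
  by rewrite lt_min !gt_max; apply/andP; split; apply/andP; split; lra.
rewrite in_itv/= gt_max lt_min => /andP[/andP[q0 tq] /andP[q1 qt]].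
exists q; rewrite in_itv/= !ltW//; split => //.
by rewrite ltr_norml; apply/andP; split; lra.
Qed.

(** Equicontinuity passes to the pointwise limit along [U], and [phi j] is chosen good at finitely
    many rationals, so a true subsequence converges everywhere. Evaluation points may move with [j],
    as the delayed arguments will. *)
Lemma primitive_subsequence (f x : nat -> R -> X) : (forall n, sel (f n)) ->
  (forall n, primitive (f n) (x n)) ->
  exists (phi : nat -> nat) (y : R -> X), [/\ forall j, (j <= phi j)%N, fcont01 p y &
    forall s (sj : nat -> R), I01 s -> (forall j, I01 (sj j)) -> sj @ \oo --> s ->
      sncvg p \oo (fun j => x (phi j) (sj j)) (y s)].
Proof.
move=> sf fx; have [U [UU Uoo]] := ultra_oo.
have hy t : exists y, I01 t -> sncvg p U (fun n => x n t) y.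
  have [It|nIt] := pselect (I01 t); last by exists 0.
  have [w wP [z wz]] := wint_ulim Xf Gck Gb Gp UU Uoo (ker_measurable M kL It)
    (fun s _ => ker_bounded k M t s) sf.
  exists (z + x0) => _ m e e0; apply: filterS (wz m e e0) => n /=.
  suff -> : w n = x n t - x0 by rewrite opprD addrA addrAC.
  by apply: (dual_separates Xf) => xs xd; rewrite (wP n xs xd) (fx n t It xs xd).
have [y yP] := choice hy.
have yeq t m (e : R) : I01 t -> 0 < e -> exists2 d : R, 0 < d &
    forall t', I01 t' -> `|t - t'| < d -> p m (y t - y t') <= e /\
      forall n, p m (x n t - x n t') <= e.
  move=> It e0.
  have [d d0 dP] := primitive_equicontinuous Xf Gck Gb Gp kL kM kc x0 m It e0.
  exists d => // t' It' tt'; have h n := dP t' (f n) (x n) It' tt' (sf n) (fx n).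
  split => //; apply/ler_addgt0Pl => e' e'0; have e'20 : 0 < e' / 2 by lra.
  have /filter_ex[n [/= h1 h2]] : U ([set n | p m (x n t - y t) < e' / 2] `&`
     [set n | p m (x n t' - y t') < e' / 2]).
    by apply: filterI; apply: yP.
  apply: le_trans (sn_tri Xf m (x n t) _ _) _; rewrite (snC Xf m (y t)).
  have := sn_tri Xf m (x n t') (x n t) (y t'); have := h n.
  by move: h1 h2; lra.
(* An enumeration containing all rationals; stage [j] controls the first [j.+1] entries in [p j]
   with error below [1 / (j + 1)]. *)
pose r i : R := if (unpickle i : option rat) is Some q then ratr q else 0.
have hphi j : exists n, (j <= n)%N /\ forall i, (i <= j)%N -> I01 (r i) ->
    p j (x n (r i) - y (r i)) < j.+1%:R^-1.
  have : U ([set n | forall i, i \in iota 0 j.+1 -> I01 (r i) ->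
      p j (x n (r i) - y (r i)) < j.+1%:R^-1] `&` [set n | (j <= n)%N]).
    apply: filterI; last by apply: Uoo; exists j.
    apply: filter_seq => i _.
    have [Ir|nIr] := pselect (I01 (r i)); last first.
      by apply: (@filterS _ U _ setT) => [n _ /nIr//|]; exact: filterT.
    have j0 : 0 < j.+1%:R^-1 :> R by rewrite invr_gt0.
    by apply: filterS (yP _ Ir j _ j0) => n hn _.
  move=> /filter_ex[n [hn jn]]; exists n; split => // i ij; apply: hn.
  by rewrite mem_iota.
have [phi phiP] := choice hphi; exists phi, y; split.
- by move=> j; case: (phiP j).
- move=> t It e e0; have [m [d d0 dP]] := fdist_lt_sn Xf e0.
  have d20 : 0 < d / 2 by lra.
  have [a a0 aP] := yeq t m _ It d20; exists a; split => // s Is st; apply: dP.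
  rewrite distrC in st; rewrite (snC Xf); have [h _] := aP s Is st.
  by apply: le_lt_trans h _; lra.
(* Four errors of at most [e / 8]: from [sj j] to [s], from [s] to a rational [q], from [x (phi j)]
   to [y] at [q], and back to [s]. *)
- move=> s sj Is Isj sjs m e e0; have e80 : 0 < e / 8 by lra.
  have [d d0 dP] := yeq s m _ Is e80.
  have [q [Iq sq]] := dense_rat_I01 Is d0.
  have rq : r (pickle q) = ratr q by rewrite /r pickleK.
  have [N1 _ N1P] := near_infty_natSinv_lt (PosNum e80).
  have /cvgrPdist_lt/(_ d d0)[N2 _ N2P] := sjs.
  exists (maxn (pickle q) (maxn m (maxn N1 N2))) => // j /=; rewrite !geq_max.
  move=> /and4P[qj mj N1j N2j]; have [_ /(_ _ qj)] := phiP j; rewrite rq => /(_ Iq) hq.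
  have /= hj := lt_trans hq (N1P _ N1j).
  have {}hj := le_lt_trans (sn_le Xf _ mj) hj.
  have [_ /(_ (phi j)) h1] := dP _ (Isj j) (N2P _ N2j).
  have [h2 /(_ (phi j)) h3] := dP _ Iq sq.
  apply: le_lt_trans (sn_tri Xf m (x (phi j) s) _ _) _.
  have h4 := sn_tri Xf m (x (phi j) (ratr q)) (x (phi j) s) (y s).
  have h5 := sn_tri Xf m (y (ratr q)) (x (phi j) (ratr q)) (y s).
  move: h1 h2 h3 h4 h5; rewrite (snC Xf m (x (phi j) s) (x (phi j) (sj j))).
  rewrite (snC Xf m (y s)) => h1 h2 h3 h4 h5.
  by lra.
Qed.

(** One norming functional is taken for each difference of two points of the countable set and each
    seminorm. If all agree on [y] and [z], approximating these by [D a] and [D b] makes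
    [p m (D a - D b)] small, hence [p m (y - z)]. *)
Lemma separating_functionals : exists xs : nat -> X -> R, (forall i, dual p (xs i)) /\
  {ae mu, forall t, I01 t -> forall y z, Gamma t y -> Gamma t z ->
    (forall i, xs i y = xs i z) -> y = z}.
Proof.
have G0 t : I01 t -> Gamma t !=set0 /\ fcompact p (Gamma t) by move=> /Gck[].
have [D Dae] := bochner_separable Xf Gb G0.
have h (abm : nat * nat * nat) : exists f, polar p abm.2 f /\
    f (D abm.1.1 - D abm.1.2) = p abm.2 (D abm.1.1 - D abm.1.2).
  by have [f fp fE] := norming_functional Xf abm.2 (D abm.1.1 - D abm.1.2); exists f.
have [f fP] := choice h.
exists (fun i => if (unpickle i : option (nat * nat * nat)) is Some abm then f abm
  else fun=> 0); split.
  by move=> i; case: unpickle => [abm|]; [exact: (polar_dual Xf (fP abm).1)|exact: dual0].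
apply: ae_mono Dae => t Dt It y z Gy Gz yz.
apply/eqP; rewrite -subr_eq0; apply/eqP; apply: (sn_eq0 Xf) => m e e0.
have e40 : 0 < e / 4 by lra.
have [d d0 dP] := sn_lt_fdist Xf m e40.
have [a /dP ya] := Dt It y Gy d d0; have [b /dP zb] := Dt It z Gz d d0.
have := yz (pickle (a, b, m)); rewrite pickleK => fyz.
have [[lf fp] /= fE] := fP (a, b, m).
have h1 := le_trans (ler_norm _) (fp (y - D a)).
have h2 := le_trans (ler_norm _) (fp (- (y - D a))).
have h3 := le_trans (ler_norm _) (fp (z - D b)).
move: h1 h2 h3 fE; rewrite !snN// !(linfN _ lf) !(linfB _ _ lf) => h1 h2 h3 fE.
have h4 := sn_tri Xf m (D a) y z; have h5 := sn_tri Xf m (D b) (D a) z.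
move: h4 h5 ya zb; rewrite (snC Xf m (D b) z) => h4 h5 ya zb.
by lra.
Qed.

Variable F : R -> X -> set X.
Hypothesis Fck : forall t x, I01 t -> ck p (F t x).
Hypothesis Fu : forall t, I01 t -> usc p (F t).

Let mid_enlargement_open K m (e : R) : fopen p [set w | exists2 z, K z & p m (w - z) < e].
Proof.
apply: (fopen_sn Xf) => w [z Kz wz]; exists m, (e - p m (w - z)); first by rewrite subr_gt0.
move=> v vw; exists z => //; apply: le_lt_trans (sn_tri Xf m w _ _) _.
by rewrite -ltrBrDr.
Qed.

Let mid_enlargement K m (e : R) u v : Defs.convex_set K ->
  (exists2 z, K z & p m (u - z) < e) -> (exists2 z, K z & p m (v - z) < e) ->
  exists2 z, K z & p m (2^-1 *: (u + v) - z) < e.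
Proof.
move=> Kc [a Ka ua] [b Kb vb]; exists (2^-1 *: a + (1 - 2^-1) *: b).
  by apply: (Kc a b 2^-1 Ka Kb); rewrite invr_ge0 ler0n/= invf_le1// ler1n.
rewrite (_ : 1 - 2^-1 = 2^-1 :> R); last by field.
rewrite -scalerDr -scalerBr opprD addrACA snZ// ger0_norm ?invr_ge0//.
by have := snD Xf m (u - a) (v - b); lra.
Qed.

(** Upper semicontinuity puts the tail values in an open enlargement of [F s x]; convexity makes the
    enlargement stable under midpoints, and compactness makes [F s x] closed. *)
Lemma usc_midhull_limit s (f : nat -> R -> X) (g : nat -> R -> X) (xl : nat -> X) x y :
  I01 s -> sncvg p \oo xl x -> (forall j, F s (xl j) (f j s)) ->
  (forall j, midhull [set u | exists2 i, (j <= i)%N & u = f i] (g j)) ->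
  sncvg p \oo (fun j => g j s) y -> F s x y.
Proof.
move=> Is xlx fF gA gy; have [U [UU Uoo]] := ultra_oo.
have [_ Fc Fconv] := Fck x Is.
apply: (compact_closed Xf UU Uoo Fc) => m e e0; have e20 : 0 < e / 2 by lra.
pose V := [set w | exists2 z, F s x z & p m (w - z) < e / 2].
have FV : F s x `<=` V by move=> z Fz; exists z => //; rewrite subrr sn0.
have [d [d0 dP]] := Fu Is (@mid_enlargement_open _ m (e / 2)) FV.
have [N1 _ N1P] := sncvg_fdist Xf _ xlx d0.
have [N2 _ N2P] := gy m _ e20.
pose n := maxn N1 N2.
have AV u : midhull [set u | exists2 i, (n <= i)%N & u = f i] u -> V (u s).
  elim=> [w [i ni ->]|w v _ Vw _ Vv]; last exact: mid_enlargement.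
  apply: (dP (xl i)); last exact: fF.
  rewrite fdistC//; apply: N1P => /=; exact: leq_trans (leq_maxl _ _) ni.
have [z Fz gz] := AV _ (gA n); exists z => //.
apply: le_lt_trans (sn_tri Xf m (g n s) _ _) _; rewrite (snC Xf m z).
by have /= := N2P n (leq_maxr _ _); lra.
Qed.

End Compactness.

(** * Identification of the limit selection *)

Section Limit.
Variables (R : realType) (X : lmodType R) (p : nat -> X -> R).
Hypothesis Xf : is_frechet p.
Variable Gamma : R -> set X.
Hypothesis Gck : forall t, I01 t -> ck p (Gamma t).
Hypothesis Gb : bochner_meas p Gamma.
Hypothesis Gp : pettis_ck p Gamma.
Local Notation mu := (@completed_lebesgue_measure R).
Local Notation I := (@I01 R : set (lebT R)).
Local Notation Int D u := (Rintegral mu (D : set (lebT R)) (u : lebT R -> R)).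
Local Notation sel := (sel p Gamma).
Local Notation wint := (wint p).

Let mI := @measurable_I01 R.

(** Closeness of the weighted integral to [c] is a convex condition on the selection, hence stable
    under midpoints. *)
Lemma midhull_wint h N xs c (e : R) (B : set (R -> X)) :
  measurable_fun I (h : lebT R -> R) -> (forall t, I01 t -> `|h t| <= N) -> dual p xs ->
  (forall u, B u -> sel u /\ `|Int I (fun t => h t * xs (u t)) - c| <= e) ->
  forall u, midhull B u -> sel u /\ `|Int I (fun t => h t * xs (u t)) - c| <= e.
Proof.
move=> mh hN xd hB u; elim=> [//|v w _ [sv hv] _ [sw hw]].
split; first exact: (sel_mid Gck).
have iv := sel_bddM Xf Gck Gp mh hN sv xd; have iw := sel_bddM Xf Gck Gp mh hN sw xd.
have -> : (fun t => h t * xs (2^-1 *: (v t + w t))) =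
    (fun t => 2^-1 * (h t * xs (v t) + h t * xs (w t))).
  apply/funext => t; rewrite (linfZ _ _ (dual_linf xd)) (linfD _ _ (dual_linf xd)).
  by rewrite -mulrDr mulrCA.
rewrite (RintegralZl _ mI (integrableD mI iv iw)) (RintegralD mI iv iw).
by move: hv hw; rewrite !ler_norml => /andP[v1 v2] /andP[w1 w2]; apply/andP; split; lra.
Qed.

Variable F : R -> X -> set X.
Hypothesis Fck : forall t x, I01 t -> ck p (F t x).
Hypothesis Fu : forall t, I01 t -> usc p (F t).
Hypothesis FG : forall t x, I01 t -> F t x `<=` Gamma t.

(** Midpoints of tails inherit any limit of the weighted integrals and converge almost everywhere
    themselves, so dominated convergence gives the integrals of [g]. Quantifying over [h] after [g]
    lets one [g] serve the kernels of all times. *)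
Lemma inclusion_limit (f xl : nat -> R -> X) (x : R -> X) : (forall j, sel (f j)) ->
  (forall s, I01 s -> sncvg p \oo (xl ^~ s) (x s)) ->
  (forall j s, I01 s -> F s (xl j s) (f j s)) ->
  exists g, [/\ sel g, forall s, I01 s -> F s (x s) (g s) &
    forall h N y, measurable_fun I (h : lebT R -> R) -> (forall t, I01 t -> `|h t| <= N) ->
      (forall xs, dual p xs -> (fun j => Int I (fun t => h t * xs (f j t))) @ \oo --> xs y) ->
      wint h g y].
Proof.
move=> sf xlx fF; have [xs [xd xsep]] := separating_functionals Xf Gck Gb.
pose A j := midhull [set u | exists2 i, (j <= i)%N & u = f i].
have AS j : A j.+1 `<=` A j.
  by apply: midhullS => _ [i ji ->]; exists i => //; exact: ltnW.
have Asel j u : A j u -> sel u.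
  by elim=> [_ [i _ ->]//|v w _ sv _ sw]; exact: (sel_mid Gck).
have A0 j : A j !=set0 by exists (f j); apply: midhull_sub; exists j.
have [v [Av vc]] := ae_cauchy_midpoints Xf Gck Gp xd A0 AS (fun j u w => @midhull_mid _ _ _ u w)
  (Asel 0%N).
have sv j := Asel j (v j) (Av j).
(* On the exceptional null set any point of [F s (x s)] is taken, so that membership holds
   everywhere. *)
have hg s : exists z, I01 s -> F s (x s) z /\
    ((exists y, sncvg p \oo (v ^~ s) y /\ F s (x s) y) -> sncvg p \oo (v ^~ s) z).
  have [[y [vy Fy]]|no] := pselect (exists y, sncvg p \oo (v ^~ s) y /\ F s (x s) y).
    by exists y.
  have [Is|nIs] := pselect (I01 s); last by exists 0.
  by have [[z Fz] _ _] := Fck (x s) Is; exists z.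
have [g gP] := choice hg.
have gae : {ae mu, forall s, I01 s -> sncvg p \oo (v ^~ s) (g s)}.
  apply: ae_mono (ae_setI vc xsep) => s [vs sep] Is; apply: (gP s Is).2.
  have [U [UU Uoo]] := ultra_oo.
  have Gc : fcompact p (Gamma s) by case: (Gck Is).
  have [y _ vy] := compact_cvg Xf UU Uoo Gc (fun j => (sv j).1 s Is) xd (vs Is) (sep Is).
  exists y; split => //.
  exact: (usc_midhull_limit Xf Fck Fu Is (xlx s Is) (fun j => fF j s Is) Av vy).
have sg : sel g.
  split=> [s Is|ys yd]; first exact: FG (gP s Is).1.
  apply: (@measurable_fun_ae_cvg _ _ (fun j t => ys (v j t)) _ mI).
    by move=> j; exact: (sv j).2.
  by apply: ae_mono gae => s vs Is; exact: (dual_cvg Xf _ yd (vs Is)).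
exists g; split=> // [s Is|h N y mh hN hy ys yd]; first exact: (gP s Is).1.
have mhs u : sel u -> measurable_fun I (fun t : lebT R => h t * ys (u t)).
  by move=> su; apply: measurable_funM => //; exact: su.2.
have ienv := integrableZ N mI (envelope_integrable Gp yd).
have c1 : (fun j => Int I (fun t => h t * ys (v j t))) @ \oo --> Int I (fun t => h t * ys (g t)).
  apply: (Rintegral_dominated_cvg mI (fun j => mhs _ (sv j)) (mhs _ sg) _ ienv).
    by apply: ae_mono gae => s vs Is; apply: cvgMr; exact: (dual_cvg Xf _ yd (vs Is)).
  move=> j t It; rewrite normrM; apply: ler_pM => //; first exact: hN.
  by apply: (le_envelope Xf Gck) => //; exact: (sv j).1.
suff c2 : (fun j => Int I (fun t => h t * ys (v j t))) @ \oo --> ys y.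
  exact: (cvg_unique (@Rhausdorff R) c2 c1).
apply/cvgrPdist_le => e e0; have /cvgrPdist_le/(_ e e0)[n _ nP] := hy ys yd.
exists n => // j nj; rewrite distrC.
apply: (proj2 (midhull_wint mh hN yd _ (Av j))) => _ [i ji ->]; split; first exact: sf.
by rewrite distrC; apply: nP => /=; exact: leq_trans nj ji.
Qed.

End Limit.

Theorem theorem5p2 (R : realType) (X : lmodType R) (p : nat -> X -> R)
  (x0 : X) (Gamma : R -> set X) (F : R -> X -> set X) (k : R -> R -> R) :
  is_frechet p ->
  (forall t, I01 t -> ck p (Gamma t)) ->
  bochner_meas p Gamma ->
  pettis_ck p Gamma ->
  (forall t x, I01 t -> ck p (F t x)) ->
  (forall x : R -> X, fcont01 p x -> bochner_meas p (fun t => F t (x t))) ->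
  (forall t, I01 t -> usc p (F t)) ->
  (forall t x, I01 t -> F t x `<=` Gamma t) ->
  (forall t, I01 t -> Linf01 (k t)) ->
  kernel_cont k ->
  exists x : R -> X, fcont01 p x /\
    forall t, I01 t -> exists y, vint p k F x t y /\ x t = x0 + y.
Proof.
move=> Xf Gck Gb Gp Fck Fb Fu FG kLinf kc.
have kL t (It : I01 t) := (kLinf t It).1.
have hM t : exists M : R, I01 t ->
    {ae @completed_lebesgue_measure R, forall s, I01 s -> `|k t s| <= M}.
  have [It|nIt] := pselect (I01 t); last by exists 0.
  by have [_ [M MP]] := kLinf t It; exists M.
have [M kM] := choice hM.
have hs (n : nat) : exists fx : (R -> X) * (R -> X), [/\ sel p Gamma fx.1,
    primitive p k M x0 fx.1 fx.2 &
    forall s, I01 s -> F s (fx.2 (delay n.+1%:R^-1 s)) (fx.1 s)].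
  have n0 : 0 < n.+1%:R^-1 :> R by rewrite invr_gt0.
  by have [f [x fxP]] := delayed_solution Xf Gck Gb Gp kL kM kc x0 Fck Fb FG n0; exists (f, x).
have [fx fxP] := choice hs.
have sf n : sel p Gamma (fx n).1 by case: (fxP n).
have pf n : primitive p k M x0 (fx n).1 (fx n).2 by case: (fxP n).
have [phi [x [phij cx xP]]] := primitive_subsequence Xf Gck Gb Gp kL kM kc sf pf.
have dI j (s : R) : I01 s -> I01 (delay (phi j).+1%:R^-1 s).
  by apply: delay_I01; rewrite invr_ge0.
have dcvg (s : R) : I01 s -> (fun j => delay (phi j).+1%:R^-1 s) @ \oo --> s.
  move=> Is; apply/cvgrPdist_lt => e e0.
  have [N _ NP] := near_infty_natSinv_lt (PosNum e0).
  exists N => // j Nj; apply: le_lt_trans (NP (phi j) _).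
    by apply: delay_close => //; rewrite invr_ge0.
  exact: leq_trans Nj (phij j).
(* The delayed functions converge pointwise to [x] because [primitive_subsequence] allows moving
   evaluation points. *)
have [g [sg gF gw]] := inclusion_limit Xf Gck Gb Gp Fck Fu FG (fun j => sf (phi j))
  (fun s Is => xP s _ Is (fun j => dI j s Is) (dcvg s Is))
  (fun j s Is => let: And3 _ _ h := fxP (phi j) in h s Is).
exists x; split => // t It; exists (x t - x0); split; last by rewrite addrC subrK.
have mE := @measurable_itv_lebT R `[0, t]; have EI := itv0_I01 It.
exists g; split.
- exact: (sel_pettis_integrable Xf Gck Gp sg).
- by apply: aeW => s; exact: gF.
- exact: (cutoff_pettis_integrable Xf Gck Gb Gp mE EI (kL t It) (kM t It) sg).
apply: (wint_cutoff_pettis Xf Gck Gp mE EI (kL t It) (kM t It) sg).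
(* With the cut-off kernel at [t] as weight, the integrals of the delayed selections are the values
   at [t] of their primitives minus [x0], which converge to [x t - x0]. *)
apply: gw => [||xs xd].
- exact: (ker_measurable M kL It).
- by move=> s _; exact: (ker_bounded k M t s).
have -> : (fun j => Rintegral (@completed_lebesgue_measure R) (@I01 R : set (lebT R))
    (fun s => cutoff `[0, t] (k t) (M t) s * xs ((fx (phi j)).1 s))) =
    (fun j => xs ((fx (phi j)).2 t - x0)).
  by apply/funext => j; rewrite (pf (phi j) t It xs xd).
have xt : sncvg p \oo (fun j => (fx (phi j)).2 t) (x t).
  by apply: (xP t (fun=> t) It (fun=> It)); exact: cvg_cst.
apply: (dual_cvg Xf _ xd) => m e e0; have [N _ NP] := xt m e e0.
by exists N => // j /NP /=; rewrite opprB addrA subrK.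
Qed.
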